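(* Let $g\ge 2$ be an integer. Consider the Diophantine equation $$F_k=d_1\frac{g^\ell-1}{g-1}\cdot d_2\frac{g^m-1}{g-1}\cdot d_3\frac{g^n-1}{g-1}$$ in positive integers $k,d_1,d_2,d_3,\ell,m,n$ with $1\le d_1,d_2,d_3\le g-1$, $n\ge 1$ and $\ell\le m\le n$. This equation has only finitely many solutions. Namely, every solution satisfies $$\ell\le m\le n<1.08\times 10^{48}\log^9 g\quad\text{and}\quad k<1.08\times 10^{49}\log^{10} g.$$
   Context: $(F_n)_{n\ge 0}$ is the Fibonacci sequence: $F_0=0$, $F_1=1$, $F_{n+2}=F_{n+1}+F_n$. $\log$ denotes the natural logarithm. A repdigit in base $g$ is a number of the form $d\,\frac{g^m-1}{g-1}$ with $m\ge1$ and $1\le d\le g-1$. *)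

(* Defs.v *)
From Stdlib Require Import Reals Arith.

Fixpoint fib (n : nat) : nat :=
  match n with
  | 0 => 0
  | S n' => match n' with
            | 0 => 1
            | S n'' => fib n' + fib n''
            end
  end.

(* Repdigit d (g^m - 1)/(g - 1) in base g; the division is exact for g >= 2. *)
Definition repdigit (g d m : nat) : nat := d * ((g ^ m - 1) / (g - 1)).

(* Main.v *)
(** Let phi be the golden ratio and lambda = log g. By Binet's formula the
    equation says that phi^k is nearly gamma g^N, where gamma is sqrt 5 times a
    rational number; the rational number may absorb none, one or two of the
    factors g^l - 1, g^m - 1, g^n - 1. Hence k log phi - N lambda - log gamma is
    of size about g^(-l), g^(-m), g^(-n) respectively, and a lower bound for
    such forms bounds l, then m in terms of l, then n in terms of l + m.

    The lower bound comes from an interpolation determinant. Consider the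
    functions C(x, i) C(y, j) Y^b (i + j < K, b < L) at the points x = u + k w,
    y = v + N w, Y = phi^u g^(-v) gamma^w. If the linear form is tiny, then Y is
    nearly exp (x log phi - y lambda), so that all functions nearly depend on two
    variables only and every determinant of their values is very small. Up to
    known factors it is an algebraic integer of Q(sqrt 5) with a conjugate of
    bounded size, so it vanishes.

    Not all these determinants vanish, by a zero estimate. A determinant of L
    translates in u eliminates Y from a linear relation between the functions
    and leaves a plane curve. Either its translates have no common component,
    and Bezout's theorem bounds their common zeros, or all translates of one
    component divide it, and then some form a x + b y with coprime a, b takes few
    values on a box of points. In the second case phi^b g^(-a) is close to 1 and
    the linear form reduces to one in the two logarithms of phi^b g^(-a) and of a
    modified gamma, to which the same method applies with a single x. *)

Require Import Defs.
From Stdlib Require Import Reals Arith.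
From Stdlib Require Import ZArith Lra Lia Psatz.

Module Determinants.

From Stdlib Require Import Classical_Prop.
From HB Require Import structures.
From mathcomp Require Import all_boot all_order all_fingroup all_algebra.
From mathcomp Require Import zify ring lra.
From mathcomp Require Import Rstruct.
Set Implicit Arguments.
Unset Strict Implicit.
Unset Printing Implicit Defensive.
Import Order.TTheory GRing.Theory Num.Theory.
Import Pdiv.Idomain.
Local Open Scope ring_scope.

(** * Determinants of algebraic integers of the golden field *)

(** Smallness comes from counting monomials. In the coordinates [x] and [t = x log phi - y lambda] a
    function is nearly a polynomial of degree below [K] in [x] with coefficients that are power
    series in [t]. Each power of [t] thus occurs in only [K] monomials, and a determinant of [K n]
    rows gains a factor [rho^(K n (n - 1) / 2)] over its trivial bound; [rho] is 4 throughout.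
    Against this gain stand the logarithms of the clearing factors and a cost of at most [log k] per
    degree in [x] or [y], which forces [L] to be of order [log k]. The resulting bound is
    [log |form| >= - C lambda A L^3], where [A = (s + 6 L) lambda] bounds the height of gamma and
    [s] is 0, [l], [l + m] in turn. The summand [6 L lambda] lets [A] absorb the powers of phi that
    the case of two logarithms moves into gamma. Three rounds give [n <= C' lambda^3 L^10]; the
    surplus [lambda^6] in the stated bound leaves room for the dependence of [L] on [log lambda]. *)

Lemma det_row_sum (R : comRingType) (T : finType) (M : nat)
    (G : 'I_M -> T -> 'I_M -> R) :
  \det (\matrix_(r, j) \sum_s G r s j) =
  \sum_(h : {ffun 'I_M -> T}) \det (\matrix_(r, j) G r (h r) j).
Proof.
rewrite exchange_big /=; apply: eq_bigr => p _.
rewrite -mulr_sumr; congr (_ * _).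
under eq_bigr => i _ do rewrite mxE.
rewrite bigA_distr_bigA /=; apply: eq_bigr => h _.
by apply: eq_bigr => i _; rewrite mxE.
Qed.

Lemma det_norm_le (R : realFieldType) (M : nat) (F : 'M[R]_M) (c : 'I_M -> R) :
  (forall r j, `|F r j| <= c r) -> `|\det F| <= M`!%:R * \prod_r c r.
Proof.
move=> Fc; apply: le_trans (ler_norm_sum _ _ _) _.
rewrite -[M`!]card_Sn mulr_natl -sumr_const; apply: ler_sum => p _.
rewrite normrM normrX normrN1 expr1n mul1r normr_prod.
by apply: ler_prod => i _; rewrite normr_ge0 Fc.
Qed.

(** The scalars may vanish, so they are pulled out by multilinearity, one row at a time, until two
    rows coincide. *)
Lemma det_eq_scaled_rows (R : comRingType) (M : nat) (F : 'M[R]_M)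
    (r1 r2 : 'I_M) (a1 a2 : R) (v : 'I_M -> R) :
  r1 != r2 -> (forall j, F r1 j = a1 * v j) -> (forall j, F r2 j = a2 * v j) ->
  \det F = 0.
Proof.
move=> ne F1 F2.
pose F' := \matrix_(i, j) if i == r1 then v j else F i j.
have -> : \det F = a1 * \det F' + 0 * \det F.
  apply: (determinant_multilinear (i0 := r1)).
  - by apply/rowP=> j; rewrite !mxE eqxx F1 mul0r addr0.
  - by apply/matrixP=> i j; rewrite !mxE eq_sym (negPf (neq_lift _ _)).
  - by apply/matrixP=> i j; rewrite !mxE.
rewrite mul0r addr0.
pose F'' := \matrix_(i, j) if i == r2 then v j else F' i j.
have -> : \det F' = a2 * \det F'' + 0 * \det F'.
  apply: (determinant_multilinear (i0 := r2)).
  - by apply/rowP=> j; rewrite !mxE eqxx eq_sym (negPf ne) F2 mul0r addr0.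
  - by apply/matrixP=> i j; rewrite !mxE [_ == r2]eq_sym (negPf (neq_lift _ _)).
  - by apply/matrixP=> i j; rewrite !mxE.
rewrite (determinant_alternate ne) ?mulr0 ?mul0r ?addr0 ?mulr0 //.
by move=> j; rewrite !mxE !eqxx (negPf ne).
Qed.

Lemma sum_nat_ltn (n w : nat) : (\sum_(m < n) (m < w) = minn n w)%N.
Proof. by elim: n => [|n IH]; rewrite ?big_ord0 ?min0n // big_ord_recr /= IH; lia. Qed.

Lemma card_pred_sum (T : finType) (P : pred T) :
  #|[pred x | P x]| = (\sum_x P x)%N.
Proof. by rewrite -sum1_card big_mkcond; apply: eq_bigr => x _; rewrite inE; case: (P x). Qed.

Lemma card_ord_pair_le (I n m : nat) :
  (m < n)%N -> #|[pred s : 'I_I * 'I_n | (s.2 <= m)%N]| = (I * m.+1)%N.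
Proof.
move=> mn.
have -> : #|[pred s : 'I_I * 'I_n | (s.2 <= m)%N]| =
          #|setX [set: 'I_I] [set j : 'I_n | (j <= m)%N]|.
  by apply: eq_card => -[i j]; rewrite !inE.
rewrite cardsX cardsT card_ord; congr (_ * _)%N.
rewrite -(card_ord m.+1) -(card_image (f := widen_ord mn)); last first.
  by move=> i j /(congr1 val) /= /val_inj.
apply: eq_card => j; rewrite !inE; apply/idP/imageP => [jm|[i _ ->]].
  have jm' : (j < m.+1)%N by [].
  by exists (Ordinal jm') => //; apply: val_inj.
by rewrite /= -ltnS.
Qed.

(** Layer by layer: at most [I (m + 1)] of the [I n] rows have weight at most [m], so at least
    [I (n - m - 1)] exceed it; summing over [m < n] gives the bound. Rows sent to [None] count with
    the weight [n]. *)
Lemma weight_sum_ge (I n : nat) (h : 'I_(I * n) -> option ('I_I * 'I_n)) :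
  (forall r1 r2 s, h r1 = Some s -> h r2 = Some s -> r1 = r2) ->
  (I * 'C(n, 2) <= \sum_r oapp (fun s : 'I_I * 'I_n => s.2 : nat) n (h r))%N.
Proof.
move=> hinj; pose wt (s : option ('I_I * 'I_n)) := oapp (fun s : 'I_I * 'I_n => s.2 : nat) n s.
have wtn s : (wt s <= n)%N by case: s => [[i j]|] //=; rewrite ltnW.
have wtE s : wt s = (\sum_(m < n) (m < wt s))%N.
  by rewrite sum_nat_ltn; apply/esym/minn_idPr.
rewrite (eq_bigr (fun r => \sum_(m < n) (m < wt (h r)))%N); last by move=> r _; exact: wtE.
rewrite exchange_big /=.
have step (m : 'I_n) : (I * n - I * m.+1 <= \sum_(r < I * n) (m < wt (h r)))%N.
  rewrite -card_pred_sum.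
  have := cardC [pred r | (m < wt (h r))%N]; rewrite card_ord => eqM.
  rewrite leq_subLR -[X in (X <= _)%N]eqM addnC leq_add2r.
  rewrite -(card_ord_pair_le I (ltn_ord m)).
  pose d : 'I_(I * n) -> option ('I_I * 'I_n) := h.
  have -> : #|[predC [pred r | (m < wt (h r))%N]]| =
            #|[seq h r | r in [predC [pred r | (m < wt (h r))%N]]]|.
    rewrite card_in_image // => r1 r2; rewrite !inE -!leqNgt => h1 h2.
    case e: (h r1) h1 => [s|] /=; last by rewrite leqNgt ltn_ord.
    by move=> _ e'; apply: (hinj _ _ s).
  rewrite -[X in (_ <= X)%N](card_image (f := Some)) => [|x y []//].
  apply: subset_leq_card; apply/subsetP => s /imageP [r]; rewrite inE -leqNgt => hr ->.
  case e: (h r) hr => [s'|] /=; last by rewrite leqNgt ltn_ord.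
  by move=> le; apply/imageP; exists s'.
apply: (@leq_trans (\sum_(m < n) (I * n - I * m.+1))%N); last first.
  by apply: leq_sum => m _; exact: step.
under eq_bigr => m _ do rewrite -mulnBr.
rewrite -big_distrr /= leq_mul2l; apply/orP; right.
rewrite (reindex_inj rev_ord_inj) /=.
under eq_bigr => m _ do (rewrite subnSK // subKn ?(ltnW (ltn_ord m)) //).
by rewrite -(big_mkord xpredT (fun m => m)) bin2_sum.
Qed.

(* Each row splits into monomials of weight [m < n] (at most [I] of each
   weight) and an error of weight [n]; two rows that select the same monomial
   are proportional, so every surviving term has total weight at least
   [I n (n-1) / 2]. *)
Lemma det_small (R : realFieldType) (I n : nat)
    (A : 'I_(I * n) -> 'I_I * 'I_n -> R) (B : 'I_I * 'I_n -> 'I_(I * n) -> R)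
    (E : 'I_(I * n) -> 'I_(I * n) -> R)
    (a : 'I_(I * n) -> 'I_I * 'I_n -> R) (C : 'I_(I * n) -> R) (rho : R) :
  1 <= rho ->
  (forall r s j, `|A r s * B s j| <= a r s) ->
  (forall r, \sum_s a r s * rho ^+ s.2 <= C r) ->
  (forall r j, `|E r j| * rho ^+ n <= C r) ->
  `|\det (\matrix_(r, j) (\sum_s A r s * B s j + E r j))| * rho ^+ (I * 'C(n, 2))
    <= (I * n)`!%:R * \prod_r (2 * C r).
Proof.
move=> rho1 Aa aC EC; set M := (I * n)%N.
have rho0 : 0 < rho by apply: lt_le_trans rho1.
have C0 r : 0 <= C r.
  by apply: le_trans (EC r r); rewrite mulr_ge0 // exprn_ge0 // ltW.
pose T := option ('I_I * 'I_n).
pose G r (s : T) j := if s is Some s' then A r s' * B s' j else E r j.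
pose wt (s : T) := oapp (fun s : 'I_I * 'I_n => s.2 : nat) n s.
pose g r (s : T) := if s is Some s' then a r s' else C r * rho ^- n.
have optE (r : 'I_M) (f : T -> R) : \sum_s f s = \sum_s' f (Some s') + f None.
  rewrite (bigD1 None) //= addrC; congr (_ + _).
  rewrite (reindex_omap Some id) //=; last by case.
  by apply: eq_bigl => s; rewrite eqxx.
have -> : \matrix_(r, j) (\sum_s A r s * B s j + E r j) =
          \matrix_(r, j) \sum_(s : T) G r s j.
  by apply/matrixP => r j; rewrite !mxE optE.
rewrite det_row_sum -ler_pdivlMr ?exprn_gt0 //.
apply: le_trans (ler_norm_sum _ _ _) _.
have Gg r s j : `|G r s j| <= g r s.
  case: s => [s|] //=; by rewrite ler_pdivlMr ?exprn_gt0.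
have g0 r s : 0 <= g r s by apply: le_trans (Gg r s r).
have term (h : {ffun 'I_M -> T}) :
  `|\det (\matrix_(r, j) G r (h r) j)| <=
   M`!%:R * (\prod_r (g r (h r) * rho ^+ wt (h r))) / rho ^+ (I * 'C(n, 2)).
  have [hinj|] := boolP [forall r1, forall r2, (h r1 == h r2) && (h r1 != None) ==> (r1 == r2)].
    apply: (@le_trans _ _ (M`!%:R * \prod_r g r (h r))).
      by apply: det_norm_le => r j; rewrite mxE.
    rewrite big_split /= -mulrA -mulrA; apply: ler_wpM2l => //.
    rewrite -[X in X <= _]mulr1; apply: ler_wpM2l; first exact: prodr_ge0.
    rewrite ler_pdivlMr ?exprn_gt0 // mul1r.
    rewrite -(big_morph _ (exprD rho) (expr0 rho)); apply: ler_weXn2l => //.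
    apply: weight_sum_ge => r1 r2 s h1 h2.
    move/forallP: hinj => /(_ r1) /forallP /(_ r2).
    by rewrite h1 h2 eqxx /= => /eqP.
  rewrite negb_forall => /existsP [r1]; rewrite negb_forall => /existsP [r2].
  rewrite negb_imply => /andP[/andP[/eqP h12 hN] ne].
  case hs: (h r1) hN => [s|] // _.
  rewrite (@det_eq_scaled_rows _ _ _ r1 r2 (A r1 s) (A r2 s) (B s)) //.
  - rewrite normr0 divr_ge0 ?exprn_ge0 ?(ltW rho0) // mulr_ge0 //.
    by apply: prodr_ge0 => r _; rewrite mulr_ge0 // exprn_ge0 // ltW.
  - by move=> j; rewrite mxE hs.
  - by move=> j; rewrite mxE -h12 hs.
apply: le_trans (ler_sum _ (fun h _ => term h)) _.
rewrite -mulr_suml ler_wpM2r ?invr_ge0 ?exprn_ge0 ?(ltW rho0) //.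
rewrite -mulr_sumr ler_wpM2l //.
(* Summing over all selections factors again into a product over rows, where each row contributes
   [C r] from its monomials and [C r] from its error. *)
rewrite -(bigA_distr_bigA (fun r s => g r s * rho ^+ wt s)) /=.
apply: ler_prod => r _; rewrite sumr_ge0 /=; last first.
  by move=> s _; rewrite mulr_ge0 // exprn_ge0 // ltW.
rewrite optE //= mulfVK ?expf_neq0 ?gt_eqF //.
by have := aC r; lra.
Qed.

Definition ev (R : comNzRingType) (x : R) (p : {poly int}) : R :=
  (map_poly intr p).[x].

Lemma evE (R : comNzRingType) (x : R) : ev x =1 (horner_eval x \o map_poly intr).
Proof. by []. Qed.

Lemma det_ev (R : comNzRingType) (x : R) (M : nat) (G : 'M[{poly int}]_M) :
  \det (\matrix_(i, j) ev x (G i j)) = ev x (\det G).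
Proof.
rewrite evE -det_map_mx; congr (\det _).
by apply/matrixP => i j; rewrite !mxE.
Qed.

(** Reduction modulo [X^2 - X - 1]. Since [a] and [b] are chosen before [x], they serve [x] and its
    conjugate [1 - x] alike. *)
Lemma ev_golden (R : comNzRingType) (p : {poly int}) :
  exists a b : int, forall x : R, x ^+ 2 = x + 1 -> ev x p = a%:~R + b%:~R * x.
Proof.
elim/poly_ind: p => [|p c [a [b IH]]].
  by exists 0, 0 => x _; rewrite /ev rmorph0 horner0 !mulr0z mul0r addr0.
exists (b + c), (a + b) => x hx; have e := IH x hx.
rewrite /ev rmorphD rmorphM /= map_polyX map_polyC /= !hornerE -/(ev x p) e.
rewrite !rmorphD /=.
have -> : (a%:~R + b%:~R * x) * x = a%:~R * x + b%:~R * x ^+ 2 by ring.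
by rewrite hx; ring.
Qed.

(** Otherwise the valuation at 5 would be even on the left and odd on the right. *)
Lemma sqr_eq_5sqr (a b : int) : a ^+ 2 = 5%:Z * b ^+ 2 -> b = 0.
Proof.
move=> e; apply/eqP; case: (eqVneq b 0) => // b0.
have e' : (`|a| ^ 2 = 5 * `|b| ^ 2)%N by rewrite -!abszX e abszM.
have b0' : (0 < `|b|)%N by rewrite absz_gt0.
have a0' : (0 < `|a|)%N.
  by rewrite lt0n; apply/eqP => a0; move: e'; rewrite a0 exp0n // => /esym/eqP; rewrite muln_eq0 expn_eq0 /= andbT (gtn_eqF b0').
have := congr1 (logn 5) e'.
by rewrite lognX lognM ?expn_gt0 ?b0' // lognX (@logn_prime 5 5) //=; lia.
Qed.

(* [a^2 + ab - b^2] is the norm of [a + b phi], [phi] the golden ratio. *)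
Lemma golden_norm_ge1 (R : realFieldType) (x : R) (p : {poly int}) :
  x ^+ 2 = x + 1 -> ev x p != 0 -> 1 <= `|ev x p * ev (1 - x) p|.
Proof.
move=> hx; have [a [b e]] := @ev_golden R p.
have hx' : (1 - x) ^+ 2 = (1 - x) + 1 by rewrite sqrrB hx; ring.
rewrite (e _ hx) (e _ hx') => nz.
have -> : (a%:~R + b%:~R * x) * (a%:~R + b%:~R * (1 - x)) =
          (a ^+ 2 + a * b - b ^+ 2)%:~R :> R.
  rewrite rmorphB rmorphD !rmorphXn rmorphM /=.
  have -> : (a%:~R + b%:~R * x) * (a%:~R + b%:~R * (1 - x)) =
    a%:~R ^+ 2 + a%:~R * b%:~R + b%:~R ^+ 2 * (x - x ^+ 2) :> R by ring.
  by rewrite hx; ring.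
rewrite -intr_norm -[1]/(1%:~R) ler_int -gtz0_ge1 normr_gt0.
apply/eqP => n0.
(* Completing the square: four times the norm is [(2 a + b)^2 - 5 b^2]. *)
have e5 : (2%:Z * a + b) ^+ 2 = 5%:Z * b ^+ 2.
  have -> : (2%:Z * a + b) ^+ 2 = 4%:Z * (a ^+ 2 + a * b - b ^+ 2) + 5%:Z * b ^+ 2 by ring.
  by rewrite n0 mulr0 add0r.
have b0 := sqr_eq_5sqr e5.
have a0 : a = 0.
  by move: n0; rewrite b0 mulr0 expr0n /= subr0 addr0 => /eqP; rewrite sqrf_eq0 => /eqP.
by move: nz; rewrite a0 b0 mul0r addr0 eqxx.
Qed.

(** Liouville's inequality. The determinant is an integer polynomial evaluated at [x], so it is at
    least the inverse of its conjugate in absolute value; the conjugate is bounded trivially by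
    [C'], and the determinant itself by [det_small]. *)
Lemma det_principle (R : realFieldType) (x : R) (I n : nat)
    (G : 'M[{poly int}]_(I * n))
    (A : 'I_(I * n) -> 'I_I * 'I_n -> R) (B : 'I_I * 'I_n -> 'I_(I * n) -> R)
    (a : 'I_(I * n) -> 'I_I * 'I_n -> R) (C C' : 'I_(I * n) -> R) (rho : R) :
  x ^+ 2 = x + 1 -> \det (\matrix_(r, j) ev x (G r j)) != 0 ->
  1 <= rho ->
  (forall r s j, `|A r s * B s j| <= a r s) ->
  (forall r, \sum_s a r s * rho ^+ s.2 <= C r) ->
  (forall r j, `|ev x (G r j) - \sum_s A r s * B s j| * rho ^+ n <= C r) ->
  (forall r j, `|ev (1 - x) (G r j)| <= C' r) ->
  rho ^+ (I * 'C(n, 2)) <= (I * n)`!%:R ^+ 2 * \prod_r (2 * C r * C' r).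
Proof.
move=> hx nz rho1 Aa aC EC C'G.
pose E r j := ev x (G r j) - \sum_s A r s * B s j.
have dE : \det (\matrix_(r, j) ev x (G r j)) =
    \det (\matrix_(r, j) (\sum_s A r s * B s j + E r j)).
  by congr (\det _); apply/matrixP => r j; rewrite !mxE /E addrC subrK.
have small := det_small rho1 Aa aC EC.
have conj : `|\det (\matrix_(r, j) ev (1 - x) (G r j))| <= (I * n)`!%:R * \prod_r C' r.
  by apply: det_norm_le => r j; rewrite mxE.
rewrite -dE in small.
have := nz; rewrite !det_ev in small conj * => nz'.
have := golden_norm_ge1 hx nz'; rewrite normrM => n1.
have rho0 : 0 <= rho ^+ (I * 'C(n, 2)) by rewrite exprn_ge0 // (le_trans ler01).
rewrite -[X in X <= _]mul1r; apply: le_trans (ler_wpM2r rho0 n1) _.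
rewrite mulrAC.
have -> : (I * n)`!%:R ^+ 2 * \prod_r (2 * C r * C' r) =
  ((I * n)`!%:R * \prod_r (2 * C r)) * ((I * n)`!%:R * \prod_r C' r) :> R.
  by rewrite big_split /=; ring.
by apply: ler_pM => //; rewrite mulr_ge0.
Qed.

(** * Zero estimate for plane curves *)


(** [x] is the inner variable, the second argument the outer one. Divisibility and irreducibility
    below are those of [Pdiv.Idomain], up to nonzero factors from [R[x]], hence those of polynomials
    in [y] over the field [R(x)]. *)
Definition ev2 (R : comNzRingType) (f : {poly {poly R}}) (x y : R) : R :=
  (f.[y%:P]).[x].

Definition shift2 (R : comNzRingType) (s t : int) (f : {poly {poly R}}) :
    {poly {poly R}} :=
  map_poly (comp_poly ('X + s%:~R)) f \Po ('X + t%:~R).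

Lemma shift2_is_additive (R : comNzRingType) s t : zmod_morphism (@shift2 R s t).
Proof. by move=> f g; rewrite /shift2 rmorphB /= comp_polyB. Qed.
HB.instance Definition _ (R : comNzRingType) s t :=
  GRing.isZmodMorphism.Build {poly {poly R}} {poly {poly R}} (@shift2 R s t)
    (@shift2_is_additive R s t).
Lemma shift2_is_multiplicative (R : comNzRingType) s t :
  monoid_morphism (@shift2 R s t).
Proof.
split=> [|f g]; first by rewrite /shift2 rmorph1 comp_polyC.
by rewrite /shift2 rmorphM /= comp_polyM.
Qed.
HB.instance Definition _ (R : comNzRingType) s t :=
  GRing.isMonoidMorphism.Build {poly {poly R}} {poly {poly R}} (@shift2 R s t)
    (@shift2_is_multiplicative R s t).

Lemma shift2D (R : comNzRingType) s t (f g : {poly {poly R}}) :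
  shift2 s t (f + g) = shift2 s t f + shift2 s t g.
Proof. exact: raddfD. Qed.

Lemma shift2M (R : comNzRingType) s t (f g : {poly {poly R}}) :
  shift2 s t (f * g) = shift2 s t f * shift2 s t g.
Proof. exact: rmorphM. Qed.

Section Shift.

Variable R : realFieldType.
Implicit Types (f g p q Q : {poly {poly R}}) (s t : int).

Lemma ev2D f g x y : ev2 (f + g) x y = ev2 f x y + ev2 g x y.
Proof. by rewrite /ev2 !hornerE. Qed.
Lemma ev2M f g x y : ev2 (f * g) x y = ev2 f x y * ev2 g x y.
Proof. by rewrite /ev2 !hornerE. Qed.

Lemma ev2_shift s t f x y : ev2 (shift2 s t f) x y = ev2 f (x + s%:~R) (y + t%:~R).
Proof.
rewrite /ev2 /shift2 horner_comp.
have e (A : comNzRingType) (z : A) (c : int) : ('X + c%:~R).[z] = z + c%:~R.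
  by rewrite hornerD hornerX -(rmorph_int (@polyC A)) hornerC.
have -> : ('X + t%:~R).[y%:P] = comp_poly ('X + s%:~R) (y + t%:~R)%:P :> {poly R}.
  by rewrite e comp_polyC polyCD rmorph_int.
by rewrite horner_map /= horner_comp e.
Qed.

Lemma shift2C s t (c : {poly R}) : shift2 s t c%:P = (c \Po ('X + s%:~R))%:P.
Proof. by rewrite /shift2 map_polyC comp_polyC. Qed.

Lemma shift2X s t : shift2 s t 'X = 'X + t%:~R :> {poly {poly R}}.
Proof. by rewrite /shift2 map_polyX comp_polyX. Qed.

Lemma shift2_shift2 s t s' t' f :
  shift2 s t (shift2 s' t' f) = shift2 (s + s') (t + t') f.
Proof.
elim/poly_ind: f => [|f c IH]; first by rewrite !raddf0.
have S (u v : int) (h : {poly {poly R}}) (d : {poly R}) :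
    shift2 u v (h * 'X + d%:P) =
    shift2 u v h * ('X + v%:~R) + (d \Po ('X + u%:~R))%:P.
  by rewrite shift2D shift2M shift2X shift2C.
have Sz (u v z : int) : shift2 u v z%:~R = z%:~R :> {poly {poly R}}.
  have zE : z%:~R = ((z%:~R : R)%:P)%:P :> {poly {poly R}}.
    by rewrite -[RHS]/((polyC \o polyC) z%:~R) rmorph_int.
  by rewrite zE shift2C comp_polyC.
rewrite (S s' t') (S (s + s')) shift2D shift2M shift2D shift2X Sz shift2C IH.
congr (_ * _ + _); first by rewrite -addrA intrD [X in _ + X]addrC.
congr (_ %:P); rewrite -comp_polyA; congr (_ \Po _).
rewrite comp_polyD comp_polyX.
have -> : (s'%:~R : {poly R}) \Po ('X + s%:~R) = s'%:~R.
  by rewrite -[s'%:~R](rmorph_int (@polyC R)) comp_polyC.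
by rewrite -addrA intrD [X in _ + X]addrC.
Qed.

Lemma shift2_0 f : shift2 0 0 f = f.
Proof.
rewrite /shift2 mulr0z !addr0 comp_polyXr map_poly_id //.
by move=> c _; rewrite comp_polyXr.
Qed.

Lemma size_XDint (A : idomainType) (t : int) : size ('X + t%:~R : {poly A}) = 2%N.
Proof. by rewrite -(rmorph_int (@polyC A)) size_XaddC. Qed.

Lemma size_shift2 s t f : size (shift2 s t f) = size f.
Proof.
rewrite /shift2 size_comp_poly2 ?size_XDint // size_map_inj_poly ?comp_poly0 //.
move=> a b /(congr1 (comp_poly ('X - s%:~R))).
by rewrite -!comp_polyA comp_polyD comp_polyX rmorph_int subrK !comp_polyXr.
Qed.

Lemma shift2_eq0 s t f : (shift2 s t f == 0) = (f == 0).
Proof. by rewrite -!size_poly_eq0 size_shift2. Qed.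

Lemma lead_shift2 s t f :
  lead_coef (shift2 s t f) = lead_coef f \Po ('X + s%:~R).
Proof.
have inj : injective (comp_poly ('X + s%:~R : {poly R})).
  move=> a b /(congr1 (comp_poly ('X - s%:~R))).
  by rewrite -!comp_polyA comp_polyD comp_polyX rmorph_int subrK !comp_polyXr.
rewrite /shift2 lead_coef_comp ?size_XDint //.
rewrite -(rmorph_int (@polyC {poly R})) lead_coefXaddC expr1n mulr1.
by rewrite lead_coef_map_inj //= comp_poly0.
Qed.

Lemma dvdp_shift2 s t p q : p %| q -> shift2 s t p %| shift2 s t q.
Proof.
move/dvdpP => [[c r] /= c0 e]; apply/dvdpP.
exists (c \Po ('X + s%:~R), shift2 s t r) => /=.
  by have := shift2_eq0 s t c%:P; rewrite shift2C !polyC_eq0 => ->.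
by rewrite -shift2M -e -!mul_polyC shift2M shift2C.
Qed.

Lemma irreducible_shift2 s t p : irreducible_poly p -> irreducible_poly (shift2 s t p).
Proof.
move=> [p1 irr]; split; first by rewrite size_shift2.
move=> q q1 qp.
have := irr (shift2 (- s) (- t) q); rewrite size_shift2 => /(_ q1).
have := dvdp_shift2 (- s) (- t) qp; rewrite shift2_shift2 !addNr shift2_0 => d /(_ d).
rewrite /eqp => /andP[_ d2]; rewrite qp /=.
by have := dvdp_shift2 s t d2; rewrite shift2_shift2 !subrr shift2_0.
Qed.

Lemma exists_irreducible_dvdp p : (1 < size p)%N ->
  exists2 q, irreducible_poly q & q %| p.
Proof.
have [n] := ubnP (size p); elim: n p => // n IH p pn p1.
have [[q [q1 qp nqp]]|nex] := classic (exists q, [/\ size q != 1, q %| p & ~~ (q %= p)]).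
  have p0 : p != 0 by rewrite -size_poly_gt0 (leq_trans _ p1).
  have q0 : q != 0 by apply: contraNneq p0 => q0; move: qp; rewrite q0 dvd0p.
  have sq : (size q < size p)%N.
    by rewrite ltn_neqAle (dvdp_leq p0 qp) andbT (dvdp_size_eqp qp).
  have q1' : (1 < size q)%N.
    by rewrite ltn_neqAle eq_sym q1 size_poly_gt0.
  have [//|r irr rq] := IH q _ q1'; first by rewrite (leq_trans sq).
  by exists r => //; apply: dvdp_trans qp.
exists p => //; split=> // q q1 qp; apply/negPn/negP => nqp.
by apply: nex; exists q.
Qed.

End Shift.

Section Stabilizer.

Variable R : realFieldType.
Implicit Types (f g p q Q : {poly {poly R}}) (s t : int).

(** A vertical translation keeps the leading coefficient, so association becomes equality; then
    [p - p(0)] would vanish at all multiples of [t], more often than its degree allows. *)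
Lemma shift2_0t_eqp t p : (1 < size p)%N -> shift2 0 t p %= p -> t = 0.
Proof.
move=> p1 /eqpP [[c1 c2] /= /andP[c10 c20] e].
have p0 : p != 0 by rewrite -size_poly_gt0 (leq_trans _ p1).
have c12 : c1 = c2.
  have := congr1 lead_coef e.
  rewrite !lead_coefZ lead_shift2 mulr0z addr0 comp_polyXr.
  by apply: mulIf; rewrite lead_coef_eq0.
have {}e : shift2 0 t p = p.
  by apply: (@mulfI _ c2%:P); rewrite ?polyC_eq0 // !mul_polyC -e c12.
apply/eqP; apply: contraT => t0.
pose rs := [seq ((t * n%:Z)%:~R : {poly R}) | n <- iota 0 (size p)].
have urs : uniq rs.
  rewrite map_inj_uniq ?iota_uniq // => a b.
  rewrite -!(rmorph_int (@polyC R)) => /polyC_inj /eqP; rewrite eqr_int => /eqP.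
  by move/(mulfI t0) => [].
have e0 (n : nat) : p.[(t * n%:Z)%:~R] = p.[0].
  elim: n => [|n IH]; first by rewrite mulr0 mulr0z.
  rewrite -IH -{2}e /shift2 mulr0z addr0.
  have -> : map_poly (comp_poly 'X) p = p.
    by rewrite map_poly_id // => c _; rewrite comp_polyXr.
  rewrite horner_comp; congr (p.[_]).
  rewrite hornerD hornerX -(rmorph_int (@polyC {poly R})) hornerC -rmorphD /=.
  by congr (_%:~R); rewrite -addn1 PoszD mulrDr mulr1.
have sp : size (p - (p.[0])%:P) = size p.
  by rewrite size_polyDl // size_polyN (leq_ltn_trans (size_polyC_leq1 _)).
have := @max_poly_roots _ (p - (p.[0])%:P) rs _ _ urs.
rewrite -size_poly_gt0 sp size_map size_iota ltnn => ->//; first exact: ltn_trans p1.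
apply/allP => z /mapP [n _ ->].
by rewrite rootE hornerD hornerN hornerC e0 subrr.
Qed.

Lemma eqp_shift2 s t p q : p %= q -> shift2 s t p %= shift2 s t q.
Proof. by rewrite /eqp => /andP[pq qp]; rewrite !dvdp_shift2. Qed.

Lemma eqp_shift2_mul (n : nat) s t p : shift2 s t p %= p ->
  shift2 (s * n%:Z) (t * n%:Z) p %= p.
Proof.
move=> e; elim: n => [|n IH]; first by rewrite !mulr0 shift2_0 eqpxx.
rewrite -addn1 PoszD !mulrDr !mulr1 -shift2_shift2.
exact: eqp_trans (eqp_shift2 _ _ e) IH.
Qed.

Lemma eqp_shift2_opp s t p : shift2 s t p %= p -> shift2 (- s) (- t) p %= p.
Proof.
move/(eqp_shift2 (- s) (- t)); rewrite shift2_shift2 !addNr shift2_0.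
by rewrite eqp_sym.
Qed.

Lemma eqp_shift2_mulz (z : int) s t p : shift2 s t p %= p ->
  shift2 (s * z) (t * z) p %= p.
Proof.
case: z => n e; first exact: eqp_shift2_mul.
rewrite NegzE !mulrN; apply: eqp_shift2_opp; exact: eqp_shift2_mul.
Qed.

(* An irreducible polynomial of positive degree in the outer variable has a
   stabilizer of rank at most one: otherwise it would be periodic in that
   variable. *)
Lemma stabilizer_parallel s t s' t' p : (1 < size p)%N ->
  shift2 s t p %= p -> shift2 s' t' p %= p -> t * s' = t' * s.
Proof.
move=> p1 e e'.
have e1 := eqp_shift2_mulz (- s') e.
have e2 := eqp_trans (eqp_shift2 (s * - s') (t * - s') (eqp_shift2_mulz s e')) e1.
have z : s * - s' + s' * s = 0 by ring.
have y : t * - s' + t' * s = 0.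
  by apply: (shift2_0t_eqp p1); rewrite -z -shift2_shift2.
by apply/eqP; rewrite -subr_eq0 -oppr_eq0; apply/eqP; rewrite -y; ring.
Qed.

End Stabilizer.

Section Divisors.

Variable R : idomainType.
Implicit Types (p q Q : {poly R}) (ps : seq {poly R}).

Lemma irreducible_not_eqp_coprime p q :
  irreducible_poly p -> irreducible_poly q -> ~~ (p %= q) -> coprimep p q.
Proof.
move=> ip iq npq; rewrite irreducible_poly_coprime //; apply: contra npq => pq.
have [_ ->] // := iq.
by case: ip => + _; apply: contraL => /eqP->.
Qed.

(** The divisors are pairwise coprime, so they can be divided out one after the other, each lowering
    the size of [Q]. *)
Lemma count_irreducible_divisors ps Q : Q != 0 ->
  (forall p, p \in ps -> irreducible_poly p) ->
  pairwise (fun p q => ~~ (p %= q)) ps -> (forall p, p \in ps -> p %| Q) ->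
  (size ps < size Q)%N.
Proof.
elim: ps Q => [|p ps IH] Q Q0 irr /=; first by rewrite size_poly_gt0.
move=> /andP[/allP pps uniq dvd].
have ip := irr _ (mem_head _ _).
have /dvdpP[[c Q'] /= c0 e] := dvd _ (mem_head _ _).
have Q'0 : Q' != 0.
  apply: contraNneq Q0 => Q'0; move/eqP: e.
  by rewrite Q'0 mul0r -mul_polyC mulf_eq0 polyC_eq0 (negPf c0).
have p0 : p != 0 by apply: irredp_neq0.
have sQ : size Q = (size Q' + size p).-1 by rewrite -(size_scale _ c0) e size_mul.
have p1 : (1 < size p)%N by case: ip.
suff lt : (size ps < size Q')%N.
  by rewrite sQ; move: p1 lt; move: (size p) (size Q') (size ps) => x y z; lia.
apply: IH => // [q qps|q qps]; first by apply: irr; rewrite inE qps orbT.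
have : q %| Q' * p.
  by rewrite -e dvdpZr // dvd // inE qps orbT.
rewrite Gauss_dvdpl //; apply: irreducible_not_eqp_coprime => //.
  by apply: irr; rewrite inE qps orbT.
by rewrite eqp_sym pps.
Qed.

(* Each irreducible divisor of [Q] spoils at most one coefficient [e], and [Q]
   has fewer irreducible divisors than its size. *)
Lemma generic_combination Q p q : Q != 0 -> (forall n : nat, n.+1%:R != 0 :> R) ->
  exists e : nat, forall r, irreducible_poly r -> r %| Q ->
    r %| p + e%:R *: q -> (r %| p) && (r %| q).
Proof.
move=> Q0 char0.
have [//|bad] := classic (exists e : nat, forall r, irreducible_poly r -> r %| Q ->
    r %| p + e%:R *: q -> (r %| p) && (r %| q)).
have {}bad (e : nat) : exists r, [/\ irreducible_poly r, r %| Q, r %| p + e%:R *: q &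
    ~~ ((r %| p) && (r %| q))].
  apply: NNPP => ne; apply: bad; exists e => r ir rQ re.
  by apply/negPn/negP => nr; apply: ne; exists r.
have [n] := ubnP (size Q); case: n => // n Qn.
suff : exists ps, [/\ size ps = n.+1, forall r, r \in ps -> irreducible_poly r,
    pairwise (fun p q => ~~ (p %= q)) ps, forall r, r \in ps -> r %| Q &
    forall r, r \in ps -> exists2 e : nat, (e < n.+1)%N &
      (r %| p + e%:R *: q) && ~~ ((r %| p) && (r %| q))].
  move=> [ps [sps irr uniq dvd _]].
  by have := count_irreducible_divisors Q0 irr uniq dvd; rewrite sps; lia.
elim: n.+1 => [|m [ps [sps irr uniq dvd ex]]]; first by exists [::].
have [r [ir rQ re nr]] := bad m.
exists (r :: ps); split=> /=.
- by rewrite sps.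
- by move=> s; rewrite inE => /orP[/eqP->//|]; apply: irr.
(* If associate divisors spoiled two coefficients [e < m], the difference [(m - e) q] would show
   that the divisor divides [q], and then also [p]. *)
- rewrite uniq andbT; apply/allP => s /ex [e em /andP[se ns]].
  apply: contra nr => rs.
  have r_e : r %| p + e%:R *: q by rewrite (eqp_dvdl _ rs).
  have rq : r %| q.
    have := dvdp_sub re r_e; rewrite opprD addrACA subrr add0r -scalerBl.
    rewrite -natrB ?(ltnW em) // dvdpZr // -(prednK (n := (m - e)%N)) ?char0 //.
    by rewrite subn_gt0.
  by rewrite rq andbT -(dvdp_addl p (dvdp_mull (m%:R)%:P rq)) mul_polyC.
- by move=> s; rewrite inE => /orP[/eqP->//|]; apply: dvd.
- move=> s; rewrite inE => /orP[/eqP->|/ex[e em]]; first by exists m; rewrite ?re.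
  by exists e => //; apply: ltnW.
Qed.

(** Replaces a whole list by one member of [S], so that [common_zeros_bound], which concerns two
    polynomials, applies to [Q] and all its translates at once. *)
Lemma generic_combination_seq Q ps (S : {poly R} -> Prop) :
  Q != 0 -> (forall n : nat, n.+1%:R != 0 :> R) -> S 0 ->
  (forall p q (e : nat), S p -> S q -> S (p + e%:R *: q)) ->
  (forall p, p \in ps -> S p) ->
  exists2 q, S q & forall r, irreducible_poly r -> r %| Q -> r %| q ->
    forall p, p \in ps -> r %| p.
Proof.
move=> Q0 char0 S0 Sadd; elim: ps => [|p ps IH] Sps; first by exists 0.
have [|q Sq qP] := IH; first by move=> r rps; apply: Sps; rewrite inE rps orbT.
have [e eP] := generic_combination q p Q0 char0.
exists (q + e%:R *: p); first by apply: Sadd => //; apply: Sps; rewrite mem_head.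
move=> r ir rQ re s; rewrite inE; have /andP[rq rp] := eP r ir rQ re.
by move=> /orP[/eqP->|/(qP r ir rQ rq)].
Qed.

End Divisors.

Section CommonZeros.

Variable R : realFieldType.
Implicit Types (p q f : {poly {poly R}}).

Definition bidegree_le (d : nat) f :=
  (size f <= d.+1)%N /\ forall i, (size (f`_i)%R <= d.+1)%N.

Lemma size_prod_le (I : Type) (s : seq I) (P : pred I) (F : I -> {poly R}) (d : nat) :
  (forall i, P i -> (size (F i) <= d.+1)%N) ->
  (size (\prod_(i <- s | P i) F i)%R <= (d * count P s).+1)%N.
Proof.
move=> Fd; elim: s => [|i s IH]; first by rewrite big_nil size_poly1.
rewrite big_cons /=; case: ifP => // Pi.
apply: leq_trans (size_polyMleq _ _) _.
by have := Fd i Pi; move: IH; move: (size _) (size _) (count _ _) => x y z; lia.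
Qed.

Lemma size_det_le (m d : nat) (F : 'M[{poly R}]_m) :
  (forall i j, (size (F i j) <= d.+1)%N) -> (size (\det F) <= (d * m).+1)%N.
Proof.
move=> Fd; apply: leq_trans (size_sum _ _ _) _; apply/bigmax_leqP => s _.
rewrite -signr_odd; apply: leq_trans (_ : size (\prod_i F i (s i))%R <= _)%N.
  by case: odd; rewrite ?expr0 ?expr1 ?mul1r // mulN1r size_polyN.
have := size_prod_le (index_enum _) (P := xpredT) (F := fun i => F i (s i)) (d := d)
  (fun i _ => Fd i (s i)).
by rewrite count_predT [index_enum _]unlock -enumT size_enum_ord.
Qed.

(** The resultant in [y] is a determinant of at most [2 d] rows with entries of degree at most [d]
    in [x], and it vanishes at the abscissae of the common zeros; these are asked to be distinct so
    that they can be counted as its roots. A polynomial free of [y] takes the place of the resultant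
    itself. *)
Lemma common_zeros_bound (d : nat) p q (pts : seq (R * R)) :
  p != 0 -> bidegree_le d p -> bidegree_le d q ->
  (forall r, irreducible_poly r -> r %| p -> ~~ (r %| q)) ->
  uniq [seq z.1 | z <- pts] ->
  (forall z, z \in pts -> ev2 p z.1 z.2 = 0 /\ ev2 q z.1 z.2 = 0) ->
  (size pts <= 2 * d ^ 2)%N.
Proof.
move=> p0 [sp cp] [sq cq] cop upts zpts.
suff [h h0 [sh zh]] : exists2 h : {poly R}, h != 0 &
    (size h <= (2 * d ^ 2).+1)%N /\ forall z, z \in pts -> root h z.1.
  rewrite -(size_map fst) -ltnS; apply: leq_trans sh.
  by apply: max_poly_roots => //; apply/allP => x /mapP [z /zh + ->].
have dd : (d <= 2 * d ^ 2)%N by case: (d) => // m; rewrite expnS expn1; lia.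
have [p1|p1] := leqP (size p) 1.
  have := size1_polyC p1 => pE; exists p`_0; first by rewrite -polyC_eq0 -pE.
  split=> [|z /zpts[+ _]]; last by rewrite /ev2 pE hornerC coefC /= => /rootP.
  by apply: leq_trans (cp 0) _; rewrite ltnS dd.
have [q1|q1] := leqP (size q) 1.
  have := size1_polyC q1 => qE; exists q`_0.
    apply/eqP => q00; have [r ir rp] := exists_irreducible_dvdp p1.
    by have := cop r ir rp; rewrite qE q00 dvdp0.
  split=> [|z /zpts[_]]; last by rewrite /ev2 qE hornerC coefC /= => /rootP.
  by apply: leq_trans (cq 0) _; rewrite ltnS dd.
exists (resultant p q).
  rewrite resultant_eq0; apply/negP => g1.
  have [r ir rg] := exists_irreducible_dvdp g1.
  have rp : r %| p by apply: dvdp_trans rg (dvdp_gcdl _ _).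
  by have := cop r ir rp; rewrite (dvdp_trans rg (dvdp_gcdr _ _)).
split.
  have := @size_det_le _ d (Sylvester_mx p q).
  rewrite /resultant => H; apply: leq_trans (H _) _.
    move=> i j; rewrite Sylvester_mxE.
    by case: split => k /=; case: (k <= j)%N; rewrite ?mulr1n ?mulr0n ?size_poly0 //.
  have h : ((size q).-1 + (size p).-1 <= 2 * d)%N.
    by move: sp sq; move: (size p) (size q) => x y; lia.
  by rewrite ltnS expnS expn1 mulnCA leq_mul2l h orbT.
move=> z /zpts [zp zq].
have [[u v] /= _ e] := resultant_in_ideal p1 q1.
have := congr1 (fun f => ev2 f z.1 z.2) e.
rewrite ev2D !ev2M zp zq !mulr0 addr0 /ev2 hornerC => e0.
by apply/rootP.
Qed.

End CommonZeros.

Section PlanarZeroEstimate.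

Variable R : realFieldType.
Implicit Types (p q f Q : {poly {poly R}}).

Lemma bidegree_leD d f g : bidegree_le d f -> bidegree_le d g -> bidegree_le d (f + g).
Proof.
move=> [sf cf] [sg cg]; split=> [|i].
  by apply: leq_trans (size_polyD _ _) _; rewrite geq_max sf.
by rewrite coefD; apply: leq_trans (size_polyD _ _) _; rewrite geq_max cf cg.
Qed.

Lemma bidegree_leZ d (c : R) f : bidegree_le d f -> bidegree_le d (c%:P *: f).
Proof.
move=> [sf cf]; split=> [|i].
  exact: leq_trans (size_scale_leq _ _) sf.
rewrite coefZ; apply: leq_trans (size_polyMleq _ _) _.
have := cf i; have := size_polyC_leq1 c.
by move: (size _) (size _) => x y; lia.
Qed.

Lemma bidegree_le_shift2 d s t f : bidegree_le d f -> bidegree_le d (shift2 s t f).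
Proof.
move=> [sf cf]; split=> [|n]; first by rewrite size_shift2.
rewrite /shift2 coef_comp_poly; apply: leq_trans (size_sum _ _ _) _.
apply/bigmax_leqP => i _.
have -> : ('X + t%:~R : {poly {poly R}}) = map_poly polyC ('X + (t%:~R)%:P).
  by rewrite rmorphD /= map_polyX map_polyC /= !rmorph_int.
rewrite -rmorphXn coef_map /=; apply: leq_trans (size_polyMleq _ _) _.
rewrite coef_map /= size_comp_poly2 ?size_XDint //.
have := cf i; have := size_polyC_leq1 (('X + (t%:~R)%:P : {poly R}) ^+ i)`_n.
by move: (size _) (size _) => x y; lia.
Qed.

(** All stabilizing translations are parallel, so a nonzero one, divided by its gcd and turned by a
    right angle, gives the form. If there is none, any form will do and [(1, 0)] is taken. *)
Lemma stabilizer_form p : (1 < size p)%N -> exists a b : int, coprimez a b /\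
  forall s t, shift2 s t p %= p -> a * s + b * t = 0.
Proof.
move=> p1.
have [[s0 [t0 [st0 e0]]]|none] :=
  classic (exists s0 t0, (s0, t0) != 0 /\ shift2 s0 t0 p %= p); last first.
  exists 1, 0; split; first by rewrite /coprimez gcd1z.
  move=> s t e; have [st|st] := eqVneq (s, t) 0; first by case: st => -> ->; rewrite mulr0 mul0r.
  by case: none; exists s, t.
have g0 : gcdz s0 t0 != 0.
  by rewrite gcdz_eq0; apply: contra st0 => /andP[/eqP-> /eqP->].
have [a ea] := dvdzP (dvdz_gcdl s0 t0); have [b eb] := dvdzP (dvdz_gcdr s0 t0).
set g := gcdz s0 t0 in g0 ea eb.
exists b, (- a); split.
  rewrite /coprimez gcdzN gcdzC; apply/eqP.
  have : gcdz (a * g) (b * g) = g by rewrite -ea -eb.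
  rewrite -mulz_gcdl => /eqP; have gg : (`|g|%N : int) = g by rewrite /g /gcdz.
  by rewrite gg -[X in _ == X]mul1r => /eqP /(mulIf g0).
move=> s t e; have := stabilizer_parallel p1 e e0; rewrite ea eb => h.
by apply: (mulIf g0); rewrite mul0r; move/eqP: h; rewrite -subr_eq0 => /eqP h; rewrite -[RHS]oppr0 -h; ring.
Qed.

(* If the translates of [Q] have no common irreducible factor, Bezout bounds
   their common zeros; otherwise [Q] is divisible by all translates of that
   factor, so they fall into few classes. *)
Lemma planar_zero_estimate (d : nat) Q (B : seq (int * int)) (pts : seq (R * R)) :
  Q != 0 -> bidegree_le d Q -> uniq [seq z.1 | z <- pts] ->
  (forall z sg, z \in pts -> sg \in B ->
     ev2 Q (z.1 + sg.1%:~R) (z.2 + sg.2%:~R) = 0) ->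
  (0, 0) \in B -> (2 * d ^ 2 < size pts)%N ->
  exists a b : int, coprimez a b /\
    (size (undup [seq (a * sg.1 + b * sg.2)%R | sg <- B]) <= d)%N.
Proof.
move=> Q0 dQ upts zQ B0 big.
pose S f := bidegree_le d f /\ forall z, z \in pts -> ev2 f z.1 z.2 = 0.
have char0 (n : nat) : n.+1%:R != 0 :> {poly R}.
  by rewrite -polyC_natr polyC_eq0 pnatr_eq0.
have [|f g e [df zf] [dg zg]||q [dq zq] qP] :=
    @generic_combination_seq _ Q [seq shift2 sg.1 sg.2 Q | sg <- B] S Q0 char0.
- split; first by split=> [|i]; rewrite ?coef0 size_poly0.
  by move=> z _; rewrite /ev2 !horner0.
- split; first by apply: bidegree_leD => //; rewrite -polyC_natr; apply: bidegree_leZ.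
  by move=> z zp; rewrite ev2D -mul_polyC ev2M zf // zg // mulr0 addr0.
- move=> f /mapP [sg sB ->]; split; first exact: bidegree_le_shift2.
  by move=> z zp; rewrite ev2_shift zQ.
have [r ir [rQ rq]] : exists2 r, irreducible_poly r & r %| Q /\ r %| q.
  apply: NNPP => none; move: big; rewrite ltnNge => /negP; apply.
  apply: (@common_zeros_bound _ d Q q) => // [r ir rQ|z zp].
    by apply/negP => rq; apply: none; exists r.
  split; last exact: zq.
  by have := zQ z (0, 0) zp B0; rewrite /= !mulr0z !addr0.
have r1 : (1 < size r)%N by case: ir.
have [a [b [cab ab]]] := stabilizer_form r1; exists a, b; split=> //.
pose l (sg : int * int) := a * sg.1 + b * sg.2.
rewrite -/l; set vals := undup _.
pose rep v := nth (0, 0) B (index v (map l B)).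
have repP v : v \in vals -> rep v \in B /\ l (rep v) = v.
  rewrite mem_undup => vB; have iB : (index v (map l B) < size B)%N.
    by rewrite -(size_map l) index_mem.
  by split; [exact: mem_nth | rewrite -(nth_map _ 0) // nth_index].
(* The translates of [r] by minus [rep v] divide [Q]. An association between two of them is a
   stabilizing translation of [r], on which the form vanishes, so distinct values give inequivalent
   divisors. *)
rewrite -ltnS; apply: leq_trans (proj1 dQ).
rewrite -(size_map (fun v => shift2 (- (rep v).1) (- (rep v).2) r)).
apply: count_irreducible_divisors => //.
- by move=> f /mapP [v _ ->]; apply: irreducible_shift2.
- rewrite pairwise_map; have := undup_uniq (map l B); rewrite uniq_pairwise.
  rewrite -/vals => uv; apply: (sub_in_pairwise (P := mem vals)) uv; last exact/allP.
  move=> v w /repP [_ lv] /repP [_ lw] /=; apply: contra => e.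
  have := eqp_shift2 (rep v).1 (rep v).2 e.
  rewrite !shift2_shift2 !subrr shift2_0 eqp_sym => /ab e0.
  by rewrite -lv -lw /l -subr_eq0; apply/eqP; rewrite -e0; ring.
- move=> f /mapP [v /repP [vB _] ->].
  have := qP r ir rQ rq (shift2 (rep v).1 (rep v).2 Q) (map_f _ vB).
  by move/(dvdp_shift2 (- (rep v).1) (- (rep v).2)); rewrite shift2_shift2 !addNr shift2_0.
Qed.

End PlanarZeroEstimate.

(** * Elimination of the exponential *)

Section Elimination.

Variable R : realFieldType.

Lemma coef_prod_top (A : comNzRingType) (I : Type) (s : seq I) (F : I -> {poly A})
    (d : I -> nat) :
  (forall i, (size (F i) <= (d i).+1)%N) ->
  (size (\prod_(i <- s) F i)%R <= (\sum_(i <- s) d i).+1)%N /\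
  (\prod_(i <- s) F i)`_(\sum_(i <- s) d i) = \prod_(i <- s) (F i)`_(d i).
Proof.
move=> Fd; elim: s => [|i s [IHs IHc]]; first by rewrite !big_nil size_poly1 coef1.
rewrite !big_cons; split.
  apply: leq_trans (size_polyMleq _ _) _.
  by have := Fd i; move: IHs; move: (size _) (size _) (\sum_(_ <- _) _)%N => x y z; lia.
rewrite coefM (bigD1 (inord (d i))) //=.
rewrite inordK ?ltnS ?leq_addr // addKn IHc [X in _ + X]big1 ?addr0 // => j nj.
have [ji|ji|ji] := ltngtP j (d i).
- rewrite [X in _ * X]nth_default ?mulr0 //; apply: leq_trans IHs _.
  by move: ji; move: (\sum_(_ <- _) _)%N (d i) (val j) => x y z; lia.
- by rewrite nth_default ?mul0r // (leq_trans (Fd i)).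
- by case/eqP: nj; apply: val_inj; rewrite /= inordK // ltnS leq_addr.
Qed.

(** Every product in the Leibniz expansion takes one entry from each column, so the column bounds
    [d] add up to the same top degree in all of them. *)
Lemma det_coef_top (A : comNzRingType) (m : nat) (F : 'M[{poly A}]_m) (d : 'I_m -> nat) :
  (forall i j, (size (F i j) <= (d j).+1)%N) ->
  (\det F)`_(\sum_j d j) = \det (\matrix_(i, j) (F i j)`_(d j)).
Proof.
move=> Fd; rewrite /determinant coef_sum; apply: eq_bigr => s _.
rewrite -(rmorph_sign (@polyC A)) coefCM; congr (_ * _).
have -> : (\sum_j d j = \sum_j d (perm.fun_of_perm s j))%N.
  by rewrite (reindex_inj (@perm.perm_inj _ s)).
have [_ ->] := @coef_prod_top A _ (index_enum 'I_m) (fun i => F i (perm.fun_of_perm s i))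
  (fun i => d (perm.fun_of_perm s i)) (fun i => Fd i _).
by apply: eq_bigr => i _; rewrite mxE.
Qed.

Lemma bidegree_leW (d d' : nat) (f : {poly {poly R}}) :
  (d <= d')%N -> bidegree_le d f -> bidegree_le d' f.
Proof.
by move=> dd [sf cf]; split=> [|i]; apply: leq_trans (_ : (d.+1 <= _)%N).
Qed.

Lemma bidegree_leM d d' (f g : {poly {poly R}}) :
  bidegree_le d f -> bidegree_le d' g -> bidegree_le (d + d') (f * g).
Proof.
move=> [sf cf] [sg cg]; split=> [|n].
  apply: leq_trans (size_polyMleq _ _) _.
  by move: sf sg; move: (size f) (size g) => x y; lia.
rewrite coefM; apply: leq_trans (size_sum _ _ _) _; apply/bigmax_leqP => i _.
apply: leq_trans (size_polyMleq _ _) _.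
by have := cf i; have := cg (n - i)%N; move: (size _) (size _) => x y; lia.
Qed.

Lemma bidegree_le_det (d m : nat) (F : 'M[{poly {poly R}}]_m) :
  (forall i j, bidegree_le d (F i j)) -> bidegree_le (d * m) (\det F).
Proof.
move=> dF; rewrite /determinant; apply: big_ind => [|f g|s _].
- by split=> [|i]; rewrite ?coef0 size_poly0.
- exact: bidegree_leD.
have -> : (-1) ^+ perm.odd_perm s * \prod_i F i (perm.fun_of_perm s i) =
    ((-1) ^+ perm.odd_perm s : R)%:P *: \prod_i F i (perm.fun_of_perm s i).
  by rewrite rmorph_sign -mul_polyC rmorph_sign.
apply: bidegree_leZ.
suff H (t : seq 'I_m) : bidegree_le (d * size t) (\prod_(i <- t) F i (perm.fun_of_perm s i)).
  by have := H (index_enum 'I_m); rewrite [X in size X]unlock -enumT size_enum_ord.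
elim: t => [|i t IH]; last by rewrite big_cons mulnS; apply: bidegree_leM.
by rewrite big_nil muln0; split=> [|i]; rewrite ?size_poly1 // coef1; case: eqP; rewrite ?size_poly1 ?size_poly0.
Qed.

Lemma det_vandermonde_neq0 (m : nat) (a : 'I_m -> R) : injective a ->
  \det (\matrix_(i < m, j < m) a j ^+ i) != 0.
Proof.
move=> inj; have -> : \matrix_(i < m, j < m) a j ^+ i = Vandermonde m (\row_j a j).
  by apply/matrixP => i j; rewrite !mxE.
rewrite det_Vandermonde; apply/prodf_neq0 => i _; apply/prodf_neq0 => j ij.
rewrite !mxE subr_eq0; apply: contraTneq ij => /inj ->.
by rewrite ltnn.
Qed.

Lemma det_scale_cols (A : comNzRingType) (m : nat) (c : 'I_m -> A) (F : 'M[A]_m) :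
  \det (\matrix_(i, j) (c j * F i j)) = (\prod_j c j) * \det F.
Proof.
have -> : \matrix_(i, j) (c j * F i j) = F *m diag_mx (\row_j c j).
  apply/matrixP => i j; rewrite !mxE (bigD1 j) //= !mxE eqxx mulr1n big1 ?addr0 1?mulrC //.
  by move=> k /negPf kj; rewrite !mxE kj mulr0n mulr0.
by rewrite det_mulmx det_diag mulrC; congr (_ * _); apply: eq_bigr => j _; rewrite mxE.
Qed.

Lemma det_ev2 (m : nat) (F : 'M[{poly {poly R}}]_m) (x y : R) :
  ev2 (\det F) x y = \det (\matrix_(i, j) ev2 (F i j) x y).
Proof.
rewrite -[LHS]/(horner_eval x (horner_eval y%:P (\det F))).
rewrite -!det_map_mx; congr (\det _).
by apply/matrixP => i j; rewrite !mxE.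
Qed.

Lemma ev2C (c : R) x y : ev2 c%:P%:P x y = c.
Proof. by rewrite /ev2 !hornerC. Qed.

(** Translation leaves the top coefficient in [y], and then in [x], untouched. For this reason the
    top coefficients of translates in [eliminate_exponential] form a Vandermonde matrix with scaled
    columns. *)
Lemma lead_shift2_top s t (f : {poly {poly R}}) :
  ((shift2 s t f)`_(size f).-1)`_(size (lead_coef f)).-1 = lead_coef (lead_coef f).
Proof.
have -> : (shift2 s t f)`_(size f).-1 = lead_coef f \Po ('X + s%:~R).
  by rewrite -(lead_shift2 s t) lead_coefE size_shift2.
have -> : (size (lead_coef f)).-1 = (size (lead_coef f \Po ('X + s%:~R))).-1.
  by rewrite size_comp_poly2 // size_XDint.
rewrite -lead_coefE lead_coef_comp ?size_XDint //.
by rewrite -(rmorph_int (@polyC R)) lead_coefXaddC expr1n mulr1.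
Qed.

(* The determinant of [L] translates, restricted to the exponents that occur,
   is nonzero because its leading coefficient is a Vandermonde determinant. *)
Lemma eliminate_exponential (L kap : nat) (P : 'I_L -> {poly {poly R}}) (al : R) :
  0 < al -> al != 1 -> (exists b, P b != 0) -> (forall b, bidegree_le kap (P b)) ->
  exists Q, [/\ Q != 0, bidegree_le (kap * L) Q &
    forall x y Y : R, Y != 0 ->
      (forall i : 'I_L, \sum_b ev2 (P b) (x + i%:R) y * (al ^+ i * Y) ^+ b = 0) ->
      ev2 Q x y = 0].
Proof.
move=> al0 al1 [b0 Pb0] dP.
pose S := [set b | P b != 0]; pose m := #|S|.
have mL : (m <= L)%N by rewrite -[X in (_ <= X)%N]card_ord max_card.
pose e (c : 'I_m) : 'I_L := enum_val c.
have eP c : P (e c) != 0 by have := enum_valP c; rewrite inE.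
pose T (i : 'I_m) (c : 'I_m) := shift2 (i : nat)%:Z 0 (P (e c)).
pose F := \matrix_(i < m, c < m) ((al ^+ (i * e c))%:P%:P * T i c).
have sF i c : bidegree_le kap (F i c).
  by rewrite mxE mul_polyC; apply: bidegree_leZ; apply: bidegree_le_shift2.
exists (\det F); split.
- have al0' (n : nat) : al ^+ n != 0 by rewrite expf_neq0 // gt_eqF.
  have sT i c : size (F i c) = size (P (e c)).
    by rewrite mxE size_Cmul ?polyC_eq0 // size_shift2.
  have topF (i c : 'I_m) : (F i c)`_(size (P (e c))).-1 =
      (al ^+ (i * e c))%:P * (T i c)`_(size (P (e c))).-1.
    by rewrite mxE coefCM.
  apply: contraTneq isT => detF0.
  (* The top coefficient is read off twice, first in [y] and then in [x]. *)
  have := @det_coef_top _ m F (fun c => (size (P (e c))).-1).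
  rewrite detF0 coef0 => /(_ _)/esym d1.
  have {}d1 : \det (\matrix_(i, c) (F i c)`_(size (P (e c))).-1) = 0.
    by apply: d1 => i c; rewrite sT leqSpred.
  have := @det_coef_top _ m (\matrix_(i, c) (F i c)`_(size (P (e c))).-1)
    (fun c => (size (lead_coef (P (e c)))).-1).
  rewrite d1 coef0 => /(_ _)/esym d2.
  have /eqP : \det (\matrix_(i, c) (lead_coef (lead_coef (P (e c))) *
     (\matrix_(i < m, c < m) (al ^+ e c) ^+ i) i c)) = 0.
    rewrite -d2; last first.
      move=> i c; rewrite mxE topF; apply: leq_trans (size_polyMleq _ _) _.
      rewrite size_polyC al0' add1n /=.
      have -> : (T i c)`_(size (P (e c))).-1 = lead_coef (P (e c)) \Po ('X + (i : nat)%:Z%:~R).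
        by rewrite -(lead_shift2 (i : nat)%:Z 0) lead_coefE size_shift2.
      by rewrite size_comp_poly2 ?size_XDint // leqSpred.
    congr (\det _); apply/matrixP => i c; rewrite [RHS]mxE [LHS]mxE.
    have -> : (\matrix_(i, c) (F i c)`_(size (P (e c))).-1) i c =
      (F i c)`_(size (P (e c))).-1 by rewrite mxE.
    by rewrite topF coefCM lead_shift2_top mxE mulrC -exprM mulnC.
  rewrite det_scale_cols mulf_eq0 => /orP[/prodf_eq0 [c _]|].
    by rewrite !lead_coef_eq0 (negPf (eP c)).
  have inj := ieexprIn al0 al1.
  apply: contraLR => _; apply: det_vandermonde_neq0 => c c' /inj /val_inj.
  exact: enum_val_inj.
- apply: (@bidegree_leW (kap * m)); first by rewrite leq_mul2l mL orbT.
  exact: bidegree_le_det.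
- move=> x y Y Y0 van; rewrite det_ev2; apply/eqP; rewrite -det_tr; apply/det0P.
  (* The relations say that the powers of [Y] form a kernel vector of the evaluated matrix; it is
     nonzero since [Y] is. *)
  exists (\row_c Y ^+ e c).
    have b0S : b0 \in S by rewrite inE.
    apply/eqP => /rowP /(_ (enum_rank_in b0S b0)); rewrite !mxE.
    by apply/eqP; rewrite expf_neq0.
  apply/rowP => i; rewrite !mxE.
  have iL : (i < L)%N by apply: leq_trans mL.
  rewrite -[RHS](van (Ordinal iL)) [RHS](bigID (mem S)) /= [X in _ = _ + X]big1 ?addr0.
    rewrite [in RHS]big_enum_val; apply: eq_bigr => c _; rewrite !mxE ev2M ev2C ev2_shift.
    rewrite mulr0z addr0 exprMn exprM -pmulrn.
    move: (ev2 _ _ _) (al ^+ i) => w a.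
    by rewrite [RHS]mulrC [(a ^+ _) * _ in RHS]mulrC -mulrA.
  move=> b; rewrite inE negbK => /eqP ->.
  by rewrite /ev2 !horner0 mul0r.
Qed.

End Elimination.

(** * Interpolation by binomial polynomials *)

Section Interpolation.

Variable R : realFieldType.
Implicit Types (f : {poly {poly R}}).

(** Independence of the rows on [pts] means that the evaluation matrix has full rank; [h] selects
    points for which it becomes invertible. *)
Lemma exists_nonzero_minor (T : Type) (M : nat) (pts : seq T) (t0 : T)
    (F : 'I_M -> T -> R) :
  (forall c : 'I_M -> R,
     (forall n, (n < size pts)%N -> \sum_r c r * F r (nth t0 pts n) = 0) ->
     forall r, c r = 0) ->
  exists h : 'I_M -> nat, (forall j, (h j < size pts)%N) /\
    \det (\matrix_(r, j) F r (nth t0 pts (h j))) != 0.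
Proof.
move=> inj; pose A := \matrix_(n < size pts, r < M) F r (nth t0 pts n).
have fA : row_full A.
  rewrite /row_full -mxrank_tr -/(row_free A^T); apply: inj_row_free => v vA.
  apply/rowP => r; rewrite mxE; apply: (inj (fun r => v 0 r)) => n ns.
  have := congr1 (fun w : 'rV_(size pts) => w 0 (Ordinal ns)) vA.
  rewrite !mxE => {2}<-; apply: eq_bigr => i _; by rewrite !mxE.
exists (fun j => fullrankfun fA j); split=> // .
have := fullrowsub_unit fA; rewrite unitmxE unitfE -det_tr.
by congr (\det _ != 0); apply/matrixP => r j; rewrite !mxE.
Qed.

(** The binomial polynomial [f (f - 1) ... (f - i + 1) / i!]. Its values at naturals are integers,
    so the determinants stay algebraic integers, while the factorial in the denominator lowers their
    size. *)
Definition fallp (i : nat) f : {poly {poly R}} :=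
  ((i`!%:R : R)^-1)%:P *: \prod_(s < i) (f - s%:R).

Lemma ev2_prod (I : Type) (s : seq I) (F : I -> {poly {poly R}}) x y :
  ev2 (\prod_(i <- s) F i) x y = \prod_(i <- s) ev2 (F i) x y.
Proof.
elim: s => [|i s IH]; first by rewrite !big_nil /ev2 !hornerC.
by rewrite !big_cons ev2M IH.
Qed.

Lemma ev2_sum (I : Type) (s : seq I) (P : pred I) (F : I -> {poly {poly R}}) x y :
  ev2 (\sum_(i <- s | P i) F i) x y = \sum_(i <- s | P i) ev2 (F i) x y.
Proof.
elim: s => [|i s IH]; first by rewrite !big_nil /ev2 !horner0.
by rewrite !big_cons; case: ifP => _; rewrite ?ev2D IH.
Qed.

Lemma ev2Z (c : R) f x y : ev2 (c%:P *: f) x y = c * ev2 f x y.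
Proof. by rewrite /ev2 !hornerE. Qed.

Lemma ev2N f x y : ev2 (- f) x y = - ev2 f x y.
Proof. by rewrite /ev2 !hornerE. Qed.

Lemma ev2_nat (n : nat) x y : ev2 (n%:R : {poly {poly R}}) x y = n%:R.
Proof.
have -> : n%:R = ((n%:R : R)%:P)%:P :> {poly {poly R}} by rewrite !polyC_natr.
exact: ev2C.
Qed.

Lemma falling_binomial (n i : nat) :
  (i`!%:R : R)^-1 * \prod_(s < i) (n%:R - s%:R) = ('C(n, i))%:R.
Proof.
apply: (mulfI (x := i`!%:R)); first by rewrite pnatr_eq0 -lt0n fact_gt0.
rewrite mulrA mulfV ?mul1r -?natrM; last by rewrite pnatr_eq0 -lt0n fact_gt0.
rewrite mulnC bin_ffact; elim: i => [|i IH]; first by rewrite big_ord0.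
rewrite big_ord_recr /= IH ffactnSr natrM.
have [ni|ni] := leqP i n; first by rewrite natrB.
by rewrite ffact_small // !mul0r.
Qed.

Lemma ev2_fallp i f x y (n : nat) : ev2 f x y = n%:R ->
  ev2 (fallp i f) x y = ('C(n, i))%:R.
Proof.
move=> fn; rewrite /fallp ev2Z ev2_prod -falling_binomial; congr (_ * _).
by apply: eq_bigr => s _; rewrite ev2D ev2N ev2_nat fn.
Qed.

Lemma bidegree_le_fallp i f : bidegree_le 1 f -> bidegree_le i (fallp i f).
Proof.
move=> df; apply: bidegree_leZ; elim: i => [|i IH].
  rewrite big_ord0; split=> [|n]; rewrite ?size_poly1 // coef1.
  by case: eqP => _; rewrite ?size_poly1 ?size_poly0.
rewrite big_ord_recr /= -addn1; apply: bidegree_leM => //; apply: bidegree_leD => //.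
have -> : - (i%:R) = (- (i%:R : R))%:P%:P :> {poly {poly R}} by rewrite !rmorphN /= !polyC_natr.
split=> [|n]; first by apply: leq_trans (size_polyC_leq1 _) _.
by rewrite coefC; case: eqP => _; rewrite ?size_poly0 // (leq_trans (size_polyC_leq1 _)).
Qed.

(** Triangularity: at [x = p.1], [y = p.2] only the indices below [p] in both coordinates survive,
    and those other than [p] have smaller total degree. *)
Lemma binomial_products_free (K : nat) (c : 'I_K * 'I_K -> R) :
  (forall x y : nat, \sum_(p : 'I_K * 'I_K | (p.1 + p.2 < K)%N)
      c p * (('C(x, p.1))%:R * ('C(y, p.2))%:R) = 0) ->
  forall p : 'I_K * 'I_K, (p.1 + p.2 < K)%N -> c p = 0.
Proof.
move=> van; suff H s (p : 'I_K * 'I_K) : (p.1 + p.2 < K)%N -> (p.1 + p.2 < s)%N -> c p = 0.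
  by move=> p pK; apply: (H (p.1 + p.2).+1).
elim: s p => [|s IH] // p pK ps.
have := van p.1 p.2; rewrite (bigD1 p) //= !binn !mulr1 big1 ?addr0 // => q /andP[qK qp].
have [lt1|le1] := ltnP p.1 q.1; first by rewrite (bin_small lt1) mul0r mulr0.
have [lt2|le2] := ltnP p.2 q.2; first by rewrite (bin_small lt2) !mulr0.
rewrite IH ?mul0r //; suff : (q.1 + q.2 != p.1 + p.2)%N by lia.
apply: contra qp => /eqP e.
have [e1 e2] : q.1 = p.1 :> nat /\ q.2 = p.2 :> nat by lia.
by move: e1 e2; case: (q) (p) => [q1 q2] [p1 p2] /= /val_inj -> /val_inj ->; apply/eqP.
Qed.

End Interpolation.

(** * Zero estimates on boxes of points *)

Section ZeroEstimates.

Variable R : realFieldType.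

Definition grid (m n : nat) := [seq (u, v) | u <- iota 0 m, v <- iota 0 n].

Lemma size_grid m n : size (grid m n) = (m * n)%N.
Proof. by rewrite size_allpairs !size_iota. Qed.
Lemma uniq_grid m n : uniq (grid m n).
Proof. by apply: allpairs_uniq; rewrite ?iota_uniq // => -[? ?] [? ?]. Qed.
Lemma mem_grid m n s : (s \in grid m n) = (s.1 < m)%N && (s.2 < n)%N.
Proof.
apply/allpairsP/andP => [[[u v] /= [+ + ->]]|[iv iw]]; first by rewrite !mem_iota.
by exists s; rewrite !mem_iota; case: (s) iv iw.
Qed.

Definition box (U V W : nat) : seq (nat * nat * nat) :=
  [seq (uv, w) | uv <- grid U V, w <- iota 0 W].

Lemma mem_box U V W u v w :
  ((u, v, w) \in box U V W) = [&& (u < U)%N, (v < V)%N & (w < W)%N].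
Proof.
rewrite andbA; apply/allpairsP/andP => [[[uv w'] /= [gu iw [eu ew]]]|[uv iw]].
  by move: gu iw; rewrite -eu -ew mem_grid mem_iota => ->.
by exists ((u, v), w); rewrite mem_grid mem_iota.
Qed.

Lemma size_box U V W : size (box U V W) = (U * V * W)%N.
Proof. by rewrite size_allpairs size_grid size_iota. Qed.

Lemma uniq_box U V W : uniq (box U V W).
Proof. by apply: allpairs_uniq; rewrite ?uniq_grid ?iota_uniq // => -[? ?] [? ?]. Qed.

(* The shear [zeta = x + H y] separates the points of the box, so that no
   common zero is lost by projecting the resultant to the [zeta]-axis. *)
Lemma three_log_zero_estimate (K L k N U1 V1 W1 U2 V2 W2 : nat) (al : R)
    (Y : nat -> nat -> nat -> R) (c : 'I_K * 'I_K -> 'I_L -> R) :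
  1 < al -> (forall u v w, Y u v w != 0) ->
  (forall i u v w, Y (u + i)%N v w = al ^+ i * Y u v w) ->
  (0 < U1)%N -> (0 < V1)%N -> (0 < W1)%N -> (U2 <= k)%N ->
  (2 * (K.-1 * L) ^ 2 < U2 * V2 * W2)%N ->
  (forall u v w, (u < U1 + U2 + L)%N -> (v < V1 + V2)%N -> (w < W1 + W2)%N ->
     \sum_(b < L) \sum_(p : 'I_K * 'I_K | (p.1 + p.2 < K)%N) c p b *
        (('C(u + k * w, p.1))%:R * ('C(v + N * w, p.2))%:R * Y u v w ^+ b) = 0) ->
  (forall (p : 'I_K * 'I_K) b, (p.1 + p.2 < K)%N -> c p b = 0) \/
  exists a b : int, coprimez a b /\
    (size (undup [seq (a * (s.1.1 + k * s.2)%:Z + b * (s.1.2 + N * s.2)%:Z)%R |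
       s <- box U1 V1 W1]) <= K.-1 * L)%N.
Proof.
move=> al1 Y0 Yshift U10 V10 W10 U2k big van.
(* [H] exceeds every [x = u + k w] of the second box, so division of [zeta] by [H] recovers [y] and
   [x]; since [U2 <= k], division of [x] by [k] then recovers [w] and [u]. *)
pose H := (U2 + k * W2)%N.
pose fy : {poly {poly R}} := 'X.
pose fx : {poly {poly R}} := ('X)%:P - H%:R * 'X.
have ev_fx x y : ev2 fx x y = x - H%:R * y.
  by rewrite /fx ev2D ev2N ev2M ev2_nat /ev2 !hornerE.
have ev_fy x y : ev2 fy x y = y by rewrite /fy /ev2 !hornerE.
pose P (b : 'I_L) := \sum_(p : 'I_K * 'I_K | (p.1 + p.2 < K)%N)
  (c p b)%:P *: (fallp p.1 fx * fallp p.2 fy).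
have dfy : bidegree_le 1 fy.
  split=> [|i]; first by rewrite size_polyX.
  by rewrite coefX; case: eqP; rewrite ?size_poly1 ?size_poly0.
have dfx : bidegree_le 1 fx.
  apply: bidegree_leD.
    split=> [|i]; first by apply: leq_trans (size_polyC_leq1 _) _.
    by rewrite coefC; case: eqP; rewrite ?size_polyX ?size_poly0.
  have -> : - (H%:R * 'X) = (- H%:R : R)%:P *: 'X :> {poly {poly R}}.
    by rewrite -mul_polyC !rmorphN /= !polyC_natr mulNr.
  exact: bidegree_leZ.
have dP b : bidegree_le K.-1 (P b).
  rewrite /P; elim/big_ind: _ => [|f g|p pK].
  - by split=> [|i]; rewrite ?coef0 size_poly0.
  - exact: bidegree_leD.
  apply: bidegree_leZ; apply: (@bidegree_leW _ (p.1 + p.2)); first by rewrite -ltnS (ltn_predK pK).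
  by apply: bidegree_leM; apply: bidegree_le_fallp.
have evP b (x y : nat) : ev2 (P b) (x%:R + H%:R * y%:R) y%:R =
    \sum_(p : 'I_K * 'I_K | (p.1 + p.2 < K)%N)
      c p b * (('C(x, p.1))%:R * ('C(y, p.2))%:R).
  rewrite /P ev2_sum; apply: eq_bigr => p _; rewrite ev2Z ev2M.
  rewrite (@ev2_fallp _ _ _ _ _ x) ?ev_fx ?addrK //.
  by rewrite (@ev2_fallp _ _ _ _ _ y) ?ev_fy.
have [allP0|] := boolP [forall b, P b == 0].
  left=> p b pK; apply: (@binomial_products_free _ _ (fun p => c p b)) pK => x y.
  by rewrite -evP (eqP (forallP allP0 b)) /ev2 !horner0.
rewrite negb_forall => /existsP [b0 Pb0]; right.
have [Q [Q0 dQ zQ]] := @eliminate_exponential _ L K.-1 P al (lt_trans ltr01 al1) (negbT (gt_eqF al1)) (ex_intro _ b0 Pb0) dP.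
pose zx (s : nat * nat * nat) : nat := (s.1.1 + k * s.2)%N.
pose zy (s : nat * nat * nat) : nat := (s.1.2 + N * s.2)%N.
pose pt (s : nat * nat * nat) : R * R := ((zx s)%:R + H%:R * (zy s)%:R, (zy s)%:R).
pose zt (s : nat * nat * nat) : int * int := ((zx s + H * zy s)%:Z, (zy s)%:Z).
(* The [L] additional values of [u] are used up by the translates in the elimination. What remains
   is a sum of two boxes: the first gives the translations and the second the zeros of
   [planar_zero_estimate]. *)
have Qvan u v w : (u < U1 + U2)%N -> (v < V1 + V2)%N -> (w < W1 + W2)%N ->
    ev2 Q (pt (u, v, w)).1 (pt (u, v, w)).2 = 0.
  move=> iu iv iw; apply: (zQ _ _ (Y u v w)) => // i.
  have iL := ltn_ord i; have h := van (u + i)%N v w.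
  rewrite -[RHS]h ?iv ?iw //; last by lia.
  apply: eq_bigr => b _; rewrite -Yshift.
  have -> : (pt (u, v, w)).1 + i%:R = (zx (u + i, v, w))%N%:R + H%:R * (zy (u + i, v, w))%N%:R.
    by rewrite /pt /zx /zy /= addrAC -natrD addnAC.
  rewrite evP mulr_suml; apply: eq_bigr => p _.
  by rewrite /zx /zy /= addnAC -addnA !mulrA.
have zxH s : s \in box U2 V2 W2 -> (zx s < H)%N.
  case: s => [[u v] w]; rewrite mem_box => /and3P[iu iv iw]; rewrite /zx /H /=.
  by rewrite -addSn leq_add // leq_mul2l ltnW ?orbT.
have inj : {in box U2 V2 W2 &, injective (fun s => (pt s).1)}.
  move=> s s' sB s'B; rewrite /pt /= -!natrM -!natrD => /eqP; rewrite eqr_nat => /eqP e.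
  have ey : zy s = zy s'.
    have := congr1 (divn^~ H) e; have H0 : (0 < H)%N by apply: leq_ltn_trans (zxH s sB).
    by rewrite ![(_ + H * _)%N]addnC ![(H * _)%N]mulnC !divnMDl // !divn_small ?addn0 // zxH.
  have ex : zx s = zx s' by move: e; rewrite ey => /addIn.
  case: s s' sB s'B ey ex {e} => [[u v] w] [[u' v'] w']; rewrite !mem_box /zx /zy /=.
  move=> /and3P[iu iv iw] /and3P[iu' iv' iw'] ey ex.
  have uk : (u < k)%N by apply: leq_trans U2k.
  have uk' : (u' < k)%N by apply: leq_trans U2k.
  have k0 : (0 < k)%N by apply: leq_ltn_trans uk.
  have ew : w = w'.
    have := congr1 (divn^~ k) ex.
    by rewrite ![(_ + k * _)%N]addnC ![(k * _)%N]mulnC !divnMDl // !divn_small ?addn0.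
  move: ey ex; rewrite ew => /addIn -> /addIn ->; by [].
have [|z sg|||a [b [cab sz]]] :=
    @planar_zero_estimate R (K.-1 * L) Q (map zt (box U1 V1 W1)) (map pt (box U2 V2 W2)) Q0 dQ.
- by rewrite -map_comp map_inj_in_uniq ?uniq_box.
- move=> /mapP [[[u v] w]] + -> /mapP [[[u' v'] w']] + ->.
  rewrite !mem_box => /and3P[iu iv iw] /and3P[iu' iv' iw'].
  have := Qvan (u + u')%N (v + v')%N (w + w')%N; rewrite /pt /zt /zx /zy /= => Q0'.
  rewrite -[RHS]Q0'; [|by lia..].
  by congr (ev2 Q _ _); rewrite -!pmulrn -?natrM -!natrD; congr (_%:R); ring.
- by apply/mapP; exists (0, 0, 0)%N; rewrite ?mem_box ?U10 ?V10 // /zt /zx /zy /= !muln0.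
- by rewrite size_map size_box.
(* A form [a zeta + b y] reads [a x + (a H + b) y] in the original coordinates, and its coefficients
   stay coprime. *)
exists a, (a * H%:Z + b); split.
  by rewrite /coprimez mulrC gcdzMDl.
move: sz; rewrite -map_comp; congr (size (undup _) <= _)%N.
apply: eq_map => s; rewrite /= /zt /zx /zy /=.
by rewrite PoszD PoszM; ring.
Qed.

(** Here the polynomials depend on [x] only. The eliminated [Q] vanishes on the whole vertical line
    over each of the [V W] distinct values [v + j w], so its leading coefficient in [y] has more
    roots than its degree [(K - 1) L] permits. *)
Lemma two_log_zero_estimate (K L j V W : nat) (al : R)
    (Y : nat -> nat -> R) (c : 'I_K -> 'I_L -> R) :
  0 < al -> al != 1 -> (forall v w, Y v w != 0) ->
  (forall i v w, Y (v + i)%N w = al ^+ i * Y v w) ->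
  (V <= j)%N -> (K.-1 * L < V * W)%N ->
  (forall v w, (v < V + L)%N -> (w < W)%N ->
     \sum_(b < L) \sum_(i < K) c i b * (('C(v + j * w, i))%:R * Y v w ^+ b) = 0) ->
  forall i b, c i b = 0.
Proof.
move=> al0 al1 Y0 Yshift Vj big van.
pose fx : {poly {poly R}} := ('X)%:P.
have ev_fx x y : ev2 fx x y = x by rewrite /fx /ev2 !hornerE.
have dfx : bidegree_le 1 fx.
  split=> [|i]; first by apply: leq_trans (size_polyC_leq1 _) _.
  by rewrite coefC; case: eqP; rewrite ?size_polyX ?size_poly0.
pose P (b : 'I_L) := \sum_(i < K) (c i b)%:P *: fallp i fx.
have dP b : bidegree_le K.-1 (P b).
  rewrite /P; elim/big_ind: _ => [|f g|i _].
  - by split=> [|i]; rewrite ?coef0 size_poly0.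
  - exact: bidegree_leD.
  apply: bidegree_leZ; apply: (@bidegree_leW _ i); last exact: bidegree_le_fallp.
  by rewrite -ltnS (ltn_predK (ltn_ord i)).
have evP b (x : nat) y : ev2 (P b) x%:R y = \sum_(i < K) c i b * ('C(x, i))%:R.
  by rewrite /P ev2_sum; apply: eq_bigr => i _; rewrite ev2Z (@ev2_fallp _ _ _ _ _ x) ?ev_fx.
have [allP0|] := boolP [forall b, P b == 0].
  move=> i b.
  (* Binomials in one variable are treated as products whose second degree is zero. *)
  pose c2 (p : 'I_K * 'I_K) := c p.1 b *+ (p.2 == 0 :> nat).
  have K0 : (0 < K)%N by apply: leq_ltn_trans (ltn_ord i).
  have -> : c i b = c2 (i, Ordinal K0) by rewrite /c2 eqxx mulr1n.
  apply: (@binomial_products_free R K c2); last by rewrite /= addn0.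
  move=> x y; have := evP b x 0; rewrite (eqP (forallP allP0 b)) /ev2 !horner0 => e.
  rewrite (bigID (fun p : 'I_K * 'I_K => p.2 == 0 :> nat)) /= [X in _ + X]big1 ?addr0; last first.
    by move=> p /andP[_ /negPf p0]; rewrite /c2 p0 mulr0n mul0r.
  rewrite [RHS]e.
  rewrite (reindex (fun i : 'I_K => (i, Ordinal K0))) /=; last first.
    exists fst => [//|[p1 p2]] /=; rewrite inE /= => /andP[_ /eqP p0].
    by congr pair; apply: val_inj.
  by apply: eq_big => [q|q _]; rewrite ?addn0 ?ltn_ord ?eqxx // /c2 eqxx mulr1n /= bin0 mulr1.
rewrite negb_forall => /existsP [b0 Pb0].
have [Q [Q0 dQ zQ]] := @eliminate_exponential _ L K.-1 P al al0 al1 (ex_intro _ b0 Pb0) dP.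
exfalso; move: big; rewrite ltnNge => /negP; apply.
have lQ0 : lead_coef Q != 0 by rewrite lead_coef_eq0.
pose x (s : nat * nat) : nat := (s.1 + j * s.2)%N.
pose bx := grid V W; have sbx : size bx = (V * W)%N := size_grid V W.
have inj : {in bx &, injective (fun s => (x s)%:R : R)}.
  move=> [v w] [v' w']; rewrite !mem_grid /= => /andP[iv iw] /andP[iv' iw'] /eqP; rewrite eqr_nat /x /= => /eqP e.
  have vj : (v < j)%N by apply: leq_trans Vj.
  have vj' : (v' < j)%N by apply: leq_trans Vj.
  have j0 : (0 < j)%N by apply: leq_ltn_trans vj.
  have ew : w = w'.
    have := congr1 (divn^~ j) e.
    by rewrite ![(_ + j * _)%N]addnC ![(j * _)%N]mulnC !divnMDl // !divn_small ?addn0.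
  by move: e; rewrite ew => /addIn ->.
rewrite -sbx -(size_map (fun s => (x s)%:R : R)) -ltnS.
apply: leq_trans (_ : (size (lead_coef Q) <= _)%N); last by rewrite lead_coefE; case: dQ.
apply: max_poly_roots => //; last by rewrite map_inj_in_uniq ?uniq_grid.
apply/allP => _ /mapP [[v w] + ->]; rewrite mem_grid /= => /andP[iv iw].
have Qy (y : R) : ev2 Q (x (v, w))%:R y = 0.
  apply: (zQ _ _ (Y v w)) => // i.
  have iL := ltn_ord i; have h := van (v + i)%N w.
  rewrite -[RHS]h //; last by lia.
  apply: eq_bigr => b _; rewrite -Yshift.
  have -> : (x (v, w))%:R + i%:R = (x (v + i, w))%N%:R :> R.
    by rewrite /x /= -natrD addnAC.
  by rewrite evP mulr_suml; apply: eq_bigr => p _; rewrite /x /= addnAC mulrA.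
(* Specialized at this [x], [Q] is a polynomial in [y] with too many roots, hence zero in every
   coefficient. *)
pose q := map_poly (horner_eval ((x (v, w))%:R : R)) Q.
have q0 : q = 0.
  apply/eqP; apply: contraT => nq.
  pose rs := [seq (n%:R : R) | n <- iota 0 (size q)].
  have := @max_poly_roots _ q rs nq.
  rewrite size_map size_iota ltnn => -> //.
    apply/allP => _ /mapP [n _ ->]; apply/rootP; rewrite -[RHS](Qy n%:R) /ev2 /q.
    have -> : n%:R = horner_eval ((x (v, w))%:R : R) (n%:R)%:P by rewrite /horner_eval hornerC.
    by rewrite horner_map /= /horner_eval hornerC.
  by rewrite map_inj_uniq ?iota_uniq // => a b /eqP; rewrite eqr_nat => /eqP.
apply/rootP; have := congr1 (fun f : {poly R} => f`_(size Q).-1) q0.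
by rewrite coef0 coef_map /= -lead_coefE.
Qed.

End ZeroEstimates.

(** * Boxes with few values of a linear form *)

Section DegenerateBox.

Variables (k N U V W V' D : nat) (a b : int).

Let form (s : nat * nat * nat) : int := a * (s.1.1 + k * s.2)%:Z + b * (s.1.2 + N * s.2)%:Z.
Let vals := undup [seq form s | s <- box U V W].
Hypothesis small : (size vals <= D)%N.

(** Used by contradiction: a family of more than [D] points of the box on which the form is
    injective cannot exist. *)
Lemma injective_count (T : eqType) (s : seq T) (f : T -> nat * nat * nat) :
  uniq s -> {in s, forall x, f x \in box U V W} -> {in s &, injective (form \o f)} ->
  (size s <= D)%N.
Proof.
move=> us fB inj; apply: leq_trans small.
rewrite -(size_map (form \o f)); apply: uniq_leq_size; first by rewrite map_inj_in_uniq.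
by move=> _ /mapP[x xs ->]; rewrite mem_undup; apply/mapP; exists (f x) => //; apply: fB.
Qed.

Hypotheses (ab : coprimez a b) (V'V : (V' <= V)%N) (V'0 : (0 < V')%N) (W0 : (0 < W)%N)
  (V0 : (0 < V)%N) (U0 : (0 < U)%N)
  (Uk : (U <= k)%N) (UV : (D < U * V')%N) (UW : (D < U * W)%N) (kW : (D < k * W)%N) (NW : (D < N * W)%N)
  (VW : (D < (V - V') * W)%N).

(** For [b = 0] coprimality forces [a] to be 1 or -1, and the [U W] values [u + k w] are distinct
    because [U <= k]. *)
Lemma degenerate_b_neq0 : b != 0.
Proof.
apply/eqP => b0; move: UW; rewrite ltnNge => /negP; apply.
have a1 : `|a|%N = 1%N by move: ab; rewrite /coprimez b0 gcdz0 => /eqP; case.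
rewrite -size_grid.
apply: (@injective_count _ _ (fun s => (s.1, 0, s.2)%N)); first exact: uniq_grid.
  by move=> s; rewrite mem_grid mem_box => /andP[-> ->]; rewrite V0.
move=> [u w] [u' w']; rewrite !mem_grid /form /= => /andP[iu iw] /andP[iu' iw'].
rewrite b0 !mul0r !addr0 => /mulfI h.
have /h [e] : a != 0 by rewrite -absz_gt0 a1.
have k0 : (0 < k)%N by apply: leq_trans U0 Uk.
have ew : w = w'.
  have := congr1 (divn^~ k) e.
  by rewrite ![(_ + k * _)%N]addnC ![(k * _)%N]mulnC !divnMDl // !divn_small ?addn0 //; apply: leq_trans Uk.
by move: e; rewrite ew => /addIn ->.
Qed.

Lemma dvdz_diff_small (c : int) (u u' n : nat) : (u < n)%N -> (u' < n)%N -> (n <= `|c|)%N ->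
  (c %| u%:Z - u'%:Z)%Z -> u = u'.
Proof.
move=> iu iu' nc /dvdzP [r e].
case: (eqVneq r 0) => [r0|r0]; first by move: e; rewrite r0 mul0r => /eqP; rewrite subr_eq0 eqz_nat => /eqP.
have r1 : (0 < `|r|)%N by rewrite absz_gt0.
have := congr1 absz e; rewrite abszM => e'.
have : (`|c| <= `|r| * `|c|)%N by rewrite leq_pmull.
by move: e'; move: (`|r| * `|c|)%N => y; lia.
Qed.

Lemma line_injective u v u' v' : a * u%:Z + b * v%:Z = a * u'%:Z + b * v'%:Z ->
  (b %| u%:Z - u'%:Z)%Z && (a %| v%:Z - v'%:Z)%Z.
Proof.
move=> e; apply/andP; split.
  rewrite -(@Gauss_dvdzr _ a) 1?coprimez_sym //; apply/dvdzP; exists (v'%:Z - v%:Z).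
  by rewrite mulrBr mulrBl -!(mulrC b); lia.
rewrite -(@Gauss_dvdzr _ b) //; apply/dvdzP; exists (u'%:Z - u%:Z).
by rewrite mulrBr mulrBl -!(mulrC a); lia.
Qed.

(** If [|b| >= U], then [b] divides [u - u'] only for [u = u'], so the form separates the [U V']
    points with [v < V'] and [w = 0]. *)
Lemma degenerate_b_lt : (`|b| < U)%N.
Proof.
rewrite ltnNge; apply/negP => bU; move: UV; rewrite ltnNge => /negP; apply.
rewrite -size_grid.
apply: (@injective_count _ _ (fun s => (s.1, s.2, 0)%N)); first exact: uniq_grid.
  move=> s; rewrite mem_grid mem_box W0 => /andP[-> iv] /=.
  by rewrite andbT; apply: leq_trans V'V.
move=> [u v] [u' v']; rewrite !mem_grid /form /= !muln0 !addn0 => /andP[iu iv] /andP[iu' iv'] e.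
have /andP[bu _] := line_injective e.
have eu := dvdz_diff_small iu iu' bU bu.
move: e; rewrite eu => /addrI /(mulfI degenerate_b_neq0) [->] //.
Qed.

(** The argument for [b] with the roles exchanged. Bounding [a] by [V'] and not merely by [V] leaves
    [V - V'] steps in [v] for the interval below. *)
Lemma degenerate_a_lt : (`|a| < V')%N.
Proof.
rewrite ltnNge; apply/negP => aV; move: UV; rewrite ltnNge => /negP; apply.
have a0 : a != 0 by rewrite -absz_gt0 (leq_trans V'0).
rewrite -size_grid.
apply: (@injective_count _ _ (fun s => (s.1, s.2, 0)%N)); first exact: uniq_grid.
  move=> s; rewrite mem_grid mem_box W0 => /andP[-> iv] /=.
  by rewrite andbT; apply: leq_trans V'V.
move=> [u v] [u' v']; rewrite !mem_grid /form /= !muln0 !addn0 => /andP[iu iv] /andP[iu' iv'] e.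
have /andP[_ av] := line_injective e.
have ev := dvdz_diff_small iv iv' aV av.
by move: e; rewrite ev => /addIr /(mulfI a0) [->].
Qed.

Hypothesis bpos : 0 < b.
(** [lo] and [J] are the start and length of an interval of integers filled by [a u + b v], and [c]
    is the effect of one step in [w]: the values on the box contain [W] translates of an
    interval. *)
Let J := (`|b| * (V - V'))%N.
Let lo := if 0 < a then a * (b - 1) else 0.
Let c := a * k%:Z + b * N%:Z.

(* Since [b < U], the first coordinate runs over all residues modulo [b];
   the values of [a u + b v] therefore fill a whole interval. *)
Lemma interval_covered (z : int) : lo <= z -> z < lo + J%:Z ->
  exists u v : nat, [/\ (u < U)%N, (v < V)%N & a * u%:Z + b * v%:Z = z].
Proof.
move=> zl zu; have b0 := degenerate_b_neq0; have bU := degenerate_b_lt; have aV := degenerate_a_lt.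
have [x [y xy]] : exists x y : int, x * a + y * b = 1.
  by have [x [y]] := Bezoutz a b; rewrite (eqP ab) => e; exists x, y.
(* By [x a + y b = 1] this is the residue for which [b] divides [z - a u]. The quotient is [v]; the
   offset [lo] and the bound on [a] keep it in range for either sign of [a]. *)
pose u := `|(z * x %% b)%Z|%N.
have uE : u%:Z = (z * x %% b)%Z by rewrite gez0_abs // modz_ge0.
have bE : `|b|%:Z = b by rewrite gez0_abs // ltW.
have ub : u%:Z < b by rewrite uE ltz_pmod.
have dv : (b %| z - a * u%:Z)%Z.
  rewrite uE; apply/dvdzP; exists (z * y + a * (z * x %/ b)%Z).
  have e := divz_eq (z * x) b.
  have -> : (z * x %% b)%Z = z * x - (z * x %/ b)%Z * b.
    by apply/eqP; rewrite eq_sym subr_eq addrC; apply/eqP.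
  by rewrite -[X in X - _]mulr1 -xy; move: (z * x %/ b)%Z => ?; ring.
have [v vE] := dvdzP dv.
have {}zu : z < lo + b * (V%:Z - V'%:Z) by move: zu; rewrite /J PoszM bE subzn.
have u0 : 0 <= u%:Z by [].
have vI : 0 <= v < V%:Z.
  move: zl zu vE u0 ub; rewrite /lo; move: (u%:Z) => w; have [a0|a0] := ltP 0 a => zl zu vE u0 ub.
    have aI : a <= V'%:Z - 1 by lia.
    have w1 : a * w <= a * (b - 1) by apply: ler_wpM2l; lia.
    have w2 : 0 <= a * w by apply: mulr_ge0; lia.
    have w3 : b * a <= b * (V'%:Z - 1) by apply: ler_wpM2l; lia.
    rewrite -(pmulr_lge0 _ bpos) -(ltr_pM2r bpos) -vE [V%:Z * b]mulrC.
    by apply/andP; split; lia.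
  have aI : - a <= V'%:Z - 1 by lia.
  have w1 : - a * w <= - a * (b - 1) by apply: ler_wpM2l; lia.
  have w2 : 0 <= - a * w by apply: mulr_ge0; lia.
  have w3 : b * - a <= b * (V'%:Z - 1) by apply: ler_wpM2l; lia.
  rewrite -(pmulr_lge0 _ bpos) -(ltr_pM2r bpos) -vE [V%:Z * b]mulrC.
  by apply/andP; split; lia.
exists u, `|v|%N; split.
- by apply: leq_trans bU; lia.
- by lia.
by rewrite gez0_abs; [rewrite [b * v]mulrC; lia | lia].
Qed.

Lemma translates_count (m n : nat) : (m <= J)%N -> (n <= W)%N ->
  {in grid m n &, injective (fun s => s.1%:Z + c * s.2%:Z)} -> (m * n <= D)%N.
Proof.
move=> mJ nW inj; apply: leq_trans small; rewrite -size_grid.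
rewrite -(size_map (fun s => lo + (s.1%:Z + c * s.2%:Z))); apply: uniq_leq_size.
  by rewrite map_inj_in_uniq ?uniq_grid // => s s' sg s'g /addrI /inj ->.
move=> _ /mapP[[i w] + ->]; rewrite mem_grid /= => /andP[im wn].
have [u [v [uU vV e]]] : exists u v : nat, [/\ (u < U)%N, (v < V)%N & a * u%:Z + b * v%:Z = lo + i%:Z].
  by apply: interval_covered; [rewrite lerDl | rewrite ltrD2l ltz_nat; apply: leq_trans mJ].
rewrite mem_undup; apply/mapP; exists (u, v, w).
  by rewrite mem_box uU vV; apply: leq_trans nW.
by rewrite /form /= addrA -e /c !PoszD !PoszM; ring.
Qed.

Lemma degenerate_interval_le : (`|b| * (V - V') <= D)%N.
Proof.
have := @translates_count J 1 (leqnn _) W0; rewrite muln1; apply.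
move=> [i w] [i' w']; rewrite !mem_grid !ltnS !leqn0 /= => /andP[_ /eqP ->] /andP[_ /eqP ->].
by rewrite mulr0 !addr0 => -[->].
Qed.

(** Translates by multiples of [c] of an interval of length at most [|c|] are disjoint. If
    [J < |c|], the full interval would give [J W >= (V - V') W > D] values; hence [|c| <= J], and an
    interval of length [|c|] gives the bound. *)
Lemma degenerate_shift_le : (`|c| * W <= D)%N.
Proof.
have inj m : (m <= `|c|)%N -> {in grid m W &, injective (fun s => s.1%:Z + c * s.2%:Z)}.
  move=> mc [i w] [i' w']; rewrite !mem_grid /= => /andP[im _] /andP[im' _] e.
  have ei : i = i'.
    apply: (dvdz_diff_small im im' mc); apply/dvdzP; exists (w'%:Z - w%:Z).
    by rewrite mulrBl -!(mulrC c); lia.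
  move: e; rewrite ei => /addrI /mulfI h; have /h [->] // : c != 0.
  by rewrite -absz_gt0 (leq_trans _ mc) // (leq_ltn_trans _ im).
have [cJ|Jc] := leqP `|c|%N J; first exact: (translates_count cJ (leqnn _) (inj _ (leqnn _))).
have := translates_count (leqnn _) (leqnn _) (inj J (ltnW Jc)).
rewrite leqNgt (leq_trans VW) // leq_mul2r /J leq_pmull ?orbT // absz_gt0.
exact: degenerate_b_neq0.
Qed.

(** For [a >= 0] nothing cancels in [a k + b N], which is then at least [k] or [N], against
    [degenerate_shift_le]. *)
Lemma degenerate_a_lt0 : a < 0.
Proof.
have sh := degenerate_shift_le; rewrite ltNge; apply/negP => a0.
have [a1|a1] : a = 0 \/ 1 <= a by lia.
  move: NW; rewrite ltnNge => /negP; apply; apply: leq_trans sh.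
  rewrite leq_mul2r /c a1 mul0r add0r abszM /= leq_pmull ?orbT // absz_gt0.
  exact: degenerate_b_neq0.
move: kW; rewrite ltnNge => /negP; apply; apply: leq_trans sh.
rewrite leq_mul2r; apply/orP; right; rewrite -lez_nat.
have h1 : k%:Z <= a * k%:Z by rewrite ler_peMl.
have h2 : 0 <= b * N%:Z by rewrite mulr_ge0 // ltW.
by rewrite gez0_abs /c; lia.
Qed.

End DegenerateBox.

(** Here [a' = - a]: the conclusion makes [a' / b'] a good approximation of [N / k] with small
    denominator. *)
Lemma degenerate_direction (k N U V W V' D : nat) (a b : int) :
  coprimez a b ->
  (size (undup [seq (a * (s.1.1 + k * s.2)%:Z + b * (s.1.2 + N * s.2)%:Z)%R |
     s <- box U V W]) <= D)%N ->
  (0 < U)%N -> (0 < V')%N -> (V' <= V)%N -> (0 < W)%N -> (U <= k)%N ->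
  (D < U * V')%N -> (D < U * W)%N -> (D < k * W)%N -> (D < N * W)%N -> (D < (V - V') * W)%N ->
  exists b' a' : nat, [/\ (0 < b')%N, (0 < a')%N, (b' * (V - V') <= D)%N &
    (`|(b'%:Z * N%:Z - a'%:Z * k%:Z)%R| * W <= D)%N].
Proof.
move=> ab small U0 V'0 V'V W0 Uk UV UW kW NW VW.
have V0 : (0 < V)%N by apply: leq_trans V'V.
(* Negating the form negates its values and keeps their number. *)
wlog b0 : a b ab small / 0 < b.
  move=> H; have b0 := degenerate_b_neq0 small ab V0 U0 Uk UW.
  have [b1|b1] : 0 < b \/ 0 < - b by lia.
    exact: (H a b).
  apply: (H (- a) (- b)) => //; first by rewrite coprimezN coprimeNz.
  apply: leq_trans small; rewrite -(size_map -%R); apply: uniq_leq_size.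
    by rewrite map_inj_uniq ?undup_uniq //; exact: oppr_inj.
  move=> _ /mapP[z + ->]; rewrite !mem_undup => /mapP[s sB ->].
  by apply/mapP; exists s => //; ring.
exists `|b|%N, `|a|%N.
have a0 := degenerate_a_lt0 small ab V'V V'0 W0 V0 U0 Uk UV UW kW NW VW b0.
have h1 := degenerate_interval_le small ab V'V V'0 W0 V0 U0 Uk UV UW kW NW VW b0.
have h2 := degenerate_shift_le small ab V'V V'0 W0 V0 U0 Uk UV UW kW NW VW b0.
split=> //; try by rewrite absz_gt0; lia.
have -> : `|b|%:Z * N%:Z - `|a|%:Z * k%:Z = a * k%:Z + b * N%:Z; last by [].
have -> : `|b|%:Z = b by lia. 
have -> : `|a|%:Z = - a by lia.
by ring.
Qed.

(** * Analytic majorants *)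

Section Majorants.

Variable R : realFieldType.
Implicit Types (f g : {poly {poly R}}).

(** Majorants play the part of Cauchy's estimates: one value of [g] at an enlarged radius controls
    all coefficients of [f]. From here on the outer variable is [t]. *)
Definition maj f g := forall m i, `|(f`_m)`_i| <= (g`_m)`_i.
Definition inner_le (d : nat) f := forall m, (size (f`_m)%R <= d.+1)%N.

Lemma maj_ge0 f g m i : maj f g -> 0 <= (g`_m)`_i.
Proof. by move=> /(_ m i); apply: le_trans. Qed.

Lemma majD f g f' g' : maj f g -> maj f' g' -> maj (f + f') (g + g').
Proof.
by move=> fg fg' m i; rewrite !coefD; apply: le_trans (ler_normD _ _) (lerD _ _).
Qed.

Lemma majM f g f' g' : maj f g -> maj f' g' -> maj (f * f') (g * g').
Proof.
move=> fg fg' m i; rewrite !coefM !coef_sum.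
apply: le_trans (ler_norm_sum _ _ _) _; apply: ler_sum => a _; rewrite !coefM.
apply: le_trans (ler_norm_sum _ _ _) _; apply: ler_sum => b _.
by rewrite normrM; apply: ler_pM.
Qed.

Lemma majC (c d : R) : `|c| <= d -> maj c%:P%:P d%:P%:P.
Proof.
move=> cd m i; rewrite !coefC; case: eqP => _; rewrite ?coef0 ?normr0 // !coefC.
by case: eqP => _; rewrite ?normr0.
Qed.

Lemma maj_outerX : maj 'X 'X.
Proof.
move=> m i; rewrite coefX; case: eqP => _; rewrite ?coef0 ?normr0 // coef1.
by case: eqP => _; rewrite ?normr0 ?normr1.
Qed.

Lemma maj_innerX : maj ('X)%:P ('X)%:P.
Proof.
move=> m i; rewrite coefC; case: eqP => _; rewrite ?coef0 ?normr0 // coefX.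
by case: eqP => _; rewrite ?normr0 ?normr1.
Qed.

Lemma maj_sum (I : Type) (s : seq I) (F G : I -> {poly {poly R}}) :
  (forall i, maj (F i) (G i)) -> maj (\sum_(i <- s) F i) (\sum_(i <- s) G i).
Proof.
move=> FG; elim: s => [|i s IH]; last by rewrite !big_cons; apply: majD.
by rewrite !big_nil => m i; rewrite !coef0 normr0.
Qed.

Lemma maj_prod (I : Type) (s : seq I) (F G : I -> {poly {poly R}}) :
  (forall i, maj (F i) (G i)) -> maj (\prod_(i <- s) F i) (\prod_(i <- s) G i).
Proof.
move=> FG; elim: s => [|i s IH]; last by rewrite !big_cons; apply: majM.
by rewrite !big_nil -!polyC1; apply: majC; rewrite normr1.
Qed.

Lemma majX (n : nat) f g : maj f g -> maj (f ^+ n) (g ^+ n).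
Proof.
move=> fg; have := @maj_prod _ (index_enum 'I_n) (fun=> f) (fun=> g) (fun=> fg).
by rewrite !prodr_const card_ord.
Qed.

Lemma inner_leD d f g : inner_le d f -> inner_le d g -> inner_le d (f + g).
Proof.
move=> df dg m; rewrite coefD; apply: leq_trans (size_polyD _ _) _.
by rewrite geq_max df dg.
Qed.

Lemma inner_leM d d' f g : inner_le d f -> inner_le d' g -> inner_le (d + d') (f * g).
Proof.
move=> df dg m; rewrite coefM; apply: leq_trans (size_sum _ _ _) _.
apply/bigmax_leqP => i _; apply: leq_trans (size_polyMleq _ _) _.
by have := df i; have := dg (m - i)%N; move: (size _) (size _) => x y; lia.
Qed.

Lemma inner_leW d d' f : (d <= d')%N -> inner_le d f -> inner_le d' f.
Proof. by move=> dd df m; apply: leq_trans (df m) _. Qed.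

Lemma inner_leC (c : R) : inner_le 0 c%:P%:P.
Proof.
by move=> m; rewrite coefC; case: eqP => _; rewrite ?size_poly0 // size_polyC_leq1.
Qed.

Lemma inner_le_outerX : inner_le 0 'X.
Proof.
by move=> m; rewrite coefX; case: eqP => _; rewrite ?size_poly0 ?size_poly1.
Qed.

Lemma inner_le_innerX : inner_le 1 ('X)%:P.
Proof.
by move=> m; rewrite coefC; case: eqP => _; rewrite ?size_poly0 ?size_polyX.
Qed.

Lemma inner_le_prod (d : nat) (I : Type) (s : seq I) (F : I -> {poly {poly R}}) :
  (forall i, inner_le d (F i)) -> inner_le (d * size s) (\prod_(i <- s) F i).
Proof.
move=> dF; elim: s => [|i s IH]; last by rewrite big_cons mulnS; apply: inner_leM.
by rewrite big_nil muln0 -!polyC1; apply: inner_leC.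
Qed.

Lemma inner_le_sum (d : nat) (I : Type) (s : seq I) (F : I -> {poly {poly R}}) :
  (forall i, inner_le d (F i)) -> inner_le d (\sum_(i <- s) F i).
Proof.
move=> dF; elim: s => [|i s IH]; last by rewrite big_cons; apply: inner_leD.
by rewrite big_nil => m; rewrite coef0 size_poly0.
Qed.

Lemma ev2_coef (N I : nat) f x t : (size f <= N)%N -> (forall m, (size (f`_m)%R <= I)%N) ->
  ev2 f x t = \sum_(m < N) (\sum_(i < I) (f`_m)`_i * x ^+ i) * t ^+ m.
Proof.
move=> fN fI; rewrite /ev2 (horner_coef_wide _ fN) horner_sum.
apply: eq_bigr => m _; rewrite hornerM -polyC_exp hornerC.
by rewrite (horner_coef_wide _ (fI m)).
Qed.

Lemma exists_inner_bound f : exists I, forall m, (size (f`_m)%R <= I)%N.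
Proof.
exists (\max_(m < size f) size (f`_m)%R)%N => m.
have [ms|sm] := ltnP m (size f); last by rewrite nth_default // size_poly0.
exact: (leq_bigmax (Ordinal ms)).
Qed.

Lemma maj_sum_le f g (I : nat) (D : pred nat) (N : nat) (X t : R) :
  maj f g -> 0 <= X -> 0 <= t ->
  \sum_(m < N | D m) (\sum_(i < I) `|(f`_m)`_i| * X ^+ i) * t ^+ m <= ev2 g X t.
Proof.
move=> fg X0 t0; have [I' gI'] := exists_inner_bound g.
rewrite (@ev2_coef (maxn N (size g)) (maxn I I') g) ?leq_maxr //; last first.
  by move=> m; rewrite leq_max gI' orbT.
have ge0 m i : 0 <= (g`_m)`_i * X ^+ i by rewrite mulr_ge0 ?exprn_ge0 // (maj_ge0 _ _ fg).
rewrite -(big_mkord D (fun m => (\sum_(i < I) `|(f`_m)`_i| * X ^+ i) * t ^+ m)).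
rewrite -(big_mkord xpredT (fun m => (\sum_(i < maxn I I') (g`_m)`_i * X ^+ i) * t ^+ m)).
rewrite [X in _ <= X](big_cat_nat (n := N)) ?leq_maxl //= -[X in X <= _]addr0; apply: lerD; last first.
  by apply: sumr_ge0 => m _; rewrite mulr_ge0 ?exprn_ge0 // sumr_ge0.
rewrite big_mkcond /=; apply: ler_sum => m _.
case: (D m); last by rewrite mulr_ge0 ?exprn_ge0 // sumr_ge0.
apply: ler_wpM2r; first exact: exprn_ge0.
rewrite -(big_mkord xpredT (fun i => `|(f`_m)`_i| * X ^+ i)).
rewrite -(big_mkord xpredT (fun i => (g`_m)`_i * X ^+ i)).
rewrite [X in _ <= X](big_cat_nat (n := I)) ?leq_maxl //= -[X in X <= _]addr0; apply: lerD.
  by apply: ler_sum => i _; apply: ler_wpM2r; rewrite ?exprn_ge0.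
exact: sumr_ge0.
Qed.

(** Supplies the weighted row sums that [det_small] requires. *)
Lemma maj_head f g (I n : nat) (X T rho : R) :
  maj f g -> 0 <= X -> 0 <= T -> 0 <= rho ->
  \sum_(s : 'I_I * 'I_n) `|(f`_s.2)`_s.1| * (X ^+ s.1 * T ^+ s.2) * rho ^+ s.2
    <= ev2 g X (rho * T).
Proof.
move=> fg X0 T0 r0.
apply: le_trans (maj_sum_le I xpredT n fg X0 (mulr_ge0 r0 T0)).
rewrite -(pair_bigA _ (fun (i : 'I_I) (m : 'I_n) => `|(f`_m)`_i| * (X ^+ i * T ^+ m) * rho ^+ m)) /=.
rewrite exchange_big /=; apply: ler_sum => m _; rewrite mulr_suml; apply: ler_sum => i _.
by rewrite exprMn le_eqVlt; apply/orP; left; apply/eqP; ring.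
Qed.

(** Each omitted term has degree at least [n] in [t], so enlarging [T] to [rho T] multiplies its
    bound by at least [rho^n]. *)
Lemma maj_tail f g (I n : nat) (X T rho x t : R) :
  maj f g -> (forall m, (size (f`_m)%R <= I)%N) -> 0 <= X -> 1 <= rho ->
  `|x| <= X -> `|t| <= T ->
  `|ev2 f x t - \sum_(s : 'I_I * 'I_n) (f`_s.2)`_s.1 * (x ^+ s.1 * t ^+ s.2)| * rho ^+ n
    <= ev2 g X (rho * T).
Proof.
move=> fg fI X0 rho1 xX tT.
have T0 : 0 <= T by apply: le_trans tT.
have r0 : 0 <= rho by apply: le_trans rho1.
have /= := maj_sum_le I (fun m => ~~ (m < n)%N) (maxn n (size f)) fg X0 (mulr_ge0 r0 T0).
apply: le_trans.
rewrite (@ev2_coef (maxn n (size f)) I f) ?leq_maxr //.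
rewrite -(pair_bigA _ (fun (i : 'I_I) (m : 'I_n) => (f`_m)`_i * (x ^+ i * t ^+ m))) /= exchange_big /=.
have -> : \sum_(m < n) \sum_(i < I) (f`_m)`_i * (x ^+ i * t ^+ m) =
    \sum_(m < maxn n (size f) | (m < n)%N) (\sum_(i < I) (f`_m)`_i * x ^+ i) * t ^+ m.
  rewrite -(big_mkord xpredT (fun m => \sum_(i < I) (f`_m)`_i * (x ^+ i * t ^+ m))).
  rewrite -(big_mkord (fun m => (m < n)%N) (fun m => (\sum_(i < I) (f`_m)`_i * x ^+ i) * t ^+ m)).
  rewrite (big_nat_widen 0 n (maxn n (size f))) ?leq_maxl //=.
  by apply: eq_bigr => m _; rewrite mulr_suml; apply: eq_bigr => i _; rewrite mulrA.
rewrite (bigID (fun m : 'I_ _ => (m < n)%N)) /= addrAC subrr add0r.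
apply: (@le_trans _ _ (\sum_(m < maxn n (size f) | ~~ (m < n)%N)
    `|(\sum_(i < I) (f`_m)`_i * x ^+ i) * t ^+ m| * rho ^+ n)).
  by rewrite -mulr_suml; apply: ler_wpM2r; [exact: exprn_ge0 | exact: ler_norm_sum].
apply: ler_sum => m; rewrite -leqNgt => nm; rewrite normrM exprMn -mulrA; apply: ler_pM => //.
- by rewrite mulr_ge0 ?exprn_ge0.
- apply: le_trans (ler_norm_sum _ _ _) _; apply: ler_sum => i _.
  by rewrite normrM normrX ler_wpM2l // lerXn2r ?nnegrE.
rewrite [X in _ <= X]mulrC normrX; apply: ler_pM; rewrite ?exprn_ge0 //.
  by rewrite lerXn2r ?nnegrE.
exact: ler_weXn2l.
Qed.

End Majorants.

(* The real exponential and its Taylor polynomials *)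
Bind Scope ring_scope with R.
Arguments exp _%_ring_scope.
Arguments ln _%_ring_scope.
Arguments sqrt _%_ring_scope.

Lemma expD (x y : R) : exp (x + y) = exp x * exp y.
Proof. exact: exp_plus. Qed.
Lemma exp0 : exp 0 = 1. Proof. exact: exp_0. Qed.
Lemma exp_gt0 (x : R) : 0 < exp x.
Proof. by apply/RltP; apply: exp_pos. Qed.
Lemma exp_ge0 (x : R) : 0 <= exp x. Proof. exact: ltW (exp_gt0 x). Qed.
Lemma ltr_exp (x y : R) : (exp x < exp y) = (x < y).
Proof.
by apply/RltP/RltP; [exact: exp_lt_inv | exact: exp_increasing].
Qed.
Lemma ler_exp (x y : R) : (exp x <= exp y) = (x <= y).
Proof. by rewrite !leNgt ltr_exp. Qed.
Lemma exp_ge1D (x : R) : 1 + x <= exp x.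
Proof. by apply/RleP; apply: exp_ineq1_le. Qed.
Lemma exp_ln' (x : R) : 0 < x -> exp (ln x) = x.
Proof. by move=> /RltP x0; apply: exp_ln. Qed.
Lemma exp_mulrn (x : R) n : exp (x *+ n) = exp x ^+ n.
Proof. by elim: n => [|n IH]; rewrite ?mulr0n ?exp0 // mulrS expD IH exprS. Qed.
Lemma exp_natM (n : nat) (x : R) : exp (n%:R * x) = exp x ^+ n.
Proof. by rewrite mulr_natl exp_mulrn. Qed.
Lemma prod_exp (I : Type) (s : seq I) (P : pred I) (F : I -> R) :
  \prod_(i <- s | P i) exp (F i) = exp (\sum_(i <- s | P i) F i).
Proof. by rewrite (big_morph exp expD exp0). Qed.

Definition taylor (n : nat) (z : R) : R := \sum_(m < n) z ^+ m / (m`!)%:R.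

Lemma taylor_cvg (z e : R) : 0 < e ->
  exists n0, forall n, (n0 <= n)%N -> `|taylor n z - exp z| < e.
Proof.
move=> e0; have := svalP (exist_exp z); rewrite -/(exp z) => lim.
have [n0 n0P] := lim e (elimT RltP e0).
exists n0.+1 => -[|n] // nn0; apply/RltP.
have := n0P n (elimT ssrnat.leP (nn0 : (n0 <= n)%N)); rewrite /Rdist RabsE.
suff -> : sum_f_R0 (fun i => Rmult (Rinv (INR (Factorial.fact i))) (pow z i)) n = taylor n.+1 z by [].
rewrite sum_f_R0E /taylor big_mkord; apply: eq_bigr => i _.
by rewrite factE INRE RpowE RinvE RmultE mulrC.
Qed.

Lemma taylor_le_exp (n : nat) (z : R) : 0 <= z -> taylor n z <= exp z.
Proof.
move=> z0; rewrite leNgt; apply/negP => lt.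
have [n0 n0P] := taylor_cvg z (e := taylor n z - exp z) ltac:(by rewrite subr_gt0).
have := n0P (maxn n n0) (leq_maxr _ _).
have : taylor n z <= taylor (maxn n n0) z.
  rewrite /taylor -(big_mkord xpredT (fun m => z ^+ m / (m`!)%:R)).
  rewrite -[X in _ <= X](big_mkord xpredT (fun m => z ^+ m / (m`!)%:R)).
  rewrite [X in _ <= X](big_cat_nat (n := n)) ?leq_maxl //= lerDl.
  by apply: sumr_ge0 => i _; rewrite divr_ge0 ?exprn_ge0.
by move=> le; rewrite ltNge => /negP; apply; apply: le_trans (ler_norm _); rewrite lerB.
Qed.

(** In the tail [rho^n <= rho^i], so the remainder times [rho^n] is dominated by the series of
    [exp (rho |z|)]. A longer partial sum, within an arbitrary [e] of [exp z], stands for the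
    limit. *)
Lemma exp_taylor_rest (n : nat) (z rho : R) : 1 <= rho ->
  `|exp z - taylor n z| * rho ^+ n <= exp (rho * `|z|).
Proof.
move=> rho1; have rho0 : 0 < rho by apply: lt_le_trans rho1.
rewrite -ler_pdivlMr ?exprn_gt0 //; apply/ler_addgt0Pr => e e0.
have [n0 n0P] := taylor_cvg z e0; pose N := maxn n n0.
have := n0P N (leq_maxr _ _); rewrite distrC => lt.
have -> : exp z - taylor n z = (exp z - taylor N z) + (taylor N z - taylor n z) by ring.
apply: le_trans (ler_normD _ _) _; rewrite addrC; apply: lerD; last exact: ltW.
rewrite ler_pdivlMr ?exprn_gt0 //.
apply: le_trans (taylor_le_exp N _); last by rewrite mulr_ge0 // ltW.
rewrite /taylor -(big_mkord xpredT (fun m => z ^+ m / (m`!)%:R)).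
rewrite -(big_mkord xpredT (fun m => (rho * `|z|) ^+ m / (m`!)%:R)).
rewrite -(big_mkord xpredT (fun m => z ^+ m / (m`!)%:R)).
rewrite [X in `|X - _|](big_cat_nat (n := n)) ?leq_maxl //= addrAC subrr add0r.
rewrite [X in _ <= X](big_cat_nat (n := n)) ?leq_maxl //= -[X in X <= _]add0r.
apply: lerD.
  by apply: sumr_ge0 => i _; rewrite divr_ge0 ?exprn_ge0 // mulr_ge0 // ltW.
apply: (@le_trans _ _ (\sum_(n <= i < N) `|z ^+ i / (i`!)%:R| * rho ^+ n)).
  by rewrite -mulr_suml; apply: ler_wpM2r; [rewrite exprn_ge0 // ltW | exact: ler_norm_sum].
rewrite big_seq_cond [X in _ <= X]big_seq_cond; apply: ler_sum => i.
rewrite mem_index_iota andbT => /andP[ni _].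
rewrite normrM normfV normr_nat normrX exprMn mulrAC; apply: ler_wpM2r.
  by rewrite invr_ge0 ler0n.
by rewrite [X in _ <= X]mulrC; apply: ler_wpM2l; [exact: exprn_ge0 | exact: ler_weXn2l].
Qed.

Lemma exp_sub1_le (z : R) : `|z| <= 1 / 2%:R -> `|exp z - 1| <= 2%:R * `|z|.
Proof.
move=> z1; have e1 := exp_ge1D z; have e2 := exp_ge1D (- z).
have e0 := exp_gt0 z.
have e3 : exp z * (1 - z) <= 1.
  apply: (@le_trans _ _ (exp z * exp (- z))); first by rewrite ler_pM2l.
  by rewrite -expD subrr exp0.
rewrite ler_norml; have [z0|z0] := leP 0 z.
  by rewrite ger0_norm // in z1 *; apply/andP; split; nra.
by rewrite ltr0_norm // in z1 *; apply/andP; split; nra.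
Qed.

(** [e] is the contribution of the linear form. When it is below [rho^(-n)] up to a constant, it
    does no more harm than the truncation of the series. *)
Lemma exp_perturbed_taylor (n : nat) (z e rho T : R) : 1 <= rho -> rho * `|z| <= T ->
  2%:R * `|e| * rho ^+ n <= 1 ->
  `|exp z * exp e - taylor n z| * rho ^+ n <= 2%:R * exp T.
Proof.
move=> rho1 zT eL; have rn1 : 1 <= rho ^+ n by rewrite exprn_ege1.
have rn0 : 0 <= rho ^+ n by apply: le_trans rn1.
have e12 : `|e| <= 1 / 2%:R.
  have : 2%:R * `|e| <= 2%:R * `|e| * rho ^+ n by rewrite ler_peMr // mulr_ge0.
  by lra.
have e2 : `|exp e - 1| * rho ^+ n <= 1.
  by apply: le_trans eL; rewrite ler_wpM2r //; exact: exp_sub1_le.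
have e3 : `|exp z - taylor n z| * rho ^+ n <= exp T.
  by apply: le_trans (exp_taylor_rest n z rho1) _; rewrite ler_exp.
have e4 : exp z <= exp T.
  by rewrite ler_exp; apply: le_trans zT; apply: le_trans (ler_norm _) _; rewrite ler_peMl.
have -> : exp z * exp e - taylor n z = exp z * (exp e - 1) + (exp z - taylor n z) by ring.
have -> : 2%:R * exp T = exp T * 1 + exp T by ring.
apply: le_trans (_ : (`|exp z * (exp e - 1)| + `|exp z - taylor n z|) * rho ^+ n <= _).
  by apply: ler_wpM2r => //; exact: ler_normD.
rewrite mulrDl; apply: lerD => //.
rewrite normrM (ger0_norm (exp_ge0 z)) -mulrA; apply: ler_pM => //; first exact: exp_ge0.
exact: mulr_ge0.
Qed.

(** [det_principle] at points that the independence of the rows provides through a nonzero minor. *)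
Lemma interpolation_inequality (F : realFieldType) (x : F) (I n : nat) (Row : finType)
    (P : eqType) (p0 : P) (pts : seq P) (G : Row -> P -> {poly int})
    (A : Row -> 'I_I * 'I_n -> F) (B : 'I_I * 'I_n -> P -> F)
    (a : Row -> 'I_I * 'I_n -> F) (C C' : Row -> F) (rho : F) :
  x ^+ 2 = x + 1 -> #|Row| = (I * n)%N ->
  (forall c : Row -> F, (forall p, p \in pts -> \sum_r c r * ev x (G r p) = 0) ->
     forall r, c r = 0) ->
  1 <= rho ->
  (forall r s p, p \in pts -> `|A r s * B s p| <= a r s) ->
  (forall r, \sum_s a r s * rho ^+ s.2 <= C r) ->
  (forall r p, p \in pts ->
     `|ev x (G r p) - \sum_s A r s * B s p| * rho ^+ n <= C r) ->
  (forall r p, p \in pts -> `|ev (1 - x) (G r p)| <= C' r) ->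
  rho ^+ (I * 'C(n, 2)) <= (I * n)`!%:R ^+ 2 * \prod_r (2 * C r * C' r).
Proof.
move=> hx cR inj rho1 Aa aC EC C'G.
pose row (r : 'I_(I * n)) : Row := enum_val (cast_ord (esym cR) r).
pose num (r : Row) : 'I_(I * n) := cast_ord cR (enum_rank r).
have rowK : cancel num row by move=> r; rewrite /row /num cast_ordK enum_rankK.
have numK : cancel row num by move=> r; rewrite /row /num enum_valK cast_ordKV.
have bij : {on [pred r | true], bijective row} by exists num => r _.
have [c cP|h [hpts nz]] := @exists_nonzero_minor F P (I * n) pts p0
  (fun r p => ev x (G (row r) p)).
  move=> r; rewrite -[r]numK.
  apply: (inj (fun r => c (num r))) => p /(nthP p0) [i ip <-].
  by rewrite -[RHS](cP i ip) (reindex row) //=; apply: eq_bigr => j _; rewrite numK.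
have inP j : nth p0 pts (h j) \in pts by apply: mem_nth.
have := @det_principle F x I n (\matrix_(r, j) G (row r) (nth p0 pts (h j)))
  (fun r => A (row r)) (fun s j => B s (nth p0 pts (h j)))
  (fun r => a (row r)) (fun r => C (row r)) (fun r => C' (row r)) rho hx.
rewrite [X in _ -> _ -> _ -> _ -> _ -> _ -> _ <= X](_ : _ =
    (I * n)`!%:R ^+ 2 * \prod_r (2 * C r * C' r)); last first.
  by congr (_ * _); rewrite [RHS](reindex row).
apply=> //.
- by move: nz; congr (\det _ != 0); apply/matrixP => r j; rewrite !mxE.
- by move=> r s j; apply: Aa.
- by move=> r j; rewrite mxE; apply: EC.
- by move=> r j; rewrite mxE; apply: C'G.
Qed.

(** The left side, multiplied by [(i + j)!], is a single term of the binomial expansion of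
    [(s + t)^(i + j)]. *)
Lemma falling_majorant (F : realFieldType) (i j : nat) (s t : F) : 0 <= s -> 0 <= t ->
  s ^+ i / (i`!)%:R * (t ^+ j / (j`!)%:R) <= (s + t) ^+ (i + j) / ((i + j)`!)%:R.
Proof.
move=> s0 t0; have f0 n : (n`!%:R : F) != 0 by rewrite pnatr_eq0 -lt0n fact_gt0.
have f0' n : 0 < (n`!%:R : F) by rewrite ltr0n fact_gt0.
rewrite ler_pdivlMr //.
have -> : s ^+ i / (i`!)%:R * (t ^+ j / (j`!)%:R) * ((i + j)`!)%:R =
    ('C(i + j, i))%:R * (s ^+ i * t ^+ j) :> F.
  have := bin_fact (leq_addr j i); rewrite addKn => <-.
  by rewrite !natrM; field; rewrite !f0.
have ij : (i < (i + j).+1)%N by rewrite ltnS leq_addr.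
rewrite addrC exprDn (bigD1 (Ordinal ij)) //= addKn mulr_natl mulrC [t ^+ j * _]mulrC.
by rewrite lerDl sumr_ge0 // => r _; rewrite mulrn_wge0 // mulr_ge0 ?exprn_ge0.
Qed.

Lemma prod_shift_le (F : realFieldType) (i K : nat) (s : F) : 0 <= s -> (i <= K)%N ->
  \prod_(r < i) (s + r%:R) <= (s + K%:R) ^+ i.
Proof.
move=> s0 iK; apply: (@le_trans _ _ (\prod_(r < i) (s + K%:R))).
  apply: ler_prod => r _; rewrite addr_ge0 //= lerD2l ler_nat.
  by rewrite (leq_trans (ltnW (ltn_ord r))).
by rewrite prodr_const card_ord.
Qed.

(** [K^d / d!] is one term of the series of [exp K]; the remaining factor [exp sig] is the cost of
    one degree. *)
Lemma pow_div_fact_le (d : nat) (S K sig : R) : 0 <= S -> 0 <= K -> S <= K * exp sig ->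
  S ^+ d / (d`!)%:R <= exp (K + d%:R * sig).
Proof.
move=> S0 K0 SK; rewrite expD exp_natM.
apply: (@le_trans _ _ ((K ^+ d / (d`!)%:R) * exp sig ^+ d)).
  rewrite mulrAC -exprMn; apply: ler_wpM2r; first by rewrite invr_ge0 ler0n.
  by rewrite lerXn2r ?nnegrE ?mulr_ge0 ?exp_ge0.
apply: ler_wpM2r; first by rewrite exprn_ge0 // exp_ge0.
apply: le_trans (taylor_le_exp d.+1 K0).
rewrite /taylor big_ord_recr /= lerDr; apply: sumr_ge0 => i _.
by rewrite divr_ge0 ?exprn_ge0.
Qed.

Lemma natr_exp_ln (n : nat) : (0 < n)%N -> n%:R = exp (ln n%:R).
Proof. by move=> n0; rewrite exp_ln' // ltr0n. Qed.

Lemma fact_le_exp (M : nat) : (0 < M)%N -> (M`!%:R : R) <= exp (M%:R * ln M%:R).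
Proof.
move=> M0; rewrite exp_natM -natr_exp_ln // -natrX ler_nat.
suff H m : (m <= M)%N -> (m`! <= M ^ m)%N by apply: H.
elim: m => // m IH mM; rewrite factS expnS; apply: leq_mul => //.
by apply: IH; apply: ltnW.
Qed.

(** * Pairs of bounded total degree *)

Section TriangularRows.

Lemma big_sig_val (A : Type) (idx : A) (op : Monoid.com_law idx) (T : finType) (P : pred T) (F : T -> A) :
  \big[op/idx]_(x : {x | P x}) F (val x) = \big[op/idx]_(x | P x) F x.
Proof.
rewrite [RHS](reindex_omap (val : {x | P x} -> T) insub) => [|x Px]; last by rewrite insubT.
by apply: eq_bigl => x; rewrite (valP x) valK eqxx.
Qed.

Definition tri (K : nat) := {p : 'I_K * 'I_K | (p.1 + p.2 < K)%N}.

Lemma sum_tri (K : nat) (F : nat -> nat) :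
  (\sum_(p : 'I_K * 'I_K | p.1 + p.2 < K) F (p.1 + p.2) = \sum_(d < K) d.+1 * F d)%N.
Proof.
rewrite -(pair_big_dep xpredT (fun i j : 'I_K => (i + j < K)%N) (fun i j : 'I_K => F (i + j)%N)) /=.
have inner (i : 'I_K) : (\sum_(j < K | i + j < K) F (i + j) = \sum_(d < K | i <= d) F d)%N.
  rewrite -(big_mkord (fun j => (i + j < K)%N) (fun j => F (i + j)%N)).
  rewrite -(big_mkord (fun d => (i <= d)%N) F).
  have iK : (K - i <= K)%N by rewrite leq_subr.
  rewrite (eq_bigl (fun j => true && (j < K - i)%N)); last by move=> j; rewrite ltn_subRL.
  rewrite -(big_nat_widen 0 (K - i) K xpredT) //.
  rewrite (eq_bigr (fun j => F (j + i)%N)); last by move=> j _; rewrite addnC.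
  rewrite -(big_addn 0 K i xpredT F) add0n.
  rewrite [RHS](big_cat_nat (n := i)) //=; last exact: ltnW.
  have -> : (\sum_(0 <= d < i | i <= d) F d = 0)%N.
    by rewrite big_nat_cond big_pred0 // => d; lia.
  rewrite add0n [RHS]big_nat_cond [LHS]big_nat_cond; apply: eq_bigl => j.
  by case: (i <= j)%N; rewrite ?andbT.
rewrite (eq_bigr _ (fun i _ => inner i)) (exchange_big_dep xpredT) //=.
apply: eq_bigr => d _; rewrite sum_nat_const; congr (_ * _)%N.
rewrite -sum1_card -(big_mkord (fun i => (i <= d)%N) (fun=> 1%N)).
rewrite (eq_bigl (fun j => true && (j < d.+1)%N)) // -(big_nat_widen 0 d.+1 K xpredT) //.
by rewrite sum_nat_const_nat subn0 muln1.
Qed.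

Lemma card_tri (K : nat) : (#|{: tri K}| * 2 = K * K.+1)%N.
Proof.
have -> : #|{: tri K}| = (\sum_(d < K) d.+1 * 1)%N.
  rewrite -(sum_tri K (fun=> 1%N)) -(@big_sig_val _ _ _ _ _ (fun=> 1%N)).
  by rewrite sum1_card.
by elim: (K) => [|n IH]; rewrite ?big_ord0 // big_ord_recr /= mulnDl IH; lia.
Qed.

(** The mean total degree is [2 (K - 1) / 3], the source of the coefficient [4 / 3] of [sig] in
    [three_log_inequality]. *)
Lemma sum_tri_degree (K : nat) :
  (3 * \sum_(p : tri K) ((val p).1 + (val p).2) = K.-1 * (K * K.+1))%N.
Proof.
rewrite (@big_sig_val _ _ _ _ _ (fun p : 'I_K * 'I_K => p.1 + p.2)%N) (sum_tri K id).
case: K => [|K]; first by rewrite big_ord0.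
elim: K => [|n IH]; first by rewrite big_ord1.
by rewrite big_ord_recr /= mulnDr IH /=; nia.
Qed.

End TriangularRows.

Section Evaluation.

Variables (F : comNzRingType) (x : F).

Lemma evM p q : ev x (p * q) = ev x p * ev x q.
Proof. by rewrite /ev rmorphM hornerM. Qed.
Lemma evB p q : ev x (p - q) = ev x p - ev x q.
Proof. by rewrite /ev rmorphB hornerD hornerN. Qed.
Lemma evXn p n : ev x (p ^+ n) = ev x p ^+ n.
Proof. by rewrite /ev rmorphXn horner_exp. Qed.
Lemma ev_nat n : ev x n%:R = n%:R.
Proof. by rewrite /ev rmorph_nat -polyC_natr hornerC. Qed.
Lemma evX : ev x 'X = x.
Proof. by rewrite /ev map_polyX hornerX. Qed.

End Evaluation.

Section FallingMajorant.

Variable F : realFieldType.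
Implicit Types (f g : {poly {poly F}}).

(** The rising product, a majorant of [fallp] with all signs made positive. *)
Definition fallm (i : nat) f : {poly {poly F}} :=
  ((i`!%:R : F)^-1)%:P%:P * \prod_(s < i) (f + (s%:R)%:P%:P).

Lemma maj_fallp i f g : maj f g -> maj (fallp i f) (fallm i g).
Proof.
move=> fg; rewrite /fallp -mul_polyC; apply: majM.
  by apply: majC; rewrite ger0_norm // invr_ge0 ler0n.
apply: maj_prod => s; have -> : - (s%:R : {poly {poly F}}) = (- s%:R : F)%:P%:P.
  by rewrite !rmorphN /= !polyC_natr.
by apply: majD => //; apply: majC; rewrite normrN ger0_norm.
Qed.

Lemma ev2_fallm_le i K g x y : (i <= K)%N -> 0 <= ev2 g x y ->
  0 <= ev2 (fallm i g) x y <= (ev2 g x y + K%:R) ^+ i / (i`!)%:R.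
Proof.
move=> iK g0; rewrite /fallm ev2M ev2C ev2_prod.
have i0 : 0 <= (i`!%:R : F)^-1 by rewrite invr_ge0 ler0n.
rewrite (eq_bigr (fun s : 'I_i => ev2 g x y + s%:R)); last by move=> s _; rewrite ev2D ev2C.
rewrite mulr_ge0 //=; last by apply: prodr_ge0 => s _; rewrite addr_ge0.
by rewrite mulrC; apply: ler_wpM2r => //; apply: prod_shift_le.
Qed.

Lemma inner_le_fallp i f : inner_le 1 f -> inner_le i (fallp i f).
Proof.
move=> df; rewrite /fallp -mul_polyC -[X in inner_le X]add0n.
apply: inner_leM; first exact: inner_leC.
have := @inner_le_prod F 1 _ (index_enum 'I_i) (fun s : 'I_i => f - s%:R).
rewrite [X in size X]unlock -enumT size_enum_ord mul1n; apply=> s.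
apply: inner_leD => //; have -> : - (s%:R : {poly {poly F}}) = (- s%:R : F)%:P%:P.
  by rewrite !rmorphN /= !polyC_natr.
exact: inner_leW (inner_leC _).
Qed.

Lemma inner_le_fallp0 i f : inner_le 0 f -> inner_le 0 (fallp i f).
Proof.
move=> df; rewrite /fallp -mul_polyC -[X in inner_le X]add0n.
apply: inner_leM; first exact: inner_leC.
have := @inner_le_prod F 0 _ (index_enum 'I_i) (fun s : 'I_i => f - s%:R).
rewrite mul0n; apply=> s.
apply: inner_leD => //; have -> : - (s%:R : {poly {poly F}}) = (- s%:R : F)%:P%:P.
  by rewrite !rmorphN /= !polyC_natr.
exact: inner_leC.
Qed.

Definition taylorp (n b : nat) (c : F) : {poly {poly F}} :=
  \sum_(m < n) ((b%:R * c) ^+ m / (m`!)%:R)%:P%:P * 'X ^+ m.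

Lemma maj_taylorp n b c : maj (taylorp n b c) (taylorp n b `|c|).
Proof.
apply: maj_sum => m; apply: majM; last by apply: majX; exact: maj_outerX.
apply: majC; rewrite normrM normfV normr_nat normrX normrM normr_nat.
by [].
Qed.

Lemma inner_le_taylorp n b c : inner_le 0 (taylorp n b c).
Proof.
apply: inner_le_sum => m; rewrite -[X in inner_le X]add0n; apply: inner_leM.
  exact: inner_leC.
have := @inner_le_prod F 0 _ (index_enum 'I_m) (fun=> 'X) (fun=> @inner_le_outerX F).
by rewrite prodr_const card_ord mul0n.
Qed.

End FallingMajorant.

Lemma ev2_taylorp (n b : nat) (c x t : R) :
  ev2 (taylorp n b c) x t = taylor n (b%:R * c * t).
Proof.
rewrite /taylorp ev2_sum; apply: eq_bigr => m _.
by rewrite ev2M ev2C /ev2 horner_exp hornerX -polyC_exp hornerC [LHS]mulrAC -exprMn.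
Qed.

(** * Interpolation inequalities in three and in two logarithms *)

Definition gold : R := (1 + Num.sqrt 5%:R) / 2%:R.

Lemma gold_sqr : gold ^+ 2 = gold + 1.
Proof.
have s5 : Num.sqrt 5%:R ^+ 2 = 5%:R :> R by rewrite sqr_sqrtr.
rewrite /gold; apply/eqP; rewrite -subr_eq0; apply/eqP.
have -> : ((1 + Num.sqrt 5%:R) / 2%:R) ^+ 2 - ((1 + Num.sqrt 5%:R) / 2%:R + 1) =
  (Num.sqrt 5%:R ^+ 2 - 5%:R) / 4%:R :> R by field.
by rewrite s5 subrr mul0r.
Qed.

Lemma gold_gt1 : 1 < gold.
Proof.
have s0 : 0 <= Num.sqrt 5%:R :> R by rewrite sqrtr_ge0.
have := gold_sqr; have : 1 / 2%:R <= gold by rewrite /gold; lra.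
by move: gold => x x0 hx; nra.
Qed.

Lemma gold_lt2 : gold < 2%:R.
Proof. by have := gold_sqr; have := gold_gt1; move: gold => x x0 hx; nra. Qed.

(** The square root of 5, written as the value of [2 X - 1] at [gold]; at the conjugate [1 - gold]
    the same polynomial takes the opposite value. *)
Definition sq5 : R := 2%:R * gold - 1.

Lemma sq5_gt1 : 1 < sq5.
Proof. by rewrite /sq5; have := gold_gt1; lra. Qed.

Lemma sq5_gt0 : 0 < sq5. Proof. exact: lt_trans sq5_gt1. Qed.

Definition eta : R := ln gold.

Lemma exp_eta : exp eta = gold.
Proof. by rewrite exp_ln' // (lt_trans ltr01 gold_gt1). Qed.

Lemma eta_gt0 : 0 < eta.
Proof. by rewrite -ltr_exp exp0 exp_eta gold_gt1. Qed.

(** Logarithmic form of [interpolation_inequality]. A row has polynomial degree [d r], at cost [sig]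
    per degree, and exponent [e r] of [Y], at cost [del] at [gold] and [del'] at the conjugate. *)
Lemma exponential_interpolation (I n : nat) (Row : finType) (P : eqType) (p0 : P) (pts : seq P)
    (G : Row -> P -> {poly int}) (f g : Row -> {poly {poly R}}) (px pt : P -> R)
    (d e : Row -> nat) (X T rho kap sig del del' : R) :
  #|Row| = (I * n)%N -> (0 < I * n)%N ->
  (forall c : Row -> R, (forall s, s \in pts -> \sum_r c r * ev gold (G r s) = 0) ->
     forall r, c r = 0) ->
  1 <= rho -> 0 <= X -> 0 <= T ->
  (forall r, maj (f r) (g r)) -> (forall r m, (size ((f r)`_m)%R <= I)%N) ->
  (forall s, s \in pts -> `|px s| <= X /\ `|pt s| <= T) ->
  (forall r, ev2 (g r) X (rho * T) <= exp (kap + (d r)%:R * sig) * exp ((e r)%:R * del)) ->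
  (forall r s, s \in pts -> `|ev gold (G r s) - ev2 (f r) (px s) (pt s)| * rho ^+ n <=
     2%:R * (exp (kap + (d r)%:R * sig) * exp ((e r)%:R * del))) ->
  (forall r s, s \in pts -> `|ev (1 - gold) (G r s)| <=
     exp (kap + (d r)%:R * sig) * exp ((e r)%:R * del')) ->
  (I * n)%:R * ((n.-1)%:R / 2%:R * ln rho) <= (I * n)%:R * (2%:R * ln (I * n)%:R) +
    ((I * n)%:R * (ln 6%:R + 2%:R * kap) + 2%:R * sig * (\sum_r (d r)%:R) +
     (del + del') * (\sum_r (e r)%:R)).
Proof.
move=> cR M0 inj rho1 X0 T0 fg fI ptP gC close conj.
pose E r := exp (kap + (d r)%:R * sig) * exp ((e r)%:R * del).
have E0 r : 0 <= E r by rewrite mulr_ge0 ?exp_ge0.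
have rho0 : 0 <= rho by apply: le_trans rho1.
pose C' r := exp (kap + (d r)%:R * sig) * exp ((e r)%:R * del').
(* In [3 E r] one [E r] is for the tail of [f r] and two are for the distance of the true value from
   [f r]. With the factor 2 of [det_principle] this becomes [ln 6]. *)
have := @interpolation_inequality R gold I n Row _ p0 pts G
  (fun r m => ((f r)`_m.2)`_m.1) (fun m s => px s ^+ m.1 * pt s ^+ m.2)
  (fun r m => `|((f r)`_m.2)`_m.1| * (X ^+ m.1 * T ^+ m.2)) (fun r => 3%:R * E r) C' rho
  gold_sqr cR inj rho1.
have inst1 r (m : 'I_I * 'I_n) s : s \in pts ->
    `|((f r)`_m.2)`_m.1 * (px s ^+ m.1 * pt s ^+ m.2)| <=
    `|((f r)`_m.2)`_m.1| * (X ^+ m.1 * T ^+ m.2).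
  move=> /ptP [xX tT]; rewrite normrM ler_wpM2l // normrM !normrX.
  by apply: ler_pM; rewrite ?exprn_ge0 // lerXn2r ?nnegrE.
have inst2 r : \sum_(m : 'I_I * 'I_n) `|((f r)`_m.2)`_m.1| * (X ^+ m.1 * T ^+ m.2) * rho ^+ m.2 <= 3%:R * E r.
  apply: le_trans (maj_head I n (fg r) X0 T0 rho0) _.
  by apply: le_trans (gC r) _; rewrite -/(E r); have := E0 r; lra.
have inst3 r s : s \in pts -> `|ev gold (G r s) -
    \sum_(m : 'I_I * 'I_n) ((f r)`_m.2)`_m.1 * (px s ^+ m.1 * pt s ^+ m.2)| * rho ^+ n <= 3%:R * E r.
  move=> sB; have [xX tT] := ptP s sB.
  have t1 := maj_tail n (fg r) (fI r) X0 rho1 xX tT.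
  have t2 := close r s sB; have t3 := gC r; rewrite -/(E r) in t2 t3.
  set a := ev gold _ in t2 *; set b := ev2 (f r) _ _ in t1 t2 *; set c := \sum_m _ in t1 *.
  have -> : a - c = (a - b) + (b - c) by ring.
  apply: le_trans (_ : (`|a - b| + `|b - c|) * rho ^+ n <= _).
    by rewrite ler_wpM2r ?exprn_ge0 // ler_normD.
  by rewrite mulrDl; move: (le_trans t1 t3) t2; move: (_ * _ ^+ _) (_ * _ ^+ _) => y z; lra.
move=> /(_ inst1 inst2 inst3 conj).
have -> : rho ^+ (I * 'C(n, 2)) = exp ((I * 'C(n, 2))%:R * ln rho).
  by rewrite exp_natM exp_ln' // (lt_le_trans ltr01).
have -> : \prod_r (2%:R * (3%:R * E r) * C' r) = exp ((I * n)%:R * (ln 6%:R + 2%:R * kap) +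
    2%:R * sig * (\sum_r (d r)%:R) + (del + del') * (\sum_r (e r)%:R)).
  have e6 : (6%:R : R) = exp (ln 6%:R) by rewrite -natr_exp_ln.
  rewrite (eq_bigr (fun r => exp (ln 6%:R + 2%:R * kap + 2%:R * sig * (d r)%:R +
     (del + del') * (e r)%:R))); last first.
    move=> r _; rewrite /E /C'.
    pose a := kap + (d r)%:R * sig; pose b := (e r)%:R * del; pose b' := (e r)%:R * del'.
    have -> : ln 6%:R + 2%:R * kap + 2%:R * sig * (d r)%:R + (del + del') * (e r)%:R =
      ln 6%:R + ((a + b) + (a + b')) by rewrite /a /b /b'; ring.
    rewrite (expD (ln _)) -e6 (expD (a + b)) (expD a b) (expD a b').
    by move: (exp a) (exp b) (exp b') => x y z; ring.
  rewrite prod_exp; congr exp; rewrite big_split big_split /= -!mulr_sumr.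
  by rewrite sumr_const cR -[_ *+ _]mulr_natl.
have fM : ((I * n)`!%:R : R) ^+ 2 <= exp ((I * n)%:R * (2%:R * ln (I * n)%:R)).
  by rewrite mulrCA exp_natM lerXn2r ?nnegrE ?exp_ge0 // fact_le_exp.
move=> le; have {}le := le_trans le (ler_wpM2r (exp_ge0 _) fM).
rewrite -expD ler_exp in le; apply: le_trans le.
have -> : (I * 'C(n, 2))%:R = (I * n)%:R * (n.-1)%:R / 2%:R :> R.
  have e2 : ('C(n, 2) * 2 = n * n.-1)%N.
    by rewrite bin2 muln2 even_halfK // oddM; case: (n) => //= m; rewrite andNb.
  by rewrite -natrM -mulnA -e2 mulnA [in RHS]natrM mulfK // pnatr_eq0.
by rewrite !mulrA.
Qed.

Lemma sum_ord_nat (m : nat) : \sum_(i < m) (i : nat)%:R = m%:R * (m.-1)%:R / 2%:R :> R.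
Proof.
rewrite -natr_sum -(big_mkord xpredT (fun i => i)) bin2_sum.
have e : ('C(m, 2) * 2 = m * m.-1)%N.
  by rewrite bin2 muln2 even_halfK // oddM; case: (m) => //= k; rewrite andNb.
by rewrite -natrM -e natrM mulfK // pnatr_eq0.
Qed.

Lemma binomial_le (x i : nat) : ('C(x, i))%:R <= x%:R ^+ i / (i`!)%:R :> R.
Proof.
rewrite ler_pdivlMr ?ltr0n ?fact_gt0 // -natrM -natrX ler_nat bin_ffact.
elim: i => [|i IH]; first by rewrite ffactn0.
by rewrite ffactnSr expnSr leq_mul // leq_subr.
Qed.

Section ClearedPowers.

Variables (g p q W x y w : nat).

(* A cleared form of [phi^x g^y (sqrt 5 p / q)^w], [phi] the golden ratio. *)
Definition ypol : {poly int} :=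
  'X ^+ x * (g ^ y)%:R * (p%:R * (2%:R * 'X - 1)) ^+ w * (q ^ (W - w))%:R.

Lemma ev_ypol (z : R) : ev z ypol =
  z ^+ x * g%:R ^+ y * (p%:R * (2%:R * z - 1)) ^+ w * q%:R ^+ (W - w).
Proof. by rewrite /ypol !evM !evXn !evM evB !evM evX -[1]/(1%:R) !ev_nat !natrX. Qed.

Hypotheses (g0 : (1 < g)%N) (p0 : (0 < p)%N) (q0 : (0 < q)%N) (wW : (w <= W)%N).

Lemma ev_ypol_gold : ev gold ypol = exp (x%:R * eta + y%:R * ln g%:R +
  w%:R * ln (sq5 * p%:R / q%:R) + W%:R * ln q%:R).
Proof.
rewrite ev_ypol -/sq5.
have gq : 0 < sq5 * p%:R / q%:R by rewrite divr_gt0 ?ltr0n // mulr_gt0 ?ltr0n // sq5_gt0.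
have e1 : gold ^+ x = exp (x%:R * eta) by rewrite exp_natM exp_eta.
have e2 : g%:R ^+ y = exp (y%:R * ln g%:R) :> R by rewrite exp_natM -natr_exp_ln // ltnW.
have e3 : (p%:R * sq5) ^+ w = exp (w%:R * (ln (sq5 * p%:R / q%:R) + ln q%:R)).
  rewrite exp_natM expD exp_ln' // -natr_exp_ln // divfK 1?mulrC //.
  by rewrite pnatr_eq0 -lt0n.
have e4 : q%:R ^+ (W - w) = exp ((W - w)%:R * ln q%:R) :> R.
  by rewrite exp_natM -natr_exp_ln.
by rewrite e1 e2 e3 e4 -!expD natrB //; congr exp; ring.
Qed.

(** The conjugate of [gold] has absolute value at most 1, so powers of phi cost nothing here. The
    [w] factors from [p] and the [W - w] factors from [q] share the bound [exp bet]. *)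
Lemma ev_ypol_conj (Y : nat) (bet : R) : (y <= Y)%N -> sq5 * p%:R <= exp bet ->
  q%:R <= exp bet -> `|ev (1 - gold) ypol| <= exp (Y%:R * ln g%:R + W%:R * bet).
Proof.
move=> yY hbp hbq; rewrite ev_ypol !normrM !normrX !normr_nat.
have g1 : `|1 - gold| <= 1.
  by have := gold_gt1; have := gold_lt2; rewrite ler_norml => *; apply/andP; split; lra.
have s0 : 0 <= sq5 * p%:R by rewrite mulr_ge0 // ltW // sq5_gt0.
have -> : `|p%:R * (2%:R * (1 - gold) - 1)| = sq5 * p%:R.
  have -> : 2%:R * (1 - gold) - 1 = - sq5 by rewrite /sq5; ring.
  by rewrite mulrN normrN mulrC ger0_norm.
have gl : 1 <= g%:R :> R by rewrite ler1n ltnW.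
have b1 : `|1 - gold| ^+ x <= 1 by apply: exprn_ile1.
have b2 : g%:R ^+ y <= g%:R ^+ Y :> R by rewrite ler_weXn2l.
have b3 : (sq5 * p%:R) ^+ w <= exp bet ^+ w by rewrite lerXn2r ?nnegrE ?exp_ge0.
have b4 : q%:R ^+ (W - w) <= exp bet ^+ (W - w) by rewrite lerXn2r ?nnegrE ?exp_ge0 ?ler0n.
have -> : exp (Y%:R * ln g%:R + W%:R * bet) = 1 * g%:R ^+ Y * exp bet ^+ w * exp bet ^+ (W - w).
  by rewrite mul1r -mulrA -exprD subnKC // expD !exp_natM -natr_exp_ln // ltnW.
by apply: (ler_pM _ _ (ler_pM _ _ (ler_pM _ _ b1 b2) b3) b4);
  rewrite ?mulr_ge0 ?exprn_ge0 ?ler0n.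
Qed.

End ClearedPowers.

(** [t] is the ideal exponent, [e] the error due to the linear form and [del] the logarithm of the
    clearing factor, which is kept exactly while [exp (b t)] is truncated. *)
Lemma row_close (n b : nat) (c C t e rho T del : R) : 0 <= c <= C -> 1 <= rho -> `|t| <= T ->
  2%:R * (b%:R * `|e|) * rho ^+ n <= 1 ->
  `|c * exp (t - e + del) ^+ b - c * (exp (b%:R * del) * taylor n (b%:R * t))| * rho ^+ n <=
    2%:R * (C * exp (b%:R * (del + rho * T))).
Proof.
move=> /andP[c0 cC] rho1 tT eL; have rho0 : 0 <= rho := le_trans ler01 rho1.
have zT : rho * `|b%:R * t| <= b%:R * (rho * T).
  by rewrite normrM normr_nat mulrCA; apply: ler_wpM2l => //; apply: ler_wpM2l.
have eL' : 2%:R * `|- (b%:R * e)| * rho ^+ n <= 1 by rewrite normrN normrM normr_nat.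
have est := exp_perturbed_taylor rho1 zT eL'.
have -> : exp (t - e + del) ^+ b = exp (b%:R * del) * (exp (b%:R * t) * exp (- (b%:R * e))).
  by rewrite -!expD -exp_natM; congr exp; ring.
have -> : b%:R * (del + rho * T) = b%:R * del + b%:R * (rho * T) by ring.
rewrite expD; move: (exp_ge0 (b%:R * del)) est.
move: (exp (b%:R * del)) (exp (b%:R * t)) (exp (- _)) (taylor _ _) (exp (_ * (_ * T))).
move=> D z z' tl E D0 est.
have -> : c * (D * (z * z')) - c * (D * tl) = c * D * (z * z' - tl) by ring.
have -> : 2%:R * (C * (D * E)) = C * D * (2%:R * E) by ring.
rewrite normrM (ger0_norm (mulr_ge0 c0 D0)) -[X in X <= _]mulrA; apply: ler_pM => //.
- exact: mulr_ge0.
- by rewrite mulr_ge0 // exprn_ge0.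
- exact: ler_wpM2r.
Qed.

Lemma row_conj (b : nat) (c C y del : R) : 0 <= c <= C -> `|y| <= exp del ->
  `|c * y ^+ b| <= C * exp (b%:R * del).
Proof.
move=> /andP[c0 cC] yd; rewrite normrM (ger0_norm c0) normrX exp_natM; apply: ler_pM => //.
  exact: exprn_ge0.
by rewrite lerXn2r ?nnegrE ?exp_ge0.
Qed.

Section ThreeLogs.

Variables (g k N p q K h U V W : nat) (X T sig bet rho : R).

Let lam := ln g%:R.
Let gam := sq5 * p%:R / q%:R.
Let Lam := k%:R * eta - N%:R * lam - ln gam.
(** An even [L] makes the [K (K + 1) / 2 * L] rows exactly [K n], as the interpolation with [K]
    monomials for each power of [t] demands. *)
Let L := h.*2.
Let n := (K.+1 * h)%N.

Definition nx (s : nat * nat * nat) := (s.1.1 + k * s.2)%N.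
Definition ny (s : nat * nat * nat) := (s.1.2 + N * s.2)%N.
Let th s : R := (nx s)%:R * eta - (ny s)%:R * lam.

Definition ypol3 (s : nat * nat * nat) := ypol g p q W s.1.1 (V - s.1.2) s.2.
Definition rowpol (r : tri K * 'I_L) (s : nat * nat * nat) : {poly int} :=
  ('C(nx s, (val r.1).1) * 'C(ny s, (val r.1).2))%:R * ypol3 s ^+ r.2.

Lemma ev_rowpol (x : R) r s : ev x (rowpol r s) =
  ('C(nx s, (val r.1).1))%:R * ('C(ny s, (val r.1).2))%:R * ev x (ypol3 s) ^+ r.2.
Proof. by rewrite /rowpol evM ev_nat natrM evXn. Qed.

Hypotheses (g0 : (1 < g)%N) (p0 : (0 < p)%N) (q0 : (0 < q)%N) (K0 : (0 < K)%N) (h0 : (0 < h)%N).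

Lemma lam_gt0 : 0 < lam.
Proof. by rewrite /lam -ltr_exp exp0 -natr_exp_ln ?ltr1n // ltnW. Qed.

Hypotheses (rho1 : 1 <= rho)
  (hX : (U + k * W)%:R <= X) (hT : U%:R * eta + V%:R * lam + W%:R * (`|ln gam| + `|Lam|) <= T)
  (hS : X + K%:R + ((eta * X + rho * T) / lam + K%:R) <= K%:R * exp sig)
  (hbp : sq5 * p%:R <= exp bet) (hbq : q%:R <= exp bet)
  (hLam : 2%:R * (L%:R * W%:R * `|Lam|) * rho ^+ n <= 1).

Let del0 := V%:R * lam + W%:R * ln q%:R.
Let del1 := V%:R * lam + W%:R * bet.

Lemma nx_le s : s \in box U V W -> (nx s)%:R <= X.
Proof.
case: s => [[u v] w]; rewrite mem_box => /and3P[iu iv iw].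
apply: le_trans hX; rewrite ler_nat /nx /= leq_add ?(ltnW iu) //.
by rewrite leq_mul2l ltnW ?orbT.
Qed.

Lemma th_le s : s \in box U V W -> `|th s| <= T.
Proof.
case: s => [[u v] w]; rewrite mem_box => /and3P[iu iv iw]; apply: le_trans hT.
have -> : th (u, v, w) = u%:R * eta - v%:R * lam + w%:R * (ln gam + Lam).
  by rewrite /th /nx /ny /Lam !natrD !natrM /=; ring.
apply: le_trans (ler_normD _ _) _; apply: lerD.
  apply: le_trans (ler_normB _ _) _; rewrite !normrM !normr_nat.
  rewrite (ger0_norm (ltW eta_gt0)) (ger0_norm (ltW lam_gt0)).
  by apply: lerD; apply: ler_wpM2r; rewrite ?ltW ?eta_gt0 ?lam_gt0 // ltr_nat.
rewrite normrM normr_nat; apply: ler_pM => //; last exact: ler_normD.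
by rewrite ler_nat ltnW.
Qed.

Lemma X_ge0 : 0 <= X. Proof. by apply: le_trans hX; rewrite ler0n. Qed.
Lemma T_ge0 : 0 <= T.
Proof.
apply: le_trans hT; rewrite !addr_ge0 // mulr_ge0 ?addr_ge0 //.
  exact: ltW eta_gt0.
exact: ltW lam_gt0.
Qed.

Let fx : {poly {poly R}} := ('X)%:P.
(** [y] recovered from [x] and [t = x eta - y lam]. The binomials in [x] and [y] become polynomials
    in [x] and [t] whose degree in [x] is still below [K]. *)
Let fy : {poly {poly R}} := (eta / lam)%:P%:P * ('X)%:P + (- lam^-1)%:P%:P * 'X.
Let gy : {poly {poly R}} := (eta / lam)%:P%:P * ('X)%:P + (lam^-1)%:P%:P * 'X.

Lemma maj_fy : maj fy gy.
Proof.
apply: majD; apply: majM.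
- by apply: majC; rewrite ger0_norm // divr_ge0 // ltW // ?eta_gt0 ?lam_gt0.
- exact: maj_innerX.
- by apply: majC; rewrite normrN ger0_norm // invr_ge0 ltW // lam_gt0.
- exact: maj_outerX.
Qed.

Lemma ev_fx (x t : R) : ev2 fx x t = x.
Proof. by rewrite /fx /ev2 hornerC hornerX. Qed.
Lemma ev_fy (x t : R) : ev2 fy x t = (eta * x - t) / lam.
Proof. by rewrite /fy ev2D !ev2M !ev2C /ev2 hornerC !hornerX hornerC; ring. Qed.
Lemma ev_gy (x t : R) : ev2 gy x t = (eta * x + t) / lam.
Proof. by rewrite /gy ev2D !ev2M !ev2C /ev2 hornerC !hornerX hornerC; ring. Qed.

Lemma ev_fy_th s : ev2 fy (nx s)%:R (th s) = (ny s)%:R.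
Proof. by rewrite ev_fy /th; have := lam_gt0 => l0; field; rewrite gt_eqF. Qed.

Let deg (r : tri K * 'I_L) := ((val r.1).1 + (val r.1).2)%N.
Let cst (r : tri K * 'I_L) := exp (K%:R + (deg r)%:R * sig).
Let frow (r : tri K * 'I_L) := fallp (val r.1).1 fx * fallp (val r.1).2 fy *
   ((exp (r.2%:R * del0))%:P%:P * taylorp n r.2 1).
Let grow (r : tri K * 'I_L) := fallm (val r.1).1 fx * fallm (val r.1).2 gy *
   ((exp (r.2%:R * del0))%:P%:P * taylorp n r.2 1).

Lemma maj_row r : maj (frow r) (grow r).
Proof.
apply: majM; last apply: majM.
- apply: majM; apply: maj_fallp; first exact: maj_innerX.
  exact: maj_fy.
- by apply: majC; rewrite ger0_norm // exp_ge0.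
- by have := @maj_taylorp R n r.2 1; rewrite normr1.
Qed.

Lemma inner_row r m : (size ((frow r)`_m)%R <= K)%N.
Proof.
have ij := valP r.1; apply: leq_trans ij.
have : inner_le ((val r.1).1 + (val r.1).2 + (0 + 0)) (frow r).
  apply: inner_leM; first apply: inner_leM.
  - by apply: inner_le_fallp; exact: inner_le_innerX.
  - apply: inner_le_fallp; apply: inner_leD.
      rewrite -[X in inner_le X]add0n; apply: inner_leM; first exact: inner_leC.
      exact: inner_le_innerX.
    rewrite -[X in inner_le X]addn0; apply: (@inner_leW _ (0 + 0)) => //.
    by apply: inner_leM; [exact: inner_leC | exact: inner_le_outerX].
  - by apply: inner_leM; [exact: inner_leC | exact: inner_le_taylorp].
by rewrite !addn0 => /(_ m).
Qed.

Lemma poly_part_le (r : tri K * 'I_L) (x y : R) :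
  0 <= x <= X + K%:R -> 0 <= y <= (eta * X + rho * T) / lam + K%:R ->
  x ^+ (val r.1).1 / ((val r.1).1`!)%:R * (y ^+ (val r.1).2 / ((val r.1).2`!)%:R) <= cst r.
Proof.
move=> /andP[x0 xX] /andP[y0 yY].
apply: le_trans (falling_majorant _ _ x0 y0) _; apply: pow_div_fact_le.
- exact: addr_ge0.
- exact: ler0n.
by apply: le_trans hS; apply: lerD.
Qed.

Lemma grow_le r : ev2 (grow r) X (rho * T) <= cst r * exp (r.2%:R * (del0 + rho * T)).
Proof.
have rT : 0 <= rho * T by rewrite mulr_ge0 ?T_ge0 // (le_trans ler01).
have ij := valP r.1.
have iK : ((val r.1).1 <= K)%N by apply: ltnW; apply: leq_ltn_trans ij; apply: leq_addr.
have jK : ((val r.1).2 <= K)%N by apply: ltnW; apply: leq_ltn_trans ij; apply: leq_addl.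
have fx0 : 0 <= ev2 fx X (rho * T) by rewrite ev_fx X_ge0.
have gy0 : 0 <= ev2 gy X (rho * T).
  rewrite ev_gy divr_ge0 ?(ltW lam_gt0) // addr_ge0 // mulr_ge0 ?X_ge0 //.
  exact: ltW eta_gt0.
have /andP[a0 a1] := ev2_fallm_le iK fx0; have /andP[b0 b1] := ev2_fallm_le jK gy0.
have ab : ev2 (fallm (val r.1).1 fx) X (rho * T) * ev2 (fallm (val r.1).2 gy) X (rho * T)
    <= cst r.
  apply: le_trans (ler_pM a0 b0 a1 b1) _; rewrite ev_fx ev_gy; rewrite ev_fx in fx0.
  by rewrite ev_gy in gy0; apply: poly_part_le; rewrite lexx andbT addr_ge0.
move: ab a0 b0; rewrite /grow; move: (fallm _ fx) (fallm _ gy) => A B ab a0 b0.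
rewrite !ev2M ev2C ev2_taylorp mulr1; apply: ler_pM => //; first exact: mulr_ge0.
  rewrite mulr_ge0 ?exp_ge0 // sumr_ge0 // => i _.
  by rewrite divr_ge0 // exprn_ge0 // mulr_ge0.
have -> : r.2%:R * (del0 + rho * T) = r.2%:R * del0 + r.2%:R * (rho * T) :> R.
  by rewrite mulrDr.
rewrite (expD (r.2%:R * del0)); apply: ler_wpM2l; first exact: exp_ge0.
by apply: taylor_le_exp; rewrite mulr_ge0.
Qed.

Lemma binomials_le (r : tri K * 'I_L) s : s \in box U V W ->
  ('C(nx s, (val r.1).1))%:R * ('C(ny s, (val r.1).2))%:R <= cst r.
Proof.
move=> sB.
apply: le_trans (ler_pM _ _ (binomial_le _ _) (binomial_le _ _)) _; rewrite ?ler0n //.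
have nxX := nx_le sB; have thT := th_le sB.
apply: poly_part_le; rewrite ler0n /=; first by rewrite (le_trans nxX) // lerDl ler0n.
apply: le_trans (_ : (eta * X + rho * T) / lam <= _); last by rewrite lerDl ler0n.
rewrite -(ev_fy_th s) ev_fy; apply: ler_wpM2r; first by rewrite invr_ge0 ltW // lam_gt0.
apply: lerD; first by rewrite ler_wpM2l // ltW // eta_gt0.
rewrite -normrN in thT; apply: le_trans (ler_norm _) _; apply: le_trans thT _.
by rewrite ler_peMl // T_ge0.
Qed.

Lemma box_le s : s \in box U V W -> (s.1.2 <= V)%N /\ (s.2 <= W)%N.
Proof. by case: s => [[u v] w]; rewrite mem_box => /and3P[_ /ltnW + /ltnW]. Qed.

Lemma ev_row_close (r : tri K * 'I_L) s : s \in box U V W ->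
  `|ev gold (rowpol r s) - ev2 (frow r) (nx s)%:R (th s)| * rho ^+ n
    <= 2%:R * (cst r * exp (r.2%:R * (del0 + rho * T))).
Proof.
move=> sB; have [vV wW] := box_le sB.
have -> : ev2 (frow r) (nx s)%:R (th s) = ('C(nx s, (val r.1).1))%:R *
    ('C(ny s, (val r.1).2))%:R * (exp (r.2%:R * del0) * taylor n (r.2%:R * th s)).
  have ex := ev2_fallp (val r.1).1 (ev_fx (nx s)%:R (th s)).
  have ey := ev2_fallp (val r.1).2 (ev_fy_th s).
  move: ex ey; rewrite /frow; move: (fallp _ fx) (fallp _ fy) => A B ex ey.
  by rewrite !ev2M ex ey ev2C ev2_taylorp mulr1.
have -> : ev gold (rowpol r s) = ('C(nx s, (val r.1).1))%:R * ('C(ny s, (val r.1).2))%:R *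
    exp (th s - s.2%:R * Lam + del0) ^+ r.2.
  rewrite ev_rowpol /ypol3 ev_ypol_gold //; congr (_ * exp _ ^+ _).
  by rewrite /th /Lam /gam /nx /ny /del0 /lam natrB // !natrD !natrM; ring.
apply: row_close => //; first by rewrite mulr_ge0 ?ler0n // (binomials_le r sB).
  exact: th_le.
apply: le_trans hLam; rewrite ler_wpM2r ?exprn_ge0 ?(le_trans ler01) // ler_wpM2l //.
by rewrite normrM normr_nat mulrA ler_wpM2r // ler_pM // ler_nat // ltnW.
Qed.

Lemma ev_row_conj (r : tri K * 'I_L) s : s \in box U V W ->
  `|ev (1 - gold) (rowpol r s)| <= cst r * exp (r.2%:R * del1).
Proof.
move=> sB; have [vV wW] := box_le sB; rewrite ev_rowpol; apply: row_conj.
  by rewrite mulr_ge0 ?ler0n // (binomials_le r sB).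
by apply: ev_ypol_conj => //; rewrite leq_subr.
Qed.

Lemma sum_rows (F : tri K * 'I_L -> R) :
  \sum_r F r = \sum_(p : tri K) \sum_(b < L) F (p, b).
Proof. by rewrite pair_bigA; apply: eq_bigr => -[]. Qed.

Lemma card_rows : #|{: tri K * 'I_L}| = (K * n)%N.
Proof.
rewrite card_prod card_ord /L /n -mul2n mulnA (card_tri K) mulnA.
by [].
Qed.

Lemma sum_rows_deg : 3%:R * (\sum_r (deg r)%:R) = 2%:R * (K * n)%:R * (K.-1)%:R :> R.
Proof.
rewrite (sum_rows (fun r => (deg r)%:R)) /deg /=.
rewrite (eq_bigr (fun x : tri K => ((val x).1 + (val x).2)%:R * L%:R)); last first.
  by move=> x _; rewrite sumr_const card_ord mulr_natr.
rewrite -mulr_suml -natr_sum mulrA -natrM sum_tri_degree -!natrM.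
by congr (_%:R); rewrite /L /n -mul2n; ring.
Qed.

Lemma sum_rows_exponent :
  \sum_(r : tri K * 'I_L) (r.2 : nat)%:R = (K * n)%:R * (L.-1)%:R / 2%:R :> R.
Proof.
rewrite (sum_rows (fun r => (r.2 : nat)%:R)) /= sumr_const sum_ord_nat -card_rows.
by rewrite card_prod card_ord natrM -[_ *+ #|_|]mulr_natl !mulrA.
Qed.

Lemma three_log_inequality :
  (forall c : tri K * 'I_L -> R,
     (forall s, s \in box U V W -> \sum_r c r * ev gold (rowpol r s) = 0) ->
     forall r, c r = 0) ->
  (n.-1)%:R / 2%:R * ln rho <= 2%:R * ln (K * n)%:R + ln 6%:R + 2%:R * K%:R +
    4%:R / 3%:R * (K.-1)%:R * sig + (L.-1)%:R / 2%:R * (del0 + del1 + rho * T).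
Proof.
move=> inj.
have M0 : (0 < K * n)%N by rewrite !muln_gt0 K0 h0.
have := @exponential_interpolation K n (tri K * 'I_L)%type _ (0, 0, 0)%N (box U V W) rowpol
  frow grow (fun s => (nx s)%:R) th deg (fun r => r.2) X T rho K%:R sig (del0 + rho * T) del1
  card_rows M0 inj rho1 X_ge0 T_ge0 maj_row inner_row.
move=> /(_ _ grow_le ev_row_close ev_row_conj) le.
have sd : \sum_r (deg r)%:R = 2%:R * (K * n)%:R * (K.-1)%:R / 3%:R :> R.
  by rewrite -sum_rows_deg mulrAC mulfV ?mul1r // pnatr_eq0.
have Mp : 0 < (K * n)%:R :> R by rewrite ltr0n.
rewrite -(ler_pM2l Mp); apply: le_trans (le _) _.
  by move=> s sB; rewrite normr_nat nx_le // th_le.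
by rewrite sum_rows_exponent sd le_eqVlt; apply/orP; left; apply/eqP; field.
Qed.

End ThreeLogs.

Lemma three_log_alternative (g k N p q K h U1 V1 W1 U2 V2 W2 : nat) (X T sig bet rho : R) :
  let lam := ln g%:R in let L := h.*2 in let n := (K.+1 * h)%N in
  let gam := sq5 * p%:R / q%:R in
  let Lam := k%:R * eta - N%:R * lam - ln gam in
  let U := (U1 + U2 + L)%N in let V := (V1 + V2)%N in let W := (W1 + W2)%N in
  (1 < g)%N -> (0 < p)%N -> (0 < q)%N -> (0 < K)%N -> (0 < h)%N ->
  (0 < U1)%N -> (0 < V1)%N -> (0 < W1)%N -> (U2 <= k)%N ->
  (2 * (K.-1 * L) ^ 2 < U2 * V2 * W2)%N ->
  1 <= rho -> (U + k * W)%:R <= X ->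
  U%:R * eta + V%:R * lam + W%:R * (`|ln gam| + `|Lam|) <= T ->
  X + K%:R + ((eta * X + rho * T) / lam + K%:R) <= K%:R * exp sig ->
  sq5 * p%:R <= exp bet -> q%:R <= exp bet ->
  2%:R * (L%:R * W%:R * `|Lam|) * rho ^+ n <= 1 ->
  (n.-1)%:R / 2%:R * ln rho <= 2%:R * ln (K * n)%:R + ln 6%:R + 2%:R * K%:R +
    4%:R / 3%:R * (K.-1)%:R * sig + (L.-1)%:R / 2%:R *
      (V%:R * lam + W%:R * ln q%:R + (V%:R * lam + W%:R * bet) + rho * T) \/
  exists a b : int, coprimez a b /\
    (size (undup [seq (a * (s.1.1 + k * s.2)%:Z + b * (s.1.2 + N * s.2)%:Z)%R |
       s <- box U1 V1 W1]) <= K.-1 * L)%N.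
Proof.
move=> lam L n gam Lam U V W g1 p0 q0 K0 h0 U10 V10 W10 U2k big rho1 hX hT hS hbp hbq hLam.
have [deg|ndeg] := classic (exists a b : int, coprimez a b /\
    (size (undup [seq (a * (s.1.1 + k * s.2)%:Z + b * (s.1.2 + N * s.2)%:Z)%R |
       s <- box U1 V1 W1]) <= K.-1 * L)%N); first by right.
left; apply: (three_log_inequality g1 p0 q0 K0 h0 rho1 hX hT hS hbp hbq hLam).
move=> c van.
pose Y u v w := ev gold (ypol3 g p q V W (u, v, w)).
have s50 : 0 < sq5 := lt_trans ltr01 sq5_gt1.
have Y0 u v w : Y u v w != 0.
  have gn : gold != 0 by rewrite gt_eqF // (lt_trans ltr01 gold_gt1).
  have nn m : (0 < m)%N -> m%:R != 0 :> R by move=> m0; rewrite pnatr_eq0 -lt0n.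
  rewrite /Y /ypol3 ev_ypol -/sq5; apply: mulf_neq0; last by apply: expf_neq0; apply: nn.
  apply: mulf_neq0; last by rewrite expf_neq0 // mulf_neq0 ?nn // gt_eqF.
  by apply: mulf_neq0; apply: expf_neq0 => //; apply: nn; apply: ltnW.
have Ys i u v w : Y (u + i)%N v w = gold ^+ i * Y u v w.
  by rewrite /Y /ypol3 !ev_ypol /= exprD; ring.
pose c' (x : 'I_K * 'I_K) b := if insub x is Some y then c (y, b) else 0.
have c'E (y : tri K) b : c' (val y) b = c (y, b) by rewrite /c' valK.
have [|all0|/ndeg//] := @three_log_zero_estimate R K L k N U1 V1 W1 U2 V2 W2 gold Y c' gold_gt1 Y0 Ys U10 V10 W10 U2k big.
  move=> u v w iu iv iw.
  have sB : (u, v, w) \in box U V W by rewrite mem_box iu iv iw.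
  rewrite -[RHS](van _ sB) sum_rows exchange_big /=.
  rewrite -(@big_sig_val _ _ _ _ _ (fun x => \sum_(b < L) c' x b *
    (('C(u + k * w, x.1))%:R * ('C(v + N * w, x.2))%:R * Y u v w ^+ b))).
  by apply: eq_bigr => y _; apply: eq_bigr => b _; rewrite c'E ev_rowpol.
by move=> [y b]; rewrite -c'E; apply: all0; exact: (valP y).
Qed.

(** The conjugate of [gold^b] is less than 1 in absolute value, while [g^a] is its own conjugate and
    at least 1. Equality would give an element of norm zero with a nonzero conjugate. *)
Lemma gold_pow_neq (g a b : nat) : (0 < g)%N -> (0 < b)%N -> gold ^+ b != g%:R ^+ a.
Proof.
move=> g0 b0; apply/eqP => e; have hx := gold_sqr.
have g1 : `|1 - gold| < 1.
  by have := gold_gt1; have := gold_lt2; rewrite ltr_norml => *; apply/andP; split; lra.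
have hx' : (1 - gold) ^+ 2 = (1 - gold) + 1 by rewrite sqrrB hx; ring.
have nz : ev (1 - gold) ('X ^+ b - (g ^ a)%:R) != 0.
  rewrite evB evXn evX ev_nat natrX subr_eq0; apply/eqP => e'.
  have : `|(1 - gold) ^+ b| < 1 by rewrite normrX exprn_ilt1 // -lt0n.
  by rewrite e' normrX normr_nat ltNge exprn_ege1 // ler1n.
have := golden_norm_ge1 hx' nz; have -> : 1 - (1 - gold) = gold by ring.
have -> : ev gold ('X ^+ b - (g ^ a)%:R) = 0 by rewrite evB evXn evX ev_nat natrX e subrr.
by rewrite mulr0 normr0 ler10.
Qed.

Section TwoLogs.

Variables (g a b u0 p q j K L V W : nat) (X T sig bet rho : R).

Let lam := ln g%:R.
Let mu := b%:R * eta - a%:R * lam.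
Let lng := u0%:R * eta + ln (sq5 * p%:R / q%:R).
Let Lam := j%:R * mu - lng.
(** The functions nearly depend on [x = v + j w] alone, so there is one monomial for each power
    ([I = 1]) and [n] is the number of rows. *)
Let n := (K * L)%N.

Definition px (s : nat * nat) := (s.1 + j * s.2)%N.

Definition ypol2 (s : nat * nat) := ypol g p q W (b * s.1 + u0 * s.2) (a * (V - s.1)) s.2.
Definition rowpol2 (r : 'I_K * 'I_L) (s : nat * nat) : {poly int} :=
  ('C(px s, r.1))%:R * ypol2 s ^+ r.2.

Lemma ev_rowpol2 (x : R) r s : ev x (rowpol2 r s) =
  ('C(px s, r.1))%:R * ev x (ypol2 s) ^+ r.2.
Proof. by rewrite /rowpol2 evM ev_nat evXn. Qed.

Hypotheses (g0 : (1 < g)%N) (p0 : (0 < p)%N) (q0 : (0 < q)%N) (K0 : (0 < K)%N) (L0 : (0 < L)%N).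

Let del0 := (V * a)%:R * lam + W%:R * ln q%:R.
Let del1 := (V * a)%:R * lam + W%:R * bet.

Hypotheses (rho1 : 1 <= rho) (hX : (V + j * W)%:R <= X) (hT : X * `|mu| <= T)
  (hS : rho * X + K%:R <= K%:R * exp sig)
  (hbp : sq5 * p%:R <= exp bet) (hbq : q%:R <= exp bet)
  (hLam : 2%:R * (L%:R * W%:R * `|Lam|) * rho ^+ n <= 1).

Lemma px_le s : s \in grid V W -> (px s)%:R <= X.
Proof.
case: s => [v w]; rewrite mem_grid /= => /andP[iv iw].
apply: le_trans hX; rewrite ler_nat /px /= leq_add ?(ltnW iv) //.
by rewrite leq_mul2l ltnW ?orbT.
Qed.

Let X0 : 0 <= X. Proof. by apply: le_trans hX; rewrite ler0n. Qed.
Let rho0 : 0 <= rho. Proof. exact: le_trans rho1. Qed.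

Let cst (r : 'I_K * 'I_L) := exp (K%:R + (r.1 : nat)%:R * sig).
Let frow (r : 'I_K * 'I_L) : {poly {poly R}} := fallp r.1 'X *
   ((exp (r.2%:R * del0))%:P%:P * taylorp n r.2 mu).
Let grow (r : 'I_K * 'I_L) : {poly {poly R}} := fallm r.1 'X *
   ((exp (r.2%:R * del0))%:P%:P * taylorp n r.2 `|mu|).

Lemma maj_row2 r : maj (frow r) (grow r).
Proof.
apply: majM; first exact/maj_fallp/maj_outerX.
apply: majM; last exact: maj_taylorp.
by apply: majC; rewrite ger0_norm // exp_ge0.
Qed.

Lemma inner_row2 r m : (size ((frow r)`_m)%R <= 1)%N.
Proof.
have : inner_le (0 + (0 + 0)) (frow r).
  apply: inner_leM; first exact/inner_le_fallp0/inner_le_outerX.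
  by apply: inner_leM; [exact: inner_leC | exact: inner_le_taylorp].
by move=> /(_ m).
Qed.

Lemma power_part_le (r : 'I_K * 'I_L) (x : R) :
  0 <= x <= rho * X + K%:R -> x ^+ r.1 / ((r.1)`!)%:R <= cst r.
Proof.
by move=> /andP[x0 xX]; apply: pow_div_fact_le => //; apply: le_trans hS.
Qed.

Lemma ev2_outerX (x t : R) : ev2 'X x t = t.
Proof. by rewrite /ev2 hornerX hornerC. Qed.

Lemma grow2_le r : ev2 (grow r) 0 (rho * X) <= cst r * exp (r.2%:R * (del0 + rho * T)).
Proof.
have rX : 0 <= rho * X by rewrite mulr_ge0.
have iK : (r.1 <= K)%N by apply: ltnW.
have x0 : 0 <= ev2 'X 0 (rho * X) by rewrite ev2_outerX.
have /andP[a0 a1] := ev2_fallm_le iK x0; rewrite ev2_outerX in a1.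
have {}a1 : ev2 (fallm r.1 'X) 0 (rho * X) <= cst r.
  by apply: le_trans a1 _; apply: power_part_le; rewrite lexx andbT addr_ge0.
move: a0 a1; rewrite /grow; move: (fallm _ 'X) => A a0 a1.
rewrite !ev2M ev2C ev2_taylorp; apply: ler_pM => //.
  rewrite mulr_ge0 ?exp_ge0 // sumr_ge0 // => i _.
  by rewrite divr_ge0 // exprn_ge0 // !mulr_ge0.
have -> : r.2%:R * (del0 + rho * T) = r.2%:R * del0 + r.2%:R * (rho * T) :> R.
  by rewrite mulrDr.
rewrite (expD (r.2%:R * del0)); apply: ler_wpM2l; first exact: exp_ge0.
apply: le_trans (taylor_le_exp _ _) _; first by rewrite !mulr_ge0.
rewrite ler_exp -mulrA; apply: ler_wpM2l => //.
by rewrite mulrCA; apply: ler_wpM2l => //; rewrite mulrC.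
Qed.

Lemma binomial2_le (r : 'I_K * 'I_L) s : s \in grid V W -> ('C(px s, r.1))%:R <= cst r.
Proof.
move=> sB; apply: le_trans (binomial_le _ _) _.
apply: power_part_le; rewrite ler0n /=; apply: le_trans (px_le sB) _.
by rewrite -[X in X <= _]addr0 lerD ?ler_peMl.
Qed.

Lemma grid_le s : s \in grid V W -> (s.1 <= V)%N /\ (s.2 <= W)%N.
Proof. by rewrite mem_grid => /andP[/ltnW + /ltnW]. Qed.

Lemma ev_row2_close (r : 'I_K * 'I_L) s : s \in grid V W ->
  `|ev gold (rowpol2 r s) - ev2 (frow r) 0 (px s)%:R| * rho ^+ n
    <= 2%:R * (cst r * exp (r.2%:R * (del0 + rho * T))).
Proof.
move=> sB; have [vV wW] := grid_le sB.
have -> : ev2 (frow r) 0 (px s)%:R = ('C(px s, r.1))%:R *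
    (exp (r.2%:R * del0) * taylor n (r.2%:R * (mu * (px s)%:R))).
  have ex := ev2_fallp r.1 (ev2_outerX 0 (px s)%:R).
  move: ex; rewrite /frow; move: (fallp _ 'X) => A ex.
  by rewrite !ev2M ex ev2C ev2_taylorp (mulrA r.2%:R).
have -> : ev gold (rowpol2 r s) =
    ('C(px s, r.1))%:R * exp (mu * (px s)%:R - s.2%:R * Lam + del0) ^+ r.2.
  rewrite ev_rowpol2 /ypol2 ev_ypol_gold //; congr (_ * exp _ ^+ _).
  by rewrite /Lam /lng /mu /del0 /lam /px !natrM natrB // !natrD !natrM; ring.
apply: row_close => //; first by rewrite ler0n (binomial2_le r sB).
  apply: le_trans hT; rewrite normrM normr_nat mulrC ler_wpM2r //.
  exact: px_le.
apply: le_trans hLam; rewrite ler_wpM2r ?exprn_ge0 // ler_wpM2l //.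
by rewrite normrM normr_nat mulrA ler_wpM2r // ler_pM // ler_nat // ltnW.
Qed.

Lemma ev_row2_conj (r : 'I_K * 'I_L) s : s \in grid V W ->
  `|ev (1 - gold) (rowpol2 r s)| <= cst r * exp (r.2%:R * del1).
Proof.
move=> sB; have [vV wW] := grid_le sB; rewrite ev_rowpol2; apply: row_conj.
  by rewrite ler0n (binomial2_le r sB).
by apply: ev_ypol_conj => //; rewrite mulnC leq_mul2r leq_subr orbT.
Qed.

Lemma card_rows2 : #|{: 'I_K * 'I_L}| = (1 * n)%N.
Proof. by rewrite card_prod !card_ord mul1n. Qed.

Lemma sum_rows2_degree :
  \sum_(r : 'I_K * 'I_L) (r.1 : nat)%:R = n%:R * (K.-1)%:R / 2%:R :> R.
Proof.
rewrite -(pair_bigA _ (fun (i : 'I_K) (j : 'I_L) => (i : nat)%:R : R)) /=.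
rewrite (eq_bigr (fun i : 'I_K => (i : nat)%:R * L%:R)); last first.
  by move=> i _; rewrite sumr_const card_ord mulr_natr.
by rewrite -mulr_suml sum_ord_nat /n natrM; ring.
Qed.

Lemma sum_rows2_exponent :
  \sum_(r : 'I_K * 'I_L) (r.2 : nat)%:R = n%:R * (L.-1)%:R / 2%:R :> R.
Proof.
rewrite -(pair_bigA _ (fun (i : 'I_K) (j : 'I_L) => (j : nat)%:R : R)) /=.
by rewrite sumr_const card_ord sum_ord_nat /n natrM -[_ *+ K]mulr_natl !mulrA.
Qed.

Lemma two_log_interpolation :
  (forall c : 'I_K * 'I_L -> R,
     (forall s, s \in grid V W -> \sum_r c r * ev gold (rowpol2 r s) = 0) ->
     forall r, c r = 0) ->
  (n.-1)%:R / 2%:R * ln rho <= 2%:R * ln n%:R + ln 6%:R + 2%:R * K%:R +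
    (K.-1)%:R * sig + (L.-1)%:R / 2%:R * (del0 + del1 + rho * T).
Proof.
move=> inj.
have n0 : (0 < n)%N by rewrite muln_gt0 K0 L0.
have := @exponential_interpolation 1 n ('I_K * 'I_L)%type _ (0, 0)%N (grid V W) rowpol2
  frow grow (fun=> 0) (fun s => (px s)%:R) (fun r => r.1) (fun r => r.2) 0 X rho K%:R sig
  (del0 + rho * T) del1 card_rows2 _ inj rho1 (lexx 0) X0 maj_row2 inner_row2.
rewrite !mul1n => /(_ n0 _ grow2_le ev_row2_close ev_row2_conj) le.
have np : 0 < n%:R :> R by rewrite ltr0n.
rewrite -(ler_pM2l np); apply: le_trans (le _) _.
  by move=> s sB; rewrite normr0 normr_nat px_le.
by rewrite sum_rows2_degree sum_rows2_exponent le_eqVlt; apply/orP; left; apply/eqP; field.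
Qed.

End TwoLogs.

Lemma two_log_inequality (g a b u0 p q j K L V W : nat) (X T sig bet rho : R) :
  let lam := ln g%:R in let mu := b%:R * eta - a%:R * lam in
  let Lam := j%:R * mu - (u0%:R * eta + ln (sq5 * p%:R / q%:R)) in
  let n := (K * L)%N in
  (1 < g)%N -> (0 < b)%N -> (0 < p)%N -> (0 < q)%N -> (0 < K)%N -> (0 < L)%N ->
  (V <= j)%N -> (K.-1 * L < V * W)%N -> 1 <= rho ->
  (V + L + j * W)%:R <= X -> X * `|mu| <= T ->
  rho * X + K%:R <= K%:R * exp sig ->
  sq5 * p%:R <= exp bet -> q%:R <= exp bet ->
  2%:R * (L%:R * W%:R * `|Lam|) * rho ^+ n <= 1 ->
  (n.-1)%:R / 2%:R * ln rho <= 2%:R * ln n%:R + ln 6%:R + 2%:R * K%:R +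
    (K.-1)%:R * sig + (L.-1)%:R / 2%:R *
      (((V + L) * a)%:R * lam + W%:R * ln q%:R + (((V + L) * a)%:R * lam + W%:R * bet) + rho * T).
Proof.
move=> lam mu Lam n g1 b0 p0 q0 K0 L0 Vj big rho1 hX hT hS hbp hbq hLam.
apply: (two_log_interpolation g1 p0 q0 K0 L0 rho1 hX hT hS hbp hbq hLam) => c van.
pose al := gold ^+ b / g%:R ^+ a.
pose ga := gold ^+ u0 * (p%:R * sq5) / q%:R.
(* The clearing factor [D] is constant on the grid, so [D^k] is absorbed by the coefficients and
   leaves the values [al^v ga^w]. *)
pose D : R := g%:R ^+ (a * (V + L)) * q%:R ^+ W.
have s0 : 0 < sq5 := lt_trans ltr01 sq5_gt1.
have gp : 0 < gold := lt_trans ltr01 gold_gt1.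
have g0 : 0 < g%:R :> R by rewrite ltr0n ltnW.
have q0' : 0 < q%:R :> R by rewrite ltr0n.
have al0 : 0 < al by rewrite divr_gt0 ?exprn_gt0.
have ga0 : 0 < ga by rewrite divr_gt0 // mulr_gt0 ?exprn_gt0 // mulr_gt0 // ltr0n.
have al1 : al != 1.
  rewrite -subr_eq0; have -> : al - 1 = (gold ^+ b - g%:R ^+ a) / g%:R ^+ a.
    by rewrite mulrBl divff // expf_neq0 // gt_eqF.
  apply: mulf_neq0; last by rewrite invr_eq0 expf_neq0 // gt_eqF.
  by rewrite subr_eq0 gold_pow_neq // ltnW.
have YE v w : (v <= V + L)%N -> (w <= W)%N ->
    ev gold (ypol2 g a b u0 p q (V + L) W (v, w)) = D * (al ^+ v * ga ^+ w).
  move=> vV wW; rewrite /ypol2 ev_ypol -/sq5 /= /D /al /ga.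
  move: gold (g%:R : R) (q%:R : R) (p%:R : R) sq5 g0 q0' => x y z r t g0 q0'.
  rewrite -(subnK vV) -(subnK wW) !addnK mulnDr !exprD !expr_div_n !exprMn !exprM.
  by field; rewrite !expf_neq0 ?gt_eqF.
suff h : forall i k, c (i, k) * D ^+ k = 0.
  move=> [i k]; have /eqP := h i k; rewrite mulf_eq0 expf_eq0 => /orP[/eqP //|].
  by rewrite mulf_eq0 !expf_eq0 !(gt_eqF g0, gt_eqF q0') !andbF.
apply: (@two_log_zero_estimate R K L j V W al (fun v w => al ^+ v * ga ^+ w)) => //.
- by move=> v w; rewrite mulf_neq0 // expf_neq0 // gt_eqF.
- by move=> i v w; rewrite exprD mulrCA mulrA.
move=> v w iv iw.
have sB : (v, w) \in grid (V + L) W by rewrite mem_grid iv iw.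
rewrite -[RHS](van _ sB) exchange_big /= pair_bigA; apply: eq_bigr => -[i k] _ /=.
rewrite ev_rowpol2 YE ?(ltnW iv) ?(ltnW iw) // [in RHS]exprMn.
by rewrite /px /=; ring.
Qed.

(* The two criteria over the classical reals *)
Delimit Scope R_scope with coqR.

Definition stdE := (RplusE, RminusE, RmultE, RoppE, INRE, RdivE, RabsE).

Section Bridge.
Local Open Scope R_scope.

(** The first alternative is an inequality to be refuted by the choice of parameters, the second the
    input of the case of two logarithms. *)
Lemma three_log_dichotomy (g k N p q K h n U1 V1 W1 U2 V2 W2 V' U V W : nat) (X T sig bet rho : R) :
  let lam := ln (INR g) in let L := 2 * INR h in
  let D := INR K * L in
  let gam := sq5 * INR p / INR q in
  let Lam := INR k * eta - INR N * lam - ln gam in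
  (1 < g)%coq_nat -> (0 < p)%coq_nat -> (0 < q)%coq_nat -> (0 < K)%coq_nat -> (0 < h)%coq_nat ->
  (0 < U1)%coq_nat -> (0 < V')%coq_nat -> (V' <= V1)%coq_nat -> (0 < W1)%coq_nat ->
  (U1 <= k)%coq_nat -> (U2 <= k)%coq_nat -> n = ((K + 1) * h)%coq_nat ->
  U = (U1 + U2 + 2 * h)%coq_nat -> V = (V1 + V2)%coq_nat -> W = (W1 + W2)%coq_nat ->
  D < INR U1 * INR V' -> D < INR U1 * INR W1 -> D < INR k * INR W1 ->
  D < INR N * INR W1 -> D < (INR V1 - INR V') * INR W1 ->
  2 * (D * D) < INR U2 * INR V2 * INR W2 ->
  1 <= rho -> INR U + INR k * INR W <= X ->
  INR U * eta + INR V * lam + INR W * (Rabs (ln gam) + Rabs Lam) <= T ->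
  X + INR K + ((eta * X + rho * T) / lam + INR K) <= INR K * exp sig ->
  sq5 * INR p <= exp bet -> INR q <= exp bet ->
  2 * (L * INR W * Rabs Lam) * exp (INR n * ln rho)%coqR <= 1 ->
  (INR n - 1) / 2 * ln rho <= 2 * ln (INR K * INR n)%coqR + ln 6%coqR + 2 * INR K +
    4 / 3 * (INR K - 1) * sig + (L - 1) / 2 *
      (2 * (INR V * lam) + INR W * (ln (INR q) + bet) + rho * T) \/
  exists b a : nat, [/\ (0 < b)%coq_nat, (0 < a)%coq_nat,
    INR b * (INR V1 - INR V') <= D &
    Rabs (INR b * INR N - INR a * INR k)%coqR * INR W1 <= D].
Proof.
Local Open Scope ring_scope.
move=> lam L D gam Lam /ssrnat.ltP g1 /ssrnat.ltP p0 /ssrnat.ltP q0 /ssrnat.ltP K0 /ssrnat.ltP h0.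
move=> /ssrnat.ltP U10 /ssrnat.ltP V'0 /ssrnat.leP V'V /ssrnat.ltP W10 /ssrnat.leP U1k /ssrnat.leP U2k nE.
move=> UE VE WE /RltP c1 /RltP c2 /RltP c3 /RltP c4 /RltP c5 /RltP c6.
move=> /RleP rho1 /RleP hX /RleP hT /RleP hS /RleP hbp /RleP hbq /RleP hLam.
have izr m : IZR (Zpos m) = (Pos.to_nat m)%:R by rewrite /IZR -INR_IPR INRE.
have two : 2%coqR = 2%:R :> R by [].
have LE : L = (h.*2)%:R by rewrite /L -mul2n natrM !stdE.
have DE : D = (K * h.*2)%:R by rewrite /D LE natrM !stdE.
have Dle : (K.-1 * h.*2 <= K * h.*2)%N by rewrite leq_mul2r leq_pred orbT.
have nE' : n = (K.+1 * h)%N by rewrite nE; nia.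
have lamE : lam = ln g%:R by rewrite /lam INRE.
have gamE : gam = sq5 * p%:R / q%:R by rewrite /gam !stdE.
have LamE : Lam = k%:R * eta - N%:R * ln g%:R - ln (sq5 * p%:R / q%:R) by rewrite /Lam gamE lamE !stdE.
have {}rho1 : (1 : R) <= rho by [].
have rho0 : 0 < rho by apply: lt_le_trans rho1.
have UE' : U = (U1 + U2 + h.*2)%N by rewrite UE -mul2n.
have V10 : (0 < V1)%N by apply: leq_trans V'V.
move: hT hS hX hLam c1 c2 c3 c4 c5 c6; rewrite !stdE two LE DE -?natrD -?natrM -?natrB //.
rewrite !ltr_nat => hT hS hX hLam c1 c2 c3 c4 c5 c6.
have big : (2 * (K.-1 * h.*2) ^ 2 < U2 * V2 * W2)%N.
  by apply: leq_ltn_trans c6; rewrite leq_mul2l /= -mulnn leq_mul.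
rewrite lamE gamE LamE in hT hS hLam; rewrite UE' VE WE in hX hT hLam.
have hLam' : 2%:R * ((h.*2)%:R * (W1 + W2)%N%:R *
    `|k%:R * eta - N%:R * ln g%:R - ln (sq5 * p%:R / q%:R)|) * rho ^+ n <= 1.
  by rewrite -natrM -[rho]exp_ln' // -exp_natM.
rewrite nE' in hLam'.
have {}hX : (U1 + U2 + h.*2 + k * (W1 + W2))%N%:R <= X by rewrite natrD.
have pred m : (0 < m)%N -> (m.-1)%:R = m%:R - 1 :> R by move=> m0; rewrite -subn1 natrB.
have n0 : (0 < K.+1 * h)%N by rewrite muln_gt0.
have h20 : (0 < h.*2)%N by rewrite double_gt0.
have hbp' : sq5 * p%:R <= exp bet by rewrite -INRE.
have hbq' : q%:R <= exp bet by rewrite -INRE.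
case: (three_log_alternative g1 p0 q0 K0 h0 U10 V10 W10 U2k big rho1 hX hT hS hbp' hbq' hLam') => [ineq|[a [b [ab small]]]].
  left; apply/RleP; move: ineq; rewrite -nE' lamE VE WE; rewrite -nE' in n0.
  rewrite !pred // (izr 4%positive) (izr 3%positive) [6%coqR](izr (xO (xI xH))) -natrM => ineq.
  rewrite -[Pos.to_nat 6]/6%N -[Pos.to_nat 4]/4%N -[Pos.to_nat 3]/3%N -[1%coqR]/(1 : R).
  apply: le_trans ineq _; rewrite le_eqVlt; apply/orP; left; apply/eqP.
  by rewrite -[(V1 + V2)%coq_nat]/(V1 + V2)%N -[(W1 + W2)%coq_nat]/(W1 + W2)%N; ring.
have c5' : (K.-1 * h.*2 < (V1 - V') * W1)%N.
  by move: c5; rewrite -natrM ltr_nat; apply: leq_ltn_trans.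
have [b' [a' [b0 a0 bV cW]]] := degenerate_direction ab small U10 V'0 V'V W10 U1k
  (leq_ltn_trans Dle c1) (leq_ltn_trans Dle c2) (leq_ltn_trans Dle c3) (leq_ltn_trans Dle c4) c5'.
right; exists b', a'; split; first exact/ssrnat.ltP.
- exact/ssrnat.ltP.
- by apply/RleP; rewrite !stdE -natrM ler_nat (leq_trans bV).
apply/RleP; rewrite !stdE -!natrM.
have -> : (b' * N)%:R - (a' * k)%:R = (b'%:Z * N%:Z - a'%:Z * k%:Z)%:~R :> R.
  by rewrite -!PoszM rmorphB.
by rewrite -intr_norm -abszE -pmulrn -natrM ler_nat (leq_trans cW).
Qed.

Lemma two_log_criterion (g a b u0 p q j K L n V W V' : nat) (X T sig bet rho : R) :
  let lam := ln (INR g) in let mu := (INR b * eta - INR a * lam)%coqR in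
  let Lam := (INR j * mu - (INR u0 * eta + ln (sq5 * INR p / INR q)%coqR))%coqR in
  (1 < g)%coq_nat -> (0 < b)%coq_nat -> (0 < p)%coq_nat -> (0 < q)%coq_nat ->
  (0 < K)%coq_nat -> (0 < L)%coq_nat ->
  n = (K * L)%coq_nat -> V' = (V + L)%coq_nat ->
  (V <= j)%coq_nat -> (INR K * INR L < INR V * INR W)%coqR -> (1 <= rho)%coqR ->
  (INR V' + INR j * INR W <= X)%coqR -> (X * Rabs mu <= T)%coqR ->
  (rho * X + INR K <= INR K * exp sig)%coqR ->
  (sq5 * INR p <= exp bet)%coqR -> (INR q <= exp bet)%coqR ->
  (2 * (INR L * INR W * Rabs Lam) * exp (INR n * ln rho)%coqR <= 1)%coqR ->
  ((INR n - 1) / 2 * ln rho <= 2 * ln (INR n) + ln 6%coqR + 2 * INR K + (INR K - 1) * sig +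
    (INR L - 1) / 2 *
      (2 * (INR V' * INR a * lam) + INR W * (ln (INR q) + bet) + rho * T))%coqR.
Proof.
Local Open Scope ring_scope.
move=> lam mu Lam /ssrnat.ltP g1 /ssrnat.ltP b0 /ssrnat.ltP p0 /ssrnat.ltP q0 /ssrnat.ltP K0 /ssrnat.ltP L0.
move=> nE V'E /ssrnat.leP Vj /RltP big /RleP rho1 /RleP hX /RleP hT /RleP hS /RleP hbp /RleP hbq /RleP hLam.
have izr m : IZR (Zpos m) = (Pos.to_nat m)%:R by rewrite /IZR -INR_IPR INRE.
have two : 2%coqR = 2%:R :> R by [].
have lamE : lam = ln g%:R by rewrite /lam INRE.
have {}rho1 : (1 : R) <= rho by [].
have rho0 : 0 < rho by apply: lt_le_trans rho1.
have muE : mu = b%:R * eta - a%:R * ln g%:R by rewrite /mu lamE !stdE.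
have LamE : Lam = j%:R * (b%:R * eta - a%:R * ln g%:R) - (u0%:R * eta + ln (sq5 * p%:R / q%:R)).
  by rewrite /Lam muE !stdE.
rewrite muE in hT; rewrite LamE two nE in hLam; rewrite V'E in hX.
have big' : (K.-1 * L < V * W)%N.
  have := big; rewrite !stdE -!natrM ltr_nat; apply: leq_ltn_trans.
  by rewrite leq_mul2r leq_pred orbT.
have hX' : (V + L + j * W)%N%:R <= X by rewrite natrD natrM -!INRE.
have hT' : X * `|b%:R * eta - a%:R * ln g%:R| <= T by rewrite -RabsE.
have hS' : rho * X + K%:R <= K%:R * exp sig by rewrite -INRE.
have hbp' : sq5 * p%:R <= exp bet by rewrite -INRE.
have hbq' : q%:R <= exp bet by rewrite -INRE.
have hLam' : 2%:R * (L%:R * W%:R * `|j%:R * (b%:R * eta - a%:R * ln g%:R) -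
    (u0%:R * eta + ln (sq5 * p%:R / q%:R))|) * rho ^+ (K * L) <= 1.
  by rewrite -[rho]exp_ln' // -exp_natM; move: hLam; rewrite !stdE.
have := two_log_inequality g1 b0 p0 q0 K0 L0 Vj big' rho1 hX' hT' hS' hbp' hbq' hLam'.
have pred m : (0 < m)%N -> (m.-1)%:R = m%:R - 1 :> R by move=> m0; rewrite -subn1 natrB.
have n0 : (0 < K * L)%N by rewrite muln_gt0 K0.
rewrite !pred // => ineq; apply/RleP.
rewrite !stdE [6%coqR](izr (xO (xI xH))) two lamE nE V'E.
rewrite -[Pos.to_nat 6]/6%N -[1%coqR]/(1 : R).
apply: le_trans ineq _; rewrite le_eqVlt; apply/orP; left; apply/eqP.
by rewrite -[(V + L)%coq_nat]/(V + L)%N -[(K * L)%coq_nat]/(K * L)%N natrM; ring.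
Qed.
End Bridge.

Lemma gold_quadratic : (gold * gold = gold + 1)%coqR.
Proof. exact: gold_sqr. Qed.

Lemma one_lt_gold : (1 < gold)%coqR.
Proof. by apply/RltP; exact: gold_gt1. Qed.

End Determinants.

Module Estimates.

Import Determinants (gold, sq5, eta, three_log_dichotomy, two_log_criterion, gold_quadratic, one_lt_gold).
Local Open Scope R_scope.

(** * Lower bounds for linear forms in two and three logarithms *)

Lemma ln_mono (x y : R) : 0 < x -> x <= y -> ln x <= ln y.
Proof.
intros x0 [xy | ->]; [left; now apply ln_increasing | right; reflexivity].
Qed.

Lemma exp_ge_square (x y z : R) : 0 <= y -> y <= exp x -> z <= y * y -> z <= exp (2 * x).
Proof.
intros y0 yx zy; replace (2 * x) with (x + x) by ring; rewrite exp_plus.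
apply Rle_trans with (y * y); [assumption | now apply Rmult_le_compat].
Qed.

(** Starts from [1 + x <= exp x] and doubles the argument at each entry of the list, which holds the
    successive squares rounded down. *)
Ltac exp_ge_by_squaring x steps :=
  let h := fresh "h" in
  pose proof (exp_ineq1_le x) as h;
  let rec go steps h :=
    lazymatch steps with
    | nil => idtac
    | cons ?z ?rest =>
        let h' := fresh "h" in
        lazymatch type of h with
        | ?y <= exp ?u =>
          assert (h' : z <= exp (2 * u)) by
            (apply exp_ge_square with y; [lra | exact h | lra]); clear h; go rest h'
        end
    end in
  go steps h.

Lemma exp_le_inv_of_neg (x y : R) : 0 < y -> / y <= exp (- x) -> exp x <= y.
Proof.
intros y0 h; rewrite exp_Ropp in h.
apply Rinv_le_contravar in h; [rewrite !Rinv_inv in h; exact h | now apply Rinv_0_lt_compat].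
Qed.

(** An upper bound for [exp (69 / 100)] is required, obtained as a lower bound at the negative
    argument; seven doublings lead from [69 / 12800] to [69 / 100]. *)
Lemma ln2_ge : 69 / 100 <= ln 2.
Proof.
rewrite <- (ln_exp (69 / 100)); apply ln_mono; [apply exp_pos |].
apply exp_le_inv_of_neg; [lra |].
exp_ge_by_squaring (- (69 / 12800)) (cons (98924 / 100000) (cons (97859 / 100000) (cons (95763 / 100000)
  (cons (91705 / 100000) (cons (84098 / 100000) (cons (70724 / 100000) (cons (/ 2) nil))))))).
match goal with h : _ <= exp ?u |- _ => replace (- (69 / 100)) with u by field; exact h end.
Qed.

Lemma ln2_le : ln 2 <= 695 / 1000.
Proof.
rewrite <- (ln_exp (695 / 1000)); apply ln_mono; [lra |].
exp_ge_by_squaring (695 / 256000) (cons (10054370 / 10000000) (cons (10109035 / 10000000)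
  (cons (10219258 / 10000000) (cons (10443323 / 10000000) (cons (10906299 / 10000000)
  (cons (11894735 / 10000000) (cons (14148472 / 10000000) (cons 2 nil)))))))).
match goal with h : _ <= exp ?u |- _ => replace (695 / 1000) with u by field; exact h end.
Qed.

Lemma eta_le : eta <= 482 / 1000.
Proof.
pose proof gold_quadratic as gq; pose proof one_lt_gold as g1.
rewrite <- (ln_exp (482 / 1000)); apply ln_mono; [lra |].
exp_ge_by_squaring (482 / 256000) (cons (10037691 / 10000000) (cons (10075524 / 10000000)
  (cons (10151618 / 10000000) (cons (10305534 / 10000000) (cons (10620403 / 10000000)
  (cons (11279295 / 10000000) (cons (12722249 / 10000000) (cons (16185 / 10000) nil)))))))).
match goal with h : _ <= exp ?u |- _ => replace (482 / 1000) with u by field;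
  apply Rle_trans with (16185 / 10000); [nra | exact h] end.
Qed.

Lemma eta_ge : 48 / 100 <= eta.
Proof.
pose proof gold_quadratic as gq; pose proof one_lt_gold as g1.
rewrite <- (ln_exp (48 / 100)); apply ln_mono; [apply exp_pos |].
apply Rle_trans with (1618 / 1000); [|nra].
apply exp_le_inv_of_neg; [lra |].
exp_ge_by_squaring (- (48 / 12800)) (cons (9925140 / 10000000) (cons (9850840 / 10000000)
  (cons (9703904 / 10000000) (cons (9416575 / 10000000) (cons (8867188 / 10000000)
  (cons (7862702 / 10000000) (cons (/ (1618 / 1000)) nil))))))).
match goal with h : _ <= exp ?u |- _ => replace (- (48 / 100)) with u by field; exact h end.
Qed.

(** The tangent of the logarithm at 8, with [3 * ln 2 - 1] rounded up to [11 / 10]. *)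
Lemma ln_le_linear (x : R) : 0 < x -> ln x <= x / 8 + 11 / 10.
Proof.
intros x0; pose proof ln2_le as l2.
replace (ln x) with (ln (x / 8) + 3 * ln 2).
- assert (ln (x / 8) <= x / 8 - 1); [|lra].
  rewrite <- (ln_exp (x / 8 - 1)); apply ln_mono; [lra |].
  pose proof (exp_ineq1_le (x / 8 - 1)); lra.
- replace (3 * ln 2) with (ln (2 * (2 * 2))); [| rewrite !ln_mult; lra].
  rewrite <- ln_mult; [f_equal; field | lra | lra].
Qed.

Lemma nat_floor (x : R) : 0 <= x -> exists m : nat, INR m <= x < INR m + 1.
Proof.
intros x0; destruct (archimed x) as [a1 a2].
assert (0 < up x)%Z by (apply lt_IZR; lra).
exists (Z.to_nat (up x - 1)); rewrite INR_IZR_INZ, Z2Nat.id by lia.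
rewrite minus_IZR; lra.
Qed.

Lemma lambda_ge (g : nat) : (1 < g)%nat -> 69 / 100 <= ln (INR g).
Proof.
intros g1; eapply Rle_trans; [apply ln2_ge | apply ln_mono; [lra |]]. apply (le_INR 2); lia.
Qed.

Lemma exp_le (x y : R) : x <= y -> exp x <= exp y.
Proof. intros [xy | ->]; [left; now apply exp_increasing | apply Rle_refl]. Qed.

Lemma ln4_bounds : 138 / 100 <= ln 4 <= 139 / 100.
Proof.
replace 4 with (2 * 2) by ring; rewrite ln_mult by lra.
pose proof ln2_ge; pose proof ln2_le; lra.
Qed.

Lemma exp_ge_quarter_square (x : R) : 0 <= x -> x * x / 4 <= exp x.
Proof.
intros x0; replace x with (x / 2 + x / 2) at 3 by field; rewrite exp_plus.
pose proof (exp_ineq1_le (x / 2)); nra.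
Qed.

Lemma ln_nonneg (x : R) : 1 <= x -> 0 <= ln x.
Proof. intros x1; rewrite <- ln_1; apply ln_mono; lra. Qed.

(** [H1] controls the heights of [phi^b] and [g^a], and [H2] that of the modified gamma. A smaller
    form would satisfy all conditions of [two_log_criterion] with [rho = 4] and [L = 2 t], whose
    conclusion fails numerically. *)
Lemma two_log_bound (g a b u0 p q j t : nat) (H1 H2 sig : R) :
  let lam := ln (INR g) in let mu := INR b * eta - INR a * lam in
  let lng := INR u0 * eta + ln (sq5 * INR p / INR q) in
  (1 < g)%nat -> (0 < b)%nat -> (0 < p)%nat -> (0 < q)%nat -> 100 <= INR t ->
  4 * (sig + 2) <= 3 * INR t -> 48 / 100 <= H1 -> INR b * eta <= H1 -> INR a * lam <= H1 ->
  5 <= H2 -> 41 * INR t * H2 <= INR j -> INR j <= exp sig ->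
  Rabs lng <= H2 -> sq5 * INR p <= exp H2 -> INR q <= exp H2 ->
  exp (- (2300 * (INR t * (INR t * H1 * H2)))) <= Rabs (INR j * mu - lng).
Proof.
intros lam mu lng g1 b0 p0 q0 t100 sigt H1l bH aH H2l jl ju lngH pH qH.
set (Lam := INR j * mu - lng); set (M := INR t * H1 * H2).
apply Rnot_lt_le; intros small.
pose proof ln4_bounds as l4.
assert (T1 : 48 <= INR t * H1) by nra.
assert (M1 : 240 <= M) by (unfold M; nra).
assert (lam0 : 0 <= lam).
{ apply ln_nonneg; apply (le_INR 1); lia. }
assert (eta0 := eta_ge).
(* [K] is just large enough for [K L < V W]. *)
destruct (nat_floor (820 * M)) as [K [K1 K2]]; [nra |].
assert (Kl : 819 * M <= INR K) by lra.
assert (Kp : 0 < INR K) by lra.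
assert (tK0 : 0 < INR t * INR K) by (apply Rmult_lt_0_compat; lra).
(* Sides inversely proportional to the heights, so that [V' H1] and [W H2] are at most a twentieth
   of [K]; the factor 0.0495 in [V] leaves room for the [L] additional translates. *)
set (v := INR K / H1); set (w := INR K / H2).
assert (vE : v * H1 = INR K) by (unfold v; field; lra).
assert (wE : w * H2 = INR K) by (unfold w; field; lra).
assert (vl : 819 * (INR t * H2) <= v).
{ apply Rmult_le_reg_r with H1; [lra |]; rewrite vE; unfold M in Kl; lra. }
assert (wl : 819 * (INR t * H1) <= w).
{ apply Rmult_le_reg_r with H2; [lra |]; rewrite wE; unfold M in Kl; lra. }
assert (vu : v <= 820 * (INR t * H2)).
{ apply Rmult_le_reg_r with H1; [lra |]; rewrite vE; unfold M in K1; lra. }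
assert (v0 : 409500 <= v) by nra.
assert (w0 : 39312 <= w) by lra.
assert (vw : 819 * (INR t * INR K) <= v * w).
{ apply Rmult_le_reg_r with H1; [lra |].
  replace (v * w * H1) with (INR K * w) by (rewrite <- vE; ring). nra. }
destruct (nat_floor (495 / 10000 * v)) as [V [V1 V2]]; [lra |].
destruct (nat_floor (5 / 100 * w)) as [W [W1 W2]]; [lra |].
assert (Vl : 494 / 10000 * v <= INR V) by lra.
assert (Wl : 499 / 10000 * w <= INR W) by lra.
set (L := (2 * t)%nat).
assert (LE : INR L = 2 * INR t) by (unfold L; rewrite mult_INR; simpl; ring).
set (V' := (V + L)%nat).
assert (V'E : INR V' = INR V + 2 * INR t) by (unfold V'; rewrite plus_INR, LE; ring).
assert (V'H : INR V' * H1 <= 5 / 100 * INR K).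
{ rewrite V'E; replace ((INR V + 2 * INR t) * H1) with (INR V * H1 + 2 * (INR t * H1)) by ring.
  assert (INR V * H1 <= 495 / 10000 * INR K) by (rewrite <- vE, <- Rmult_assoc; apply Rmult_le_compat_r; lra).
  assert (INR t * H1 * 5 <= INR t * H1 * H2) by (apply Rmult_le_compat_l; lra).
  unfold M in Kl; lra. }
assert (WH : INR W * H2 <= 5 / 100 * INR K) by (rewrite <- wE, <- Rmult_assoc; apply Rmult_le_compat_r; lra).
assert (W0 : 0 <= INR W) by apply pos_INR.
assert (V'0 : 0 <= INR V') by apply pos_INR.
assert (WH5 : 5 * INR W <= INR W * H2) by (rewrite Rmult_comm; apply Rmult_le_compat_l; lra).
assert (j0 : 0 <= INR j) by apply pos_INR.
assert (muH : Rabs mu <= H1).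
{ assert (0 <= INR b * eta) by (apply Rmult_le_pos; [apply pos_INR | lra]).
  assert (0 <= INR a * lam) by (apply Rmult_le_pos; [apply pos_INR | lra]).
  unfold mu; apply Rabs_le; lra. }
assert (Lam_small : Rabs Lam <= 1 / 1000).
{ apply Rlt_le; eapply Rlt_le_trans; [exact small |].
  rewrite exp_Ropp; replace (1 / 1000) with (/ 1000) by field.
  apply Rinv_le_contravar; [lra |].
  assert (100 * M <= INR t * M) by (apply Rmult_le_compat_r; lra).
  eapply Rle_trans; [| apply exp_ineq1_le]; lra. }
assert (jmu : INR j * Rabs mu <= H2 + 1 / 1000).
{ rewrite <- (Rabs_pos_eq (INR j)) by assumption; rewrite <- Rabs_mult.
  replace (INR j * mu) with (lng + Lam) by (unfold Lam; ring).
  eapply Rle_trans; [apply Rabs_triang | lra]. }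
set (X := INR V' + INR j * INR W).
set (T := X * Rabs mu).
assert (TK : T <= 1001 / 10000 * INR K).
{ unfold T, X; replace ((INR V' + INR j * INR W) * Rabs mu)
    with (INR V' * Rabs mu + INR W * (INR j * Rabs mu)) by ring.
  assert (INR V' * Rabs mu <= INR V' * H1) by (apply Rmult_le_compat_l; assumption).
  assert (INR W * (INR j * Rabs mu) <= INR W * (H2 + 1 / 1000)) by (apply Rmult_le_compat_l; assumption).
  lra. }
assert (n0 : 0 < INR (K * L)) by (rewrite mult_INR, LE; lra).
set (n := (K * L)%nat).
assert (nE : INR n = 2 * (INR t * INR K)) by (unfold n; rewrite mult_INR, LE; ring).
assert (es : 20500 <= exp sig).
{ assert (100 * 5 <= INR t * H2) by (apply Rmult_le_compat; lra). lra. }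
assert (sig0 : 0 <= sig).
{ destruct (Rle_lt_dec 0 sig); [assumption |].
  apply exp_increasing in r; rewrite exp_0 in r; lra. }
assert (key := @two_log_criterion g a b u0 p q j K L n V W V' X T sig H2 4).
cbv zeta in key; fold lam mu lng Lam in key.
assert (ineq : (INR n - 1) / 2 * ln 4 <= 2 * ln (INR n) + ln 6 + 2 * INR K + (INR K - 1) * sig +
    (INR L - 1) / 2 * (2 * (INR V' * INR a * lam) + INR W * (ln (INR q) + H2) + 4 * T)).
{ apply key; clear key; try assumption; try reflexivity.
  - apply INR_lt; simpl; lra.
  - apply INR_lt; rewrite LE; simpl; lra.
  - apply INR_le; lra.
  - assert (494 / 10000 * v * (499 / 10000 * w) <= INR V * INR W) by (apply Rmult_le_compat; lra).
    rewrite LE; lra.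
  - lra.
  - assert (48 / 100 * INR V' <= INR V' * H1) by (rewrite Rmult_comm; apply Rmult_le_compat_l; lra).
    assert (INR j * INR W <= exp sig * (1 / 100 * INR K)) by (apply Rmult_le_compat; lra).
    assert (INR K * 2 <= INR K * exp sig) by (apply Rmult_le_compat_l; lra).
    unfold X; lra.
  (* Origin of 2300: [n ln 4] is at most [2 * 820 * 1.39 t M < 2280 t M], and the remaining
     [exp (- 20 t M)] outweighs the polynomial factor. *)
  - fold n; rewrite LE, nE.
    assert (tM : 24000 <= INR t * M) by (replace 24000 with (100 * 240) by ring; apply Rmult_le_compat; lra).
    assert (WK : 4 * (INR t * INR W) <= 33 * (INR t * M)).
    { assert (INR t * INR W <= INR t * (82 / 10 * M)) by (apply Rmult_le_compat_l; lra). lra. }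
    assert (tK : INR t * INR K <= INR t * (820 * M)) by (apply Rmult_le_compat_l; lra).
    assert (tW : 0 <= INR t * INR W) by (apply Rmult_le_pos; lra).
    set (e := exp (2 * (INR t * INR K) * ln 4)).
    assert (e0 : 0 < e) by apply exp_pos.
    assert (Rabs Lam * e <= exp (- (20 * (INR t * M)))).
    { apply Rle_trans with (exp (- (2300 * (INR t * M))) * e).
      - apply Rmult_le_compat_r; lra.
      - unfold e; rewrite <- exp_plus; apply exp_le.
        assert (INR t * INR K * ln 4 <= INR t * INR K * (139 / 100)) by (apply Rmult_le_compat_l; lra).
        lra. }
    assert (sq := exp_ge_quarter_square (20 * (INR t * M)) ltac:(lra)).
    rewrite exp_Ropp in H.
    apply Rle_trans with (4 * (INR t * INR W) * (Rabs Lam * e)); [right; ring |].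
    apply Rle_trans with (33 * (INR t * M) * / exp (20 * (INR t * M))).
    + apply Rmult_le_compat; try lra. apply Rmult_le_pos; [apply Rabs_pos | lra].
    + apply Rmult_le_reg_r with (exp (20 * (INR t * M))); [apply exp_pos |].
      rewrite Rmult_assoc, Rinv_l by (pose proof (exp_pos (20 * (INR t * M))); lra).
      assert (INR t * M * 24000 <= INR t * M * (INR t * M)) by (apply Rmult_le_compat_l; lra). lra. }
clear key.
assert (lnK := ln_le_linear (INR K) Kp); assert (lnt := ln_le_linear (INR t) ltac:(lra)).
assert (ln6 := ln_le_linear 6 ltac:(lra)).
assert (lnn : ln (INR n) = ln 2 + (ln (INR t) + ln (INR K))).
{ rewrite nE, !ln_mult; lra || (apply Rmult_lt_0_compat; lra). }
pose proof ln2_le as l2.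
assert (lnq : ln (INR q) <= H2).
{ rewrite <- (ln_exp H2); apply ln_mono; [apply (lt_INR 0); lia | exact qH]. }
assert (s1 : INR V' * INR a * lam <= 5 / 100 * INR K).
{ rewrite Rmult_assoc; apply Rle_trans with (INR V' * H1); [apply Rmult_le_compat_l |]; assumption. }
assert (s2 : INR W * (ln (INR q) + H2) <= 1 / 10 * INR K).
{ apply Rle_trans with (INR W * (2 * H2)); [apply Rmult_le_compat_l |]; lra. }
assert (T0 : 0 <= T).
{ unfold T; apply Rmult_le_pos; [unfold X | apply Rabs_pos]; assert (0 <= INR j * INR W) by (now apply Rmult_le_pos); lra. }
assert (s3 : (INR L - 1) / 2 * (2 * (INR V' * INR a * lam) + INR W * (ln (INR q) + H2) + 4 * T)
   <= INR t * (6004 / 10000 * INR K)).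
{ apply Rle_trans with ((INR L - 1) / 2 * (6004 / 10000 * INR K)).
  - apply Rmult_le_compat_l; [rewrite LE |]; lra.
  - apply Rmult_le_compat_r; [| rewrite LE]; lra. }
assert (s4 : INR K * (sig + 2) <= INR K * (3 / 4 * INR t)) by (apply Rmult_le_compat_l; lra).
assert (tK : 100 * INR K <= INR t * INR K) by (apply Rmult_le_compat_r; lra).
assert (tK' : INR t * 196560 <= INR t * INR K) by (apply Rmult_le_compat_l; lra).
assert (s5 : (INR n - 1) / 2 * (138 / 100) <= (INR n - 1) / 2 * ln 4).
{ apply Rmult_le_compat_l; [rewrite nE |]; lra. }
(* In units of [t K] the left side is about 1.38, while the right has 0.75 from the degrees and
   0.6004 from the heights; the logarithms fit into the margin. *)
rewrite nE in s5, ineq at 1; lra.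
Qed.

Lemma Rabs_bounds (x a : R) : Rabs x <= a -> - a <= x <= a.
Proof.
intros h; pose proof (Rle_abs x); pose proof (Rle_abs (- x)); rewrite Rabs_Ropp in *; lra.
Qed.

Lemma sq5_pos : 0 < sq5.
Proof. pose proof one_lt_gold as h; change sq5 with (2 * gold - 1); lra. Qed.

Lemma ceil_quotient (k b : nat) : (0 < b)%nat -> exists j u : nat, (j * b = k + u)%nat /\ (u < b)%nat.
Proof.
intros b0; exists ((k + (b - 1)) / b)%nat.
pose proof (Nat.div_mod_eq (k + (b - 1)) b) as e.
pose proof (Nat.mod_upper_bound (k + (b - 1)) b ltac:(lia)) as m.
exists (b - 1 - (k + (b - 1)) mod b)%nat; lia.
Qed.

Lemma ln_sq5_ratio_shift (g p q e f : nat) : (0 < g)%nat -> (0 < p)%nat -> (0 < q)%nat ->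
  ln (sq5 * INR (p * g ^ f) / INR (q * g ^ e)) =
  ln (sq5 * INR p / INR q) + (INR f - INR e) * ln (INR g).
Proof.
intros g0 p0 q0; pose proof sq5_pos as s0.
assert (g0' : 0 < INR g) by now apply lt_0_INR.
assert (p0' : 0 < INR p) by now apply lt_0_INR.
assert (q0' : 0 < INR q) by now apply lt_0_INR.
assert (0 < INR g ^ f) by now apply pow_lt.
assert (0 < INR g ^ e) by now apply pow_lt.
rewrite !mult_INR, !pow_INR.
unfold Rdiv; rewrite !ln_mult, !ln_Rinv, !ln_mult, !ln_pow;
  repeat (apply Rmult_lt_0_compat || apply Rinv_0_lt_compat || assumption); ring.
Qed.

Lemma mul_pow_le_exp (g e : nat) (x B z : R) : (0 < g)%nat -> 0 <= x -> x <= exp B ->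
  INR e * ln (INR g) <= z -> x * INR (g ^ e) <= exp (B + z).
Proof.
intros g0 x0 xB ez; rewrite exp_plus, pow_INR.
assert (g0' : 0 < INR g) by now apply lt_0_INR.
apply Rmult_le_compat; [assumption | apply pow_le; lra | assumption |].
rewrite <- (exp_ln (INR g ^ e)) by now apply pow_lt.
rewrite ln_pow by assumption; now apply exp_le.
Qed.

Lemma degenerate_bound (g k N p q t a b : nat) (A : R) :
  let lam := ln (INR g) in let L := 6 * INR t in
  let Lam := INR k * eta - INR N * lam - ln (sq5 * INR p / INR q) in
  (1 < g)%nat -> (0 < b)%nat -> (0 < p)%nat -> (0 < q)%nat -> 100 <= INR t ->
  4 * (ln (INR k) + 2) <= 3 * INR t -> 6 * (lam * L) <= A ->
  Rabs (ln (sq5 * INR p / INR q)) <= A -> sq5 * INR p <= exp A -> INR q <= exp A ->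
  100000 * (lam * A * (L * L)) < INR k ->
  INR b <= 201 * (lam * L) -> Rabs (INR b * INR N - INR a * INR k) <= 193 * (A * L) ->
  Rabs Lam <= 1 / 1000 ->
  exp (- (190000 * (lam * A * (L * L) * L))) <= Rabs Lam.
Proof.
intros lam L Lam g1 b0 p0 q0 t100 tk AL gamA pA qA kbig bL cL Lam_small.
set (lg := ln (sq5 * INR p / INR q)) in *.
set (c := Rabs (INR b * INR N - INR a * INR k)) in *.
pose proof eta_ge as e1; pose proof eta_le as e2.
pose proof (lambda_ge g g1) as lam1; fold lam in lam1.
assert (L1 : 600 <= L) by (unfold L; lra).
assert (lL : 414 <= lam * L) by nra.
assert (A1 : 2484 <= A) by lra.
assert (b1 : 1 <= INR b) by (apply (le_INR 1); lia).
assert (B0 : 0 <= INR a * lam) by (apply Rmult_le_pos; [apply pos_INR | lra]).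
assert (c0 : 0 <= c) by apply Rabs_pos.
set (P := lam * A * (L * L)) in *.
assert (lA : 1713 <= lam * A) by nra.
assert (LL : 360000 <= L * L) by nra.
assert (PA : 248400 * A <= P).
{ unfold P; replace (248400 * A) with (69 / 100 * A * 360000) by field.
  apply Rmult_le_compat; try lra; apply Rmult_le_compat_r; lra. }
assert (PL : 600 * (lam * A * L) <= P).
{ unfold P; replace (600 * (lam * A * L)) with (lam * A * (600 * L)) by ring.
  apply Rmult_le_compat_l; [lra |]; apply Rmult_le_compat_r; lra. }
assert (lAL : lam * (A * L) = lam * A * L) by ring.
assert (lAL0 : 0 <= lam * A * L) by (apply Rmult_le_pos; lra).
assert (cl : c * lam <= 193 * (lam * A * L)) by nra.
(* With [k + u = j b] the form becomes [j mu - log gamma'], where [mu] is the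
   logarithm of [gold^b g^(-a)] and [gamma'] absorbs [gold^u g^(N - j a)]. *)
destruct (ceil_quotient k b b0) as [j [u [jbE ub]]].
assert (jb : INR j * INR b = INR k + INR u) by (rewrite <- mult_INR, <- plus_INR; now f_equal).
assert (u0 : 0 <= INR u) by apply pos_INR.
assert (ub' : INR u <= INR b) by (apply le_INR; lia).
assert (k0 : 0 < INR k) by lra.
assert (NE : INR N * lam = INR k * eta - lg - Lam) by (unfold Lam; ring).
assert (gB := Rabs_bounds _ _ gamA); assert (LB := Rabs_bounds _ _ Lam_small).
assert (cB := Rabs_bounds (INR b * INR N - INR a * INR k) c ltac:(apply Rle_refl)).
set (mu := INR b * eta - INR a * lam).
(* [a lam] and [b eta] agree up to one percent, since [a k] is close to [b N], [N lam] is close to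
   [k eta] and [k] is large. *)
set (H1 := 101 / 100 * (INR b * eta)).
assert (be : 48 / 100 * INR b <= INR b * eta) by nra.
assert (be' : INR b * eta <= 482 / 1000 * INR b) by nra.
assert (aH : INR a * lam <= H1).
{ apply Rmult_le_reg_r with (INR k); [assumption |].
  assert (i1 : INR a * INR k * lam <= (INR b * INR N + c) * lam) by (apply Rmult_le_compat_r; lra).
  assert (i2 : INR b * (INR N * lam) <= INR b * (INR k * eta + A + 1 / 1000)) by (apply Rmult_le_compat_l; lra).
  assert (i3 : INR b * (A + 1 / 1000 + 193 * (lam * A * L)) <= INR b * (1 / 100 * 48 / 100 * INR k)).
  { apply Rmult_le_compat_l; lra. }
  assert (i4 : 48 / 100 * INR b * INR k <= INR b * eta * INR k) by (apply Rmult_le_compat_r; lra).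
  assert (i5 : 1 * (193 * (lam * A * L)) <= INR b * (193 * (lam * A * L))) by (apply Rmult_le_compat_r; lra).
  unfold H1; lra. }
assert (muH : Rabs mu <= H1) by (apply Rabs_le; unfold mu, H1 in *; lra).
assert (mB := Rabs_bounds _ _ muH).
set (E := c * lam / INR b).
assert (EE : E * INR b = c * lam) by (unfold E; field; lra).
assert (E0 : 0 <= E) by (unfold E; apply Rmult_le_pos; [apply Rmult_le_pos; lra | left; apply Rinv_0_lt_compat; lra]).
set (H2 := A + E + H1).
set (s := (INR j * INR a - INR N) * lam).
assert (sb : s * INR b = INR a * lam * INR u - (INR b * INR N - INR a * INR k) * lam).
{ unfold s. replace ((INR j * INR a - INR N) * lam * INR b)
   with (INR a * lam * (INR j * INR b) - INR b * INR N * lam) by ring. rewrite jb; ring. }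
assert (cl' : - (c * lam) <= (INR b * INR N - INR a * INR k) * lam <= c * lam).
{ split; [replace (- (c * lam)) with (- c * lam) by ring |]; apply Rmult_le_compat_r; lra. }
assert (H10 : 0 <= H1) by (unfold H1; lra).
assert (s_le : s <= E + H1).
{ apply Rmult_le_reg_r with (INR b); [lra |]. rewrite sb, Rmult_plus_distr_r, EE.
  assert (INR a * lam * INR u <= H1 * INR b) by (apply Rmult_le_compat; lra). lra. }
assert (s_ge : - E <= s).
{ apply Rmult_le_reg_r with (INR b); [lra |]. rewrite sb, Ropp_mult_distr_l_reverse, EE.
  assert (0 <= INR a * lam * INR u) by (apply Rmult_le_pos; lra). lra. }
assert (lng : Rabs (INR u * eta + (lg - s)) <= H2).
{ assert (w : - (E + H1) <= INR u * eta - s <= E + H1); [| apply Rabs_le; unfold H2; lra].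
  assert (e : (INR u * eta - s) * INR b = INR u * mu + (INR b * INR N - INR a * INR k) * lam).
  { rewrite Rmult_minus_distr_r, sb; unfold mu; ring. }
  assert (INR u * mu <= INR b * H1).
  { apply Rle_trans with (INR u * H1); [apply Rmult_le_compat_l | apply Rmult_le_compat_r]; lra. }
  assert (- (INR b * H1) <= INR u * mu).
  { apply Rle_trans with (- (INR u * H1)).
    - apply Ropp_le_contravar, Rmult_le_compat_r; lra.
    - rewrite <- Ropp_mult_distr_r_reverse; apply Rmult_le_compat_l; lra. }
  split; (apply Rmult_le_reg_r with (INR b); [lra |]); rewrite e.
  - rewrite Ropp_mult_distr_l_reverse, Rmult_plus_distr_r, EE; lra.
  - rewrite Rmult_plus_distr_r, EE; lra. }
(* The integer [j a - N] may have either sign: its positive part goes into [q] and its negative part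
   into [p]. *)
assert (exists e f : nat, INR e - INR f = INR j * INR a - INR N /\
   INR e * lam <= E + H1 /\ INR f * lam <= E) as [e [f [ef [el fl]]]].
{ destruct (Nat.le_ge_cases N (j * a)) as [h | h].
  - exists (j * a - N)%nat, 0%nat; rewrite minus_INR, mult_INR by assumption.
    split; [simpl; ring | split; [exact s_le | simpl; lra]].
  - exists 0%nat, (N - j * a)%nat; rewrite minus_INR, mult_INR by assumption.
    split; [simpl; ring | split; [simpl; lra |]].
    replace ((INR N - INR j * INR a) * lam) with (- s) by (unfold s; ring); lra. }
assert (g0 : (0 < g)%nat) by lia.
assert (lgE := ln_sq5_ratio_shift g p q e f g0 p0 q0).
(* Here [6 lam L <= A] enters: [H1 b] is quadratic in [lam L] and is brought down to [lam A L]. The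
   three parts of [H2] contribute 201, 193 and [98 * 201 / 6]. *)
assert (H2b : H2 * INR b <= 3700 * (lam * A * L)).
{ unfold H2; rewrite !Rmult_plus_distr_r, EE.
  assert (A * INR b <= A * (201 * (lam * L))) by (apply Rmult_le_compat_l; lra).
  assert (H1b : H1 <= 98 * (lam * L)) by (unfold H1; lra).
  assert (H1 * INR b <= 98 * (lam * L) * (201 * (lam * L))) by (apply Rmult_le_compat; lra).
  assert (lam * L * (6 * (lam * L)) <= lam * L * A) by (apply Rmult_le_compat_l; lra). lra. }
assert (ps : 0 <= sq5 * INR p) by (apply Rmult_le_pos; [left; apply sq5_pos | apply pos_INR]).
assert (bound := two_log_bound g a b u (p * g ^ f) (q * g ^ e) j t H1 H2 (ln (INR k))).
cbv zeta in bound; fold lam in bound; rewrite lgE in bound; fold lg lam mu in bound.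
replace (lg + (INR f - INR e) * lam) with (lg - s) in bound
  by (unfold s; rewrite <- ef; ring).
replace (INR j * mu - (INR u * eta + (lg - s))) with Lam in bound.
2: { unfold Lam, mu, s; fold lg.
  replace (INR j * (INR b * eta - INR a * lam) - (INR u * eta + (lg - (INR j * INR a - INR N) * lam)))
    with ((INR j * INR b) * eta - INR u * eta - lg - INR N * lam) by ring. rewrite jb; ring. }
assert (gf0 : forall i, (0 < g ^ i)%nat) by (intros i; apply Nat.neq_0_lt_0, Nat.pow_nonzero; lia).
eapply Rle_trans; [| apply bound; clear bound; try assumption].
(* As [t = L / 6], the exponent is at most [2300 * 1900 / 36] times [lam A L^3], below the 190000
   required. *)
- apply exp_le, Ropp_le_contravar.
  assert (H1 * H2 <= 1900 * (lam * A * L)).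
  { apply Rle_trans with (487 / 1000 * (H2 * INR b)); [| lra].
    unfold H1; assert (0 <= H2) by (unfold H2; lra).
    replace (487 / 1000 * (H2 * INR b)) with (487 / 1000 * INR b * H2) by ring.
    apply Rmult_le_compat_r; lra. }
  assert (INR t * INR t * (H1 * H2) <= INR t * INR t * (1900 * (lam * A * L))).
  { apply Rmult_le_compat_l; [nra | assumption]. }
  replace (P * L) with (lam * A * L * (36 * (INR t * INR t))) by (unfold P, L; ring). 
  assert (0 <= lam * A * L * (INR t * INR t)) by (apply Rmult_le_pos; nra). lra.
- apply Nat.mul_pos_pos; [assumption | apply gf0].
- apply Nat.mul_pos_pos; [assumption | apply gf0].
- unfold H1; lra.
- unfold H1; lra.
- unfold H2; lra.
- apply Rmult_le_reg_r with (INR b); [lra |]; rewrite jb.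
  assert (41 * INR t * (H2 * INR b) <= 41 * INR t * (3700 * (lam * A * L))) by (apply Rmult_le_compat_l; lra).
  replace P with (lam * A * L * (6 * INR t)) in kbig by (unfold P, L; ring).
  assert (0 <= lam * A * L * INR t) by (apply Rmult_le_pos; [nra | lra]). lra.
- rewrite exp_ln by assumption. apply le_INR; nia.
- rewrite mult_INR, <- Rmult_assoc.
  apply Rle_trans with (exp (A + E)); [| apply exp_le; unfold H2; lra].
  now apply mul_pow_le_exp.
- rewrite mult_INR.
  apply Rle_trans with (exp (A + (E + H1))); [| apply exp_le; unfold H2; lra].
  apply mul_pow_le_exp; try assumption; apply pos_INR.
Qed.

Lemma nat_floor_large (x : R) (e : R) : 0 <= x -> 1 <= e * x ->
  exists m : nat, (1 - e) * x <= INR m <= x.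
Proof. intros x0 ex; destruct (nat_floor x x0) as [m h]; exists m; lra. Qed.

(** By contradiction: for a smaller form the parameters below violate the first alternative of
    [three_log_dichotomy] with [rho = 4], and the second leads to [degenerate_bound]. *)
Lemma three_log_bound (g k N p q t : nat) (A : R) :
  let lam := ln (INR g) in let L := 6 * INR t in
  let Lam := INR k * eta - INR N * lam - ln (sq5 * INR p / INR q) in
  (1 < g)%nat -> (0 < p)%nat -> (0 < q)%nat -> 100 <= INR t ->
  4 * (ln (INR k) + 2) <= 3 * INR t -> 6 * (lam * L) <= A ->
  Rabs (ln (sq5 * INR p / INR q)) <= A -> sq5 * INR p <= exp A -> INR q <= exp A ->
  100000 * (lam * A * (L * L)) < INR k ->
  exp (- (190000 * (lam * A * (L * L) * L))) <= Rabs Lam.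
Proof.
intros lam L Lam g1 p0 q0 t100 tk AL gamA pA qA kbig.
apply Rnot_lt_le; intros small.
set (lg := ln (sq5 * INR p / INR q)) in *.
pose proof eta_ge as e1; pose proof eta_le as e2.
pose proof (lambda_ge g g1) as lam1; fold lam in lam1.
assert (L1 : 600 <= L) by (unfold L; lra).
assert (lL : 414 <= lam * L) by nra.
assert (A1 : 2484 <= A) by lra.
set (P := lam * A * (L * L)) in *.
assert (lA : 1713 <= lam * A) by nra.
assert (LL : 360000 <= L * L) by nra.
assert (P1 : 1713 * 360000 <= P) by (apply Rmult_le_compat; lra).
assert (PA : 248400 * A <= P).
{ unfold P; replace (248400 * A) with (69 / 100 * A * 360000) by field.
  apply Rmult_le_compat; try lra; apply Rmult_le_compat_r; lra. }
assert (Lam_small : Rabs Lam <= 1 / 1000).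
{ apply Rlt_le; eapply Rlt_le_trans; [exact small |].
  rewrite exp_Ropp; replace (1 / 1000) with (/ 1000) by field.
  apply Rinv_le_contravar; [lra |].
  assert (P * 600 <= P * L) by (apply Rmult_le_compat_l; lra).
  eapply Rle_trans; [| apply exp_ineq1_le]; lra. }
(* [K] is just large enough for [2 (K L)^2 < U2 V2 W2]. *)
destruct (nat_floor (271000 * P)) as [K [K1 K2]]; [lra |].
assert (Kl : 270999 * P <= INR K) by lra.
assert (Kp : 0 < INR K) by lra.
(* Sides inversely proportional to [eta], [lam] and [A], so that [U eta], [V lam] and [W A] are each
   at most [K / 48]; [T] is their sum, rounded up for the linear form. *)
set (x := INR K / (48 * eta)); set (y := INR K / (48 * lam)); set (z := INR K / (48 * A)).
assert (xE : x * eta = INR K / 48) by (unfold x; field; lra).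
assert (yE : y * lam = INR K / 48) by (unfold y; field; lra).
assert (zE : z * A = INR K / 48) by (unfold z; field; lra).
assert (x0 : 0 < x) by (apply Rmult_lt_reg_r with eta; lra).
assert (y0 : 0 < y) by (apply Rmult_lt_reg_r with lam; lra).
assert (z0 : 0 < z) by (apply Rmult_lt_reg_r with A; lra).
assert (xl : INR K <= 23136 / 1000 * x).
{ assert (x * eta <= x * (482 / 1000)) by (apply Rmult_le_compat_l; lra). lra. }
assert (xu : x * (48 / 100) <= INR K / 48).
{ rewrite <- xE; apply Rmult_le_compat_l; lra. }
assert (yl : 5645 * (A * (L * L)) <= y).
{ apply Rmult_le_reg_r with lam; [lra |]; rewrite yE; unfold P in Kl; lra. }
assert (zl : 5645 * (lam * (L * L)) <= z).
{ apply Rmult_le_reg_r with A; [lra |]; rewrite zE; unfold P in Kl; lra. }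
assert (yl' : 10 ^ 9 <= y).
{ assert (2484 * 360000 <= A * (L * L)) by (apply Rmult_le_compat; lra). lra. }
assert (lLL : 69 / 100 * 360000 <= lam * (L * L)) by (apply Rmult_le_compat; lra).
assert (zl' : 10 ^ 9 <= z) by lra.
assert (xl' : 10 ^ 9 <= x) by lra.
(* A quarter of each side serves for translations and about three quarters for zeros; 74 instead of
   75 percent in [U2] makes room for the [L] translates of the elimination. *)
destruct (nat_floor_large (x / 4) (1 / 10000)) as [U1 U1B]; [lra | lra |].
destruct (nat_floor_large (74 / 100 * x) (1 / 10000)) as [U2 U2B]; [lra | lra |].
destruct (nat_floor_large (y / 4) (1 / 10000)) as [V1 V1B]; [lra | lra |].
destruct (nat_floor_large (3 / 4 * y) (1 / 10000)) as [V2 V2B]; [lra | lra |].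
destruct (nat_floor_large (z / 4) (1 / 10000)) as [W1 W1B]; [lra | lra |].
destruct (nat_floor_large (3 / 4 * z) (1 / 10000)) as [W2 W2B]; [lra | lra |].
destruct (nat_floor_large (y / 100) (1 / 10000)) as [V' V'B]; [lra | lra |].
set (U := (U1 + U2 + 2 * (3 * t))%nat); set (V := (V1 + V2)%nat); set (W := (W1 + W2)%nat).
assert (LP : 1713 * 600 * L <= P).
{ unfold P; replace (1713 * 600 * L) with (1713 * (600 * L)) by ring.
  apply Rmult_le_compat; try lra; apply Rmult_le_compat_r; lra. }
assert (UE : INR U <= x).
{ unfold U; rewrite !plus_INR, !mult_INR; simpl (INR 2); simpl (INR 3).
  replace ((1 + 1) * ((1 + 1 + 1) * INR t)) with L by (unfold L; ring). lra. }
assert (VE : INR V <= y) by (unfold V; rewrite plus_INR; lra).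
assert (WE : INR W <= z) by (unfold W; rewrite plus_INR; lra).
assert (U0 := pos_INR U). assert (V0 := pos_INR V). assert (W0 := pos_INR W).
assert (Ue : INR U * eta <= INR K / 48) by (rewrite <- xE; apply Rmult_le_compat_r; lra).
assert (Vl : INR V * lam <= INR K / 48) by (rewrite <- yE; apply Rmult_le_compat_r; lra).
assert (WA : INR W * A <= INR K / 48) by (rewrite <- zE; apply Rmult_le_compat_r; lra).
assert (WA' : INR W * 2484 <= INR W * A) by (apply Rmult_le_compat_l; lra).
assert (kx : x <= INR k) by lra.
assert (k0 : 0 < INR k) by lra.
assert (gB := Rabs_bounds _ _ gamA); assert (LB := Rabs_bounds _ _ Lam_small).
assert (Ny : y <= INR N).
{ apply Rmult_le_reg_r with lam; [lra |].
  replace (INR N * lam) with (INR k * eta - lg - Lam) by (unfold Lam; ring).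
  assert (INR k * (48 / 100) <= INR k * eta) by (apply Rmult_le_compat_l; lra). lra. }
set (D := INR K * (2 * INR (3 * t))).
assert (DE : D = INR K * L).
{ unfold D, L; rewrite mult_INR; simpl (INR 3); ring. }
assert (KL : 0 < INR K * L) by (apply Rmult_lt_0_compat; lra).
assert (xy : 1000 * (INR K * L) <= x * y).
{ apply Rle_trans with (INR K / 24 * (24000 * L)); [right; field |].
  apply Rmult_le_compat; try lra.
  assert (A * 600 * L <= A * L * L) by (rewrite !Rmult_assoc; apply Rmult_le_compat_l; [lra |];
    apply Rmult_le_compat_r; lra).
  assert (2484 * L <= A * L) by (apply Rmult_le_compat_r; lra). lra. }
assert (xz : 1000 * (INR K * L) <= x * z).
{ apply Rle_trans with (INR K / 24 * (24000 * L)); [right; field |].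
  apply Rmult_le_compat; try lra.
  assert (414 * L <= lam * L * L) by (apply Rmult_le_compat_r; lra). lra. }
assert (LLK : L * (INR K * L) = L * L * INR K) by ring.
assert (yz : 1176 / 10 * (L * (INR K * L)) <= y * z).
{ apply Rle_trans with (5645 * (A * (L * L)) * z); [| apply Rmult_le_compat_r; lra].
  replace (5645 * (A * (L * L)) * z) with (5645 * (L * L) * (z * A)) by ring.
  rewrite zE, LLK.
  assert (0 <= L * L * INR K) by (apply Rmult_le_pos; lra). lra. }
assert (yz' : 1000 * (INR K * L) <= y * z).
{ assert (600 * (INR K * L) <= L * (INR K * L)) by (apply Rmult_le_compat_r; lra). lra. }
assert (xyz : 508 / 100 * ((INR K * L) * (INR K * L)) <= x * y * z).
{ apply Rle_trans with (1000 / 23136 * INR K * (1176 / 10 * (L * (INR K * L)))).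
  - assert (0 <= (INR K * L) * (INR K * L)) by (apply Rmult_le_pos; lra). lra.
  - rewrite Rmult_assoc; rewrite (Rmult_assoc x).
    assert (0 <= L * (INR K * L)) by (apply Rmult_le_pos; lra).
    rewrite <- Rmult_assoc; apply Rmult_le_compat; lra. }
set (X := INR U + INR k * INR W).
set (T := 626 / 10000 * INR K).
assert (lnq : ln (INR q) <= A).
{ rewrite <- (ln_exp A); apply ln_mono; [apply (lt_INR 0); lia | exact qA]. }
assert (t0 : 1 <= INR t) by lra.
set (n := ((K + 1) * (3 * t))%nat).
assert (nE : INR n = (INR K + 1) * (3 * INR t)).
{ unfold n; rewrite !mult_INR, plus_INR; simpl (INR 1); simpl (INR 3); ring. }
assert (tK : 100 * INR K <= INR t * INR K) by (apply Rmult_le_compat_r; lra).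
assert (tK' : INR t * 100000 <= INR t * INR K) by (apply Rmult_le_compat_l; lra).
pose proof ln4_bounds as l4.
assert (kl0 : 0 <= ln (INR k)) by (apply ln_nonneg; lra).
assert (alt := @three_log_dichotomy g k N p q K (3 * t) n U1 V1 W1 U2 V2 W2 V' U V W X T (ln (INR k)) A 4).
cbv zeta in alt; fold lam lg Lam D in alt.
destruct alt as [ineq | [b [a [b0 a0 bV cW]]]]; try assumption; try reflexivity.
- apply INR_lt; simpl; lra.
- apply INR_lt; rewrite mult_INR; simpl; lra.
- apply INR_lt; simpl; lra.
- apply INR_lt; simpl; lra.
- apply INR_le; lra.
- apply INR_lt; simpl; lra.
- apply INR_le; lra.
- apply INR_le; lra.
- rewrite DE; apply Rlt_le_trans with (216 / 100000 * (x * y)); [lra |].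
  replace (216 / 100000 * (x * y)) with (24 / 100 * x * (9 / 1000 * y)) by field. apply Rmult_le_compat; lra.
- rewrite DE; apply Rlt_le_trans with (1 / 25 * (x * z)); [lra |].
  replace (1 / 25 * (x * z)) with (1 / 5 * x * (1 / 5 * z)) by field. apply Rmult_le_compat; lra.
- rewrite DE; apply Rlt_le_trans with (1 / 25 * (x * z)); [lra |].
  replace (1 / 25 * (x * z)) with (1 / 5 * x * (1 / 5 * z)) by field. apply Rmult_le_compat; lra.
- rewrite DE; apply Rlt_le_trans with (1 / 25 * (y * z)); [lra |].
  replace (1 / 25 * (y * z)) with (1 / 5 * y * (1 / 5 * z)) by field. apply Rmult_le_compat; lra.
- rewrite DE; apply Rlt_le_trans with (1 / 25 * (y * z)); [lra |].
  replace (1 / 25 * (y * z)) with (1 / 5 * y * (1 / 5 * z)) by field. apply Rmult_le_compat; lra.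
- rewrite DE.
  apply Rlt_le_trans with (416 / 1000 * (x * y * z)).
  + assert (0 < INR K * L * (INR K * L)) by (apply Rmult_lt_0_compat; lra). lra.
  + apply Rle_trans with ((9999 / 10000 * (74 / 100 * x)) * (9999 / 10000 * (3 / 4 * y)) * (9999 / 10000 * (3 / 4 * z))).
    * assert (0 <= x * y * z) by (apply Rmult_le_pos; [apply Rmult_le_pos |]; lra). lra.
    * apply Rmult_le_compat; [apply Rmult_le_pos; lra | lra | | lra]. apply Rmult_le_compat; lra.
- lra.
- apply Rle_trans with (INR K / 48 + INR K / 48 + INR W * (A + 1 / 1000)); [| unfold T; lra].
  apply Rplus_le_compat; [lra |]. apply Rmult_le_compat_l; lra.
- rewrite exp_ln by assumption.
  set (w := (eta * X + 4 * T) / lam).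
  assert (wE : w * lam = eta * X + 4 * T) by (unfold w; field; lra).
  assert (kW : INR k * INR W * 119000 <= INR k * INR K).
  { rewrite Rmult_assoc; apply Rmult_le_compat_l; lra. }
  assert (kK : 1000 * INR K <= INR k * INR K) by (apply Rmult_le_compat_r; lra).
  assert (X0 : 0 <= X) by (unfold X; assert (0 <= INR k * INR W) by (apply Rmult_le_pos; lra); lra).
  assert (eX : eta * X <= 482 / 1000 * X) by (apply Rmult_le_compat_r; lra).
  assert (eX0 : 0 <= eta * X) by (apply Rmult_le_pos; lra).
  assert (w0 : 0 <= w) by (apply Rmult_le_pos; [unfold T; lra | left; apply Rinv_0_lt_compat; lra]).
  assert (w * (69 / 100) <= w * lam) by (apply Rmult_le_compat_l; lra).
  unfold X in *; unfold T in *; lra.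
(* Origin of 190000: [n ln 4] is below [271001 * 1.39 / 2 * P L < 189000 P L], and the remaining
   [exp (- 1000 P L)] outweighs the polynomial factor. *)
- rewrite nE; replace (2 * INR (3 * t)) with L by (rewrite mult_INR; unfold L; simpl; ring).
  assert (WP : 2 * (L * INR W) <= 5 * (P * L)).
  { assert (L * INR W <= L * (25 / 10 * P)) by (apply Rmult_le_compat_l; lra). lra. }
  assert (PL : 600 * P <= P * L) by (rewrite (Rmult_comm 600); apply Rmult_le_compat_l; lra).
  set (e := exp ((INR K + 1) * (3 * INR t) * ln 4)).
  assert (e0 : 0 < e) by apply exp_pos.
  assert (small' : Rabs Lam * e <= exp (- (1000 * (P * L)))).
  { apply Rle_trans with (exp (- (190000 * (P * L))) * e).
    - apply Rmult_le_compat_r; lra.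
    - unfold e; rewrite <- exp_plus; apply exp_le.
      assert ((INR K + 1) * (3 * INR t) <= (271001 * P) * (3 * INR t)) by (apply Rmult_le_compat_r; lra).
      assert ((INR K + 1) * (3 * INR t) * ln 4 <= 271001 * P * (3 * INR t) * (139 / 100)).
      { apply Rmult_le_compat; lra. }
      replace (271001 * P * (3 * INR t)) with (271001 / 2 * (P * L)) in * by (unfold L; field). lra. }
  assert (sq := exp_ge_quarter_square (1000 * (P * L)) ltac:(lra)).
  rewrite exp_Ropp in small'.
  apply Rle_trans with (2 * (L * INR W) * (Rabs Lam * e)); [right; ring |].
  apply Rle_trans with (5 * (P * L) * / exp (1000 * (P * L))).
  + apply Rmult_le_compat; try lra.
    * apply Rmult_le_pos; [lra | apply Rmult_le_pos; lra].
    * apply Rmult_le_pos; [apply Rabs_pos | lra].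
  + apply Rmult_le_reg_r with (exp (1000 * (P * L))); [apply exp_pos |].
    rewrite Rmult_assoc, Rinv_l by (pose proof (exp_pos (1000 * (P * L))); lra).
    assert (P * L * 1000 <= P * L * (P * L)) by (apply Rmult_le_compat_l; lra). lra.
(* In units of [K L] the left side is about 0.345. On the right the degrees give at most [1 / 6],
   because [4 (ln k + 2) <= 3 t], and the heights give 0.167. *)
- assert (lnK := ln_le_linear (INR K) Kp); assert (lnt := ln_le_linear (INR t) ltac:(lra)).
  assert (ln6 := ln_le_linear 6 ltac:(lra)).
  assert (lnn : ln (INR K * INR n) <= ln 6 + ln (INR t) + 2 * ln (INR K)).
  { replace (ln 6 + ln (INR t) + 2 * ln (INR K)) with (ln (6 * INR t * (INR K * INR K))).
    - apply ln_mono; [apply Rmult_lt_0_compat; [lra |]; rewrite nE; apply Rmult_lt_0_compat; lra |].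
      rewrite nE; replace (6 * INR t * (INR K * INR K)) with (INR K * (INR K * 2 * (3 * INR t))) by ring.
      apply Rmult_le_compat_l; [lra |]; apply Rmult_le_compat_r; lra.
    - rewrite !ln_mult; try lra; repeat apply Rmult_lt_0_compat; lra. }
  replace (2 * INR (3 * t)) with L in ineq by (rewrite mult_INR; unfold L; simpl; ring).
  assert (s2 : INR W * (ln (INR q) + A) <= 2 * (INR K / 48)).
  { apply Rle_trans with (INR W * (2 * A)); [apply Rmult_le_compat_l |]; lra. }
  assert (s3 : (L - 1) / 2 * (2 * (INR V * lam) + INR W * (ln (INR q) + A) + 4 * T)
     <= (L - 1) / 2 * (334 / 1000 * INR K)).
  { apply Rmult_le_compat_l; [lra | unfold T; lra]. }
  assert (s4 : INR K * (4 * (ln (INR k) + 2)) <= INR K * (3 * INR t)) by (apply Rmult_le_compat_l; lra).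
  assert (s5 : (INR n - 1) / 2 * (138 / 100) <= (INR n - 1) / 2 * ln 4).
  { apply Rmult_le_compat_l; [rewrite nE |]; lra. }
  rewrite nE in s5, ineq at 1; unfold L in *; lra.
(* The degenerate direction: dividing [D = K L] by [V1 - V'] and by [W1], nearly [0.24 y] and
   [0.25 z], gives the constants 201 and 193, as [48 / 0.2399] and [48 / 0.2499] rounded up. *)
- refine (Rlt_not_le _ _ small _).
  assert (b1 : 0 <= INR b) by apply pos_INR.
  rewrite DE in bV, cW.
  apply degenerate_bound with a b; try assumption.
  + change (INR b <= 201 * (lam * L)).
    apply Rmult_le_reg_r with y; [assumption |].
    replace (201 * (lam * L) * y) with (201 * (y * lam) * L) by ring; rewrite yE.
    assert (INR b * (2399 / 10000 * y) <= INR b * (INR V1 - INR V')) by (apply Rmult_le_compat_l; lra). lra.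
  + set (c := Rabs (INR b * INR N - INR a * INR k)) in *; change (c <= 193 * (A * L)).
    apply Rmult_le_reg_r with z; [assumption |].
    replace (193 * (A * L) * z) with (193 * (z * A) * L) by ring; rewrite zE.
    assert (c0 : 0 <= c) by apply Rabs_pos.
    assert (c * (2499 / 10000 * z) <= c * INR W1) by (apply Rmult_le_compat_l; lra). lra.
Qed.

(** * Fibonacci numbers that are products of three repdigits *)

Lemma Rabs_le_exp_sub1 (z : R) : Rabs (exp z - 1) <= 1 / 2 -> Rabs z <= 2 * Rabs (exp z - 1).
Proof.
intros h; pose proof (exp_ineq1_le z) as e1; pose proof (exp_ineq1_le (- z)) as e2.
rewrite exp_Ropp in e2; pose proof (exp_pos z) as e0.
assert (i : / exp z * exp z = 1) by (apply Rinv_l; lra).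
apply Rabs_bounds in h.
assert (e3 : / exp z <= 2).
{ apply Rmult_le_reg_r with (exp z); [assumption | lra]. }
destruct (Rle_lt_dec 0 z) as [z0 | z0].
- rewrite !Rabs_pos_eq; lra.
- assert (exp z < 1) by (rewrite <- exp_0; now apply exp_increasing).
  rewrite (Rabs_left z), (Rabs_left (exp z - 1)) by lra.
  assert (- z <= / exp z * (1 - exp z)) by lra.
  assert (/ exp z * (1 - exp z) <= 2 * (1 - exp z)) by (apply Rmult_le_compat_r; lra). lra.
Qed.

Lemma ln16_le : ln 16 <= 3.
Proof.
replace 16 with (2 * (2 * (2 * 2))) by ring; rewrite !ln_mult by lra; pose proof ln2_le; lra.
Qed.

Lemma sq5_le_exp1 : sq5 <= exp 1.
Proof.
pose proof gold_quadratic as gq; pose proof one_lt_gold as g1.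
assert (gold <= 1625 / 1000) by nra.
change sq5 with (2 * gold - 1).
replace 1 with (1 / 2 + 1 / 2) at 2 by field; rewrite exp_plus.
pose proof (exp_ineq1_le (1 / 2)); nra.
Qed.

(** The equation gives [exp Lam (1 - de) = Pr], so [Lam] is of size [g^(1 - i)], and
    [three_log_bound] limits [i]. The height [A] comes from [p <= g^(3 + s)] and [q <= g^3]. *)
Lemma linear_form_step (g k N p q t s i : nat) (Pr de : R) :
  let lam := ln (INR g) in let L := 6 * INR t in
  (1 < g)%nat -> (0 < p)%nat -> (0 < q)%nat -> (1 <= k)%nat -> 100 <= INR t ->
  INR p <= INR g ^ (3 + s) -> INR q <= INR g ^ 3 -> 4 * (ln (INR k) + 2) <= 3 * INR t ->
  sq5 * INR p * INR g ^ N * Pr = INR q * gold ^ k * (1 - de) ->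
  1 - 3 / INR g ^ i <= Pr <= 1 -> Rabs de <= INR g / INR g ^ i -> Rabs de <= 1 / 2 ->
  INR i * lam <= INR k * eta + lam ->
  INR i * lam <= 190000 * (lam * ((INR s + 6 * L) * lam) * (L * L) * L) + 3 + lam.
Proof.
intros lam L g1 p0 q0 k1 t100 pG qG tk eq PrB deG de2 ik.
pose proof (lambda_ge g g1) as lam1; fold lam in lam1.
pose proof eta_ge as e1; pose proof eta_le as e2.
set (A := (INR s + 6 * L) * lam).
assert (s0 : 0 <= INR s) by apply pos_INR.
assert (L1 : 600 <= L) by (unfold L; lra).
assert (AL : 6 * (lam * L) <= A).
{ unfold A; assert (0 <= INR s * lam) by (apply Rmult_le_pos; lra). lra. }
assert (lL : 69 / 100 * L <= lam * L) by (apply Rmult_le_compat_r; lra).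
assert (A0 : 2484 <= A) by lra.
assert (A3 : (3 + INR s) * lam + 1 <= A).
{ unfold A; assert (414 * lam <= L * lam) by (apply Rmult_le_compat_r; lra). lra. }
set (P := lam * A * (L * L)).
assert (P0 : 0 <= P) by (repeat apply Rmult_le_pos; lra).
assert (PL : 600 * P <= P * L) by (rewrite (Rmult_comm 600); apply Rmult_le_compat_l; lra).
(* For [k] too small for [three_log_bound] the claim follows directly from
   [i lam <= k eta + lam]. *)
destruct (Rle_lt_dec (INR k) (100000 * P)) as [ksmall | kbig].
{ assert (INR k * eta <= INR k * (482 / 1000)) by (apply Rmult_le_compat_l; [apply pos_INR | lra]). lra. }
assert (g0 : 0 < INR g) by (apply (lt_INR 0); lia).
assert (gk : INR g = exp lam) by (unfold lam; rewrite exp_ln; auto).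
assert (p1 : 1 <= INR p) by (apply (le_INR 1); lia).
assert (q1 : 1 <= INR q) by (apply (le_INR 1); lia).
pose proof one_lt_gold as go1; pose proof sq5_pos as s5; pose proof sq5_le_exp1 as s5e.
assert (s51 : 1 <= sq5) by (change sq5 with (2 * gold - 1); lra).
assert (gpow : forall r, INR g ^ r = exp (INR r * lam)).
{ intros r; rewrite <- (exp_ln (INR g ^ r)) by now apply pow_lt.
  now rewrite ln_pow. }
assert (qA : INR q <= exp (3 * lam)) by (rewrite gpow in qG; simpl (INR 3) in qG; replace (3 * lam) with ((1 + 1 + 1) * lam) by ring; exact qG).
assert (pA : sq5 * INR p <= exp ((3 + INR s) * lam + 1)).
{ rewrite (Rplus_comm _ 1), exp_plus; apply Rmult_le_compat; try lra.
  rewrite gpow, plus_INR in pG; simpl (INR 3) in pG.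
  replace (3 + INR s) with (1 + 1 + 1 + INR s) by ring; exact pG. }
assert (lnq : 0 <= ln (INR q) <= 3 * lam).
{ split; [now apply ln_nonneg |]. rewrite <- (ln_exp (3 * lam)); apply ln_mono; lra. }
assert (lnp : 0 <= ln (sq5 * INR p) <= (3 + INR s) * lam + 1).
{ assert (1 * 1 <= sq5 * INR p) by (apply Rmult_le_compat; lra).
  split; [apply ln_nonneg; lra |]. rewrite <- (ln_exp ((3 + INR s) * lam + 1)); apply ln_mono; lra. }
assert (sl : 0 <= INR s * lam) by (apply Rmult_le_pos; lra).
assert (gam : ln (sq5 * INR p / INR q) = ln (sq5 * INR p) - ln (INR q)).
{ unfold Rdiv; rewrite ln_mult, ln_Rinv; try lra; [apply Rmult_lt_0_compat; lra | apply Rinv_0_lt_compat; lra]. }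
assert (bound := three_log_bound g k N p q t A g1 p0 q0 t100 tk AL).
cbv zeta in bound; fold lam L P in bound.
set (Lam := INR k * eta - INR N * lam - ln (sq5 * INR p / INR q)) in *.
assert (low : exp (- (190000 * (P * L))) <= Rabs Lam).
{ apply bound; [rewrite gam; apply Rabs_le; lra | | | exact kbig].
  - apply Rle_trans with (1 := pA), exp_le; lra.
  - apply Rle_trans with (1 := qA), exp_le; lra. }
assert (eL : exp Lam * (1 - de) = Pr).
{ assert (gp : gold ^ k = exp (INR k * eta)).
  { change eta with (ln gold).
    rewrite <- (exp_ln (gold ^ k)) by (apply pow_lt; lra). now rewrite ln_pow by lra. }
  assert (e : exp Lam = gold ^ k * INR q / (INR g ^ N * (sq5 * INR p))).
  { unfold Lam, Rminus; rewrite !exp_plus, !exp_Ropp, <- gp, <- gpow, exp_ln.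
    - field; repeat split; try lra. apply pow_nonzero; lra.
    - apply Rdiv_lt_0_compat; [apply Rmult_lt_0_compat |]; lra. }
  rewrite e; assert (0 < INR g ^ N) by now apply pow_lt.
  apply Rmult_eq_reg_l with (sq5 * INR p * INR g ^ N).
  - rewrite eq; field; repeat split; lra.
  - apply Rgt_not_eq; repeat apply Rmult_lt_0_compat; lra. }
set (gi := INR g ^ i) in *.
assert (gi0 : 0 < gi) by now apply pow_lt.
assert (deB := Rabs_bounds _ _ de2); assert (deB' := Rabs_bounds _ _ deG).
assert (x3 : 3 / gi <= 3 * (INR g / gi)).
{ replace (3 * (INR g / gi)) with (3 * INR g / gi) by (field; lra).
  apply Rmult_le_compat_r; [left; now apply Rinv_0_lt_compat |].
  assert (1 <= INR g) by (apply (le_INR 1); lia). lra. }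
set (x := INR g / gi) in *.
(* [Pr] contributes [3 x] and [de] contributes [x]; dividing by [1 - de >= 1 / 2] doubles the
   sum. *)
assert (close : Rabs (exp Lam - 1) <= 8 * x).
{ assert (h : (exp Lam - 1) * (1 - de) = Pr - 1 + de) by (rewrite <- eL; ring).
  assert (x0 : 0 < x) by (apply Rdiv_lt_0_compat; lra).
  assert (b1 : 8 * x * (1 / 2) <= 8 * x * (1 - de)) by (apply Rmult_le_compat_l; lra).
  apply Rabs_le; split; apply Rmult_le_reg_r with (1 - de); lra. }
assert (lx : INR i * lam = lam - ln x).
{ unfold x, Rdiv; rewrite ln_mult, ln_Rinv; [| lra | lra | apply Rinv_0_lt_compat; lra].
  unfold gi; rewrite ln_pow by lra; fold lam; ring. }
assert (x0 : 0 < x) by (apply Rdiv_lt_0_compat; lra).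
assert (l16 := ln16_le).
(* Near 1 the logarithm costs another factor 2, and [ln 16 <= 3] becomes the summand 3 of the
   conclusion. Otherwise [x] is bounded below, which bounds [i] at once. *)
destruct (Rle_lt_dec (8 * x) (1 / 2)) as [xs | xb].
- assert (Rabs Lam <= 16 * x).
  { assert (Rabs Lam <= 2 * Rabs (exp Lam - 1)) by (apply Rabs_le_exp_sub1; lra). lra. }
  assert (- (190000 * (P * L)) <= ln (16 * x)).
  { rewrite <- (ln_exp (- _)); apply ln_mono; [apply exp_pos | lra]. }
  rewrite ln_mult in H0 by lra. lra.
- assert (0 <= ln (16 * x)) by (apply ln_nonneg; lra).
  rewrite ln_mult in H by lra. lra.
Qed.

Lemma gold_conj_quadratic : (1 - gold) * (1 - gold) = (1 - gold) + 1.
Proof. pose proof gold_quadratic; lra. Qed.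

Lemma fib_binet (k : nat) : sq5 * INR (fib k) = gold ^ k - (1 - gold) ^ k.
Proof.
pose proof gold_quadratic as gq; pose proof gold_conj_quadratic as cq.
change sq5 with (2 * gold - 1).
enough (h : (2 * gold - 1) * INR (fib k) = gold ^ k - (1 - gold) ^ k /\
  (2 * gold - 1) * INR (fib (S k)) = gold ^ S k - (1 - gold) ^ S k) by apply h.
induction k as [| k [h1 h2]]; [simpl; lra |].
split; [exact h2 |].
change (fib (S (S k))) with (fib (S k) + fib k)%nat.
rewrite plus_INR, Rmult_plus_distr_l, h1, h2; simpl.
replace (gold * (gold * gold ^ k)) with (gold * gold * gold ^ k) by ring.
replace ((1 - gold) * ((1 - gold) * (1 - gold) ^ k)) with ((1 - gold) * (1 - gold) * (1 - gold) ^ k) by ring.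
rewrite gq, cq; ring.
Qed.

Lemma fib_le_gold (k : nat) : INR (fib k) <= gold ^ k.
Proof.
pose proof gold_quadratic as gq; pose proof one_lt_gold as g1.
enough (h : INR (fib k) <= gold ^ k /\ INR (fib (S k)) <= gold ^ S k) by apply h.
induction k as [| k [h1 h2]]; [simpl; lra |].
split; [exact h2 |].
change (fib (S (S k))) with (fib (S k) + fib k)%nat; rewrite plus_INR.
replace (gold ^ S (S k)) with (gold ^ S k + gold ^ k); [lra |].
simpl; replace (gold * (gold * gold ^ k)) with (gold * gold * gold ^ k) by ring; rewrite gq; ring.
Qed.

Lemma gold_le_fib (k : nat) : (1 <= k)%nat -> gold ^ k <= gold * gold * INR (fib k).
Proof.
pose proof gold_quadratic as gq; pose proof one_lt_gold as g1.
intros k1; destruct k as [| k]; [lia |]; clear k1.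
enough (h : gold ^ S k <= gold * gold * INR (fib (S k)) /\
  gold ^ S (S k) <= gold * gold * INR (fib (S (S k)))) by apply h.
induction k as [| k [h1 h2]]; [simpl; split; nra |].
split; [exact h2 |].
change (fib (S (S (S k)))) with (fib (S (S k)) + fib (S k))%nat; rewrite plus_INR.
replace (gold ^ S (S (S k))) with (gold ^ S (S k) + gold ^ S k); [lra |].
change (gold ^ S (S (S k))) with (gold * (gold * gold ^ S k)).
change (gold ^ S (S k)) with (gold * gold ^ S k).
replace (gold * (gold * gold ^ S k)) with (gold * gold * gold ^ S k) by ring; rewrite gq; ring.
Qed.

Lemma geometric_nat (g m : nat) : (1 <= g)%nat -> exists r,
  (g ^ m - 1 = (g - 1) * r)%nat /\ ((1 <= m)%nat -> (g ^ (m - 1) <= r)%nat).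
Proof.
intros g1; induction m as [| m [r [IH le]]]; [exists 0%nat; simpl; split; lia |].
exists (g ^ m + r)%nat; split; [| intros _; simpl; rewrite Nat.sub_0_r; lia].
assert (1 <= g ^ m)%nat by (apply Nat.neq_0_lt_0, Nat.pow_nonzero; lia).
rewrite Nat.mul_add_distr_l, <- IH; simpl; nia.
Qed.

Lemma repdigit_spec (g d m : nat) : (2 <= g)%nat -> (1 <= d)%nat -> (1 <= m)%nat ->
  ((g - 1) * repdigit g d m = d * (g ^ m - 1) /\ g ^ (m - 1) <= repdigit g d m)%nat.
Proof.
intros g2 d1 m1; destruct (geometric_nat g m ltac:(lia)) as [r [e le]].
unfold repdigit; rewrite e, (Nat.mul_comm (g - 1) r), Nat.div_mul by lia.
specialize (le m1); split; nia.
Qed.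

Lemma small_pow_ratio (k : nat) : Rabs ((1 - gold) ^ k / gold ^ k) <= / gold ^ k.
Proof.
pose proof gold_quadratic as gq; pose proof one_lt_gold as g1.
assert (g0 : 0 < gold ^ k) by (apply pow_lt; lra).
unfold Rdiv; rewrite Rabs_mult, (Rabs_pos_eq (/ _)) by (left; now apply Rinv_0_lt_compat).
rewrite <- (Rmult_1_l (/ gold ^ k)) at 2.
apply Rmult_le_compat_r; [left; now apply Rinv_0_lt_compat |].
rewrite <- RPow_abs; apply Rle_trans with (1 ^ k); [| rewrite pow1; apply Rle_refl].
apply pow_incr; assert (gold < 2) by nra; split; [apply Rabs_pos | apply Rabs_le; lra].
Qed.

Lemma one_sub_inv_pow (g i : nat) : (1 < g)%nat ->
  INR (g ^ i - 1) = INR g ^ i * (1 - / INR g ^ i) /\ 0 < / INR g ^ i <= 1.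
Proof.
intros g1; assert (1 <= g ^ i)%nat by (apply Nat.neq_0_lt_0, Nat.pow_nonzero; lia).
assert (0 < INR g ^ i) by (apply pow_lt, (lt_INR 0); lia).
assert (1 <= INR g ^ i) by (rewrite <- pow_INR; now apply (le_INR 1)).
rewrite minus_INR, pow_INR by assumption; split; [simpl; field; lra |].
split; [now apply Rinv_0_lt_compat | rewrite <- Rinv_1; now apply Rinv_le_contravar; lra].
Qed.

Lemma inv_pow_anti (g i j : nat) : (1 < g)%nat -> (i <= j)%nat -> / INR g ^ j <= / INR g ^ i.
Proof.
intros g1 ij; assert (1 <= INR g) by (apply (le_INR 1); lia).
apply Rinv_le_contravar; [apply pow_lt; lra | now apply Rle_pow].
Qed.

(** * The equation and the successive bounds for its exponents *)

Section Equation.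

Variables (g k d1 d2 d3 l m n t : nat).
Hypotheses (hg : (1 < g)%nat) (hk : (1 <= k)%nat) (hl : (1 <= l)%nat) (hlm : (l <= m)%nat)
  (hmn : (m <= n)%nat)
  (hd1 : (1 <= d1 <= g - 1)%nat) (hd2 : (1 <= d2 <= g - 1)%nat) (hd3 : (1 <= d3 <= g - 1)%nat)
  (heq : (fib k = repdigit g d1 l * repdigit g d2 m * repdigit g d3 n)%nat).

Let lam := ln (INR g).
Let D := (d1 * d2 * d3)%nat.

Lemma cleared_equation :
  ((g - 1) ^ 3 * fib k = D * ((g ^ l - 1) * (g ^ m - 1) * (g ^ n - 1)))%nat.
Proof.
destruct (repdigit_spec g d1 l) as [e1 _]; [lia .. |].
destruct (repdigit_spec g d2 m) as [e2 _]; [lia .. |].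
destruct (repdigit_spec g d3 n) as [e3 _]; [lia .. |].
rewrite heq; unfold D.
transitivity (((g - 1) * repdigit g d1 l) * ((g - 1) * repdigit g d2 m) * ((g - 1) * repdigit g d3 n))%nat.
- simpl; ring.
- rewrite e1, e2, e3; ring.
Qed.

Lemma pow_le_fib : INR g ^ (n - 1) <= INR (fib k).
Proof.
destruct (repdigit_spec g d1 l) as [_ e1]; [lia .. |].
destruct (repdigit_spec g d2 m) as [_ e2]; [lia .. |].
destruct (repdigit_spec g d3 n) as [_ e3]; [lia .. |].
assert (1 <= g ^ (l - 1))%nat by (apply Nat.neq_0_lt_0, Nat.pow_nonzero; lia).
assert (1 <= g ^ (m - 1))%nat by (apply Nat.neq_0_lt_0, Nat.pow_nonzero; lia).
rewrite <- pow_INR; apply le_INR; rewrite heq.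
apply Nat.le_trans with (1 * 1 * g ^ (n - 1))%nat; [lia |].
repeat apply Nat.mul_le_mono; lia.
Qed.

Lemma fib_le_pow : INR (fib k) <= INR g ^ (l + m + n).
Proof.
rewrite <- pow_INR; apply le_INR.
apply Nat.mul_le_mono_pos_l with ((g - 1) ^ 3)%nat; [apply Nat.neq_0_lt_0, Nat.pow_nonzero; lia |].
rewrite cleared_equation, !Nat.pow_add_r; apply Nat.mul_le_mono.
- unfold D; simpl; rewrite Nat.mul_1_r, Nat.mul_assoc; repeat apply Nat.mul_le_mono; lia.
- repeat apply Nat.mul_le_mono; lia.
Qed.

Lemma n_le_k : INR n * lam <= INR k * eta + lam.
Proof.
pose proof one_lt_gold as g1.
assert (g0 : 0 < INR g) by (apply (lt_INR 0); lia).
assert (h : INR g ^ (n - 1) <= gold ^ k) by (eapply Rle_trans; [apply pow_le_fib | apply fib_le_gold]).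
apply ln_mono in h; [| now apply pow_lt].
rewrite !ln_pow, minus_INR in h by (lra || lia); simpl in h.
change (ln gold) with eta in h; fold lam in h; lra.
Qed.

(** From [gold^(k - 2) <= fib k <= g^(3 n)], with [3 / 0.48 = 6.25]. *)
Lemma k_le_n : INR k <= 625 / 100 * (INR n * lam) + 2.
Proof.
pose proof one_lt_gold as g1; pose proof eta_ge as e1.
assert (g0 : 0 < INR g) by (apply (lt_INR 0); lia).
assert (h : gold ^ k <= gold * gold * INR g ^ (l + m + n)).
{ eapply Rle_trans; [now apply gold_le_fib |].
  apply Rmult_le_compat_l; [nra | apply fib_le_pow]. }
apply ln_mono in h; [| apply pow_lt; lra].
assert (0 < gold * gold) by (apply Rmult_lt_0_compat; lra).
assert (0 < INR g ^ (l + m + n)) by now apply pow_lt.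
rewrite !ln_mult, !ln_pow, !plus_INR in h by lra.
change (ln gold) with eta in h; fold lam in h.
pose proof (lambda_ge g hg) as lg; fold lam in lg.
assert (INR l <= INR n) by (apply le_INR; lia).
assert (INR m <= INR n) by (apply le_INR; lia).
assert ((INR l + INR m + INR n) * lam <= 3 * INR n * lam) by (apply Rmult_le_compat_r; lra).
destruct (Rle_lt_dec (INR k) 2) as [k2 | k2].
- assert (0 <= INR n * lam) by (apply Rmult_le_pos; [apply pos_INR | lra]); lra.
- assert ((INR k - 2) * (48 / 100) <= (INR k - 2) * eta) by (apply Rmult_le_compat_l; lra). lra.
Qed.

Hypothesis n2 : (2 <= n)%nat.
Let q := ((g - 1) ^ 3)%nat.
Let de := (1 - gold) ^ k / gold ^ k.

(** [|de|] is at most [gold^(-k)], hence at most [1 / fib k] and [g^(1 - n)]; for [n >= 2] the last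
    is at most [1 / 2]. *)
Lemma conj_ratio_le (i : nat) : (i <= n)%nat -> Rabs de <= INR g / INR g ^ i /\ Rabs de <= 1 / 2.
Proof.
intros ni; pose proof one_lt_gold as g1.
assert (g2 : 2 <= INR g) by (apply (le_INR 2); lia).
assert (h : Rabs de <= / INR g ^ (n - 1)).
{ eapply Rle_trans; [apply small_pow_ratio |].
  apply Rinv_le_contravar; [apply pow_lt; lra |].
  eapply Rle_trans; [apply pow_le_fib | apply fib_le_gold]. }
split; eapply Rle_trans; try exact h.
- replace (INR g / INR g ^ i) with (/ INR g ^ i * INR g) by (unfold Rdiv; ring).
  apply Rle_trans with (/ INR g ^ n * INR g).
  + replace n with (S (n - 1)) at 2 by lia; simpl; right; field; split; [apply pow_nonzero |]; lra.
  + apply Rmult_le_compat_r; [lra | now apply inv_pow_anti].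
- replace (1 / 2) with (/ 2) by field; apply Rinv_le_contravar; [lra |].
  apply Rle_trans with (INR g ^ 1); [simpl; lra | apply Rle_pow; [lra | lia]].
Qed.

Lemma real_equation : INR q * gold ^ k * (1 - de) =
  sq5 * INR D * (INR (g ^ l - 1) * INR (g ^ m - 1) * INR (g ^ n - 1)).
Proof.
pose proof one_lt_gold as g1.
replace (INR q * gold ^ k * (1 - de)) with (INR q * (gold ^ k - (1 - gold) ^ k)).
- rewrite <- fib_binet, Rmult_assoc, <- !mult_INR, <- cleared_equation, mult_INR; fold q; ring.
- unfold de; field; apply pow_nonzero; lra.
Qed.

Lemma repdigit_coeffs : (0 < D)%nat /\ (0 < q)%nat /\ (D <= g ^ 3)%nat /\ (q <= g ^ 3)%nat.
Proof.
assert (D = d1 * d2 * d3)%nat by reflexivity.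
repeat split.
- unfold D; nia.
- apply Nat.neq_0_lt_0, Nat.pow_nonzero; lia.
- unfold D; simpl; rewrite Nat.mul_1_r, Nat.mul_assoc; repeat apply Nat.mul_le_mono; lia.
- apply Nat.pow_le_mono_l; lia.
Qed.

Hypotheses (t100 : 100 <= INR t) (tk : 4 * (ln (INR k) + 2) <= 3 * INR t).
Let L := 6 * INR t.
Let bd s := 190000 * (lam * ((s + 6 * L) * lam) * (L * L) * L) + 3 + lam.

(** [p] collects [D] and the absorbed factors, which together add at most [g^s]; [Pr] is the product
    of the at most three remaining factors [1 - g^(-j)] with [j >= i], whence the slack
    [3 / g^i]. *)
Lemma index_step (p N s i : nat) (Pr : R) : (i <= n)%nat -> (0 < p)%nat -> (p <= g ^ (3 + s))%nat ->
  sq5 * INR p * INR g ^ N * Pr =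
    sq5 * INR D * (INR (g ^ l - 1) * INR (g ^ m - 1) * INR (g ^ n - 1)) ->
  1 - 3 / INR g ^ i <= Pr <= 1 -> INR i * lam <= bd (INR s).
Proof.
intros ni p0 ps eq PrB; destruct repdigit_coeffs as [D0 [q0 [Dg qg]]].
destruct (conj_ratio_le i ni) as [c1 c2].
apply linear_form_step with k N p q Pr de; try assumption.
- rewrite <- pow_INR; now apply le_INR.
- rewrite <- pow_INR; now apply le_INR.
- now rewrite real_equation.
- eapply Rle_trans; [| apply n_le_k].
  apply Rmult_le_compat_r; [pose proof (lambda_ge g hg) as h; fold lam in h; lra | now apply le_INR].
Qed.

Lemma l_bound : INR l * lam <= bd 0.
Proof.
destruct repdigit_coeffs as [D0 [q0 [Dg qg]]].
destruct (one_sub_inv_pow g l hg) as [el bl]; destruct (one_sub_inv_pow g m hg) as [em bm].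
destruct (one_sub_inv_pow g n hg) as [en bn].
assert (ml := inv_pow_anti g l m hg hlm); assert (nl := inv_pow_anti g l n hg ltac:(lia)).
set (xl := / INR g ^ l) in *; set (xm := / INR g ^ m) in *; set (xn := / INR g ^ n) in *.
apply index_step with (p := D) (N := (l + m + n)%nat) (s := 0%nat) (Pr := (1 - xl) * (1 - xm) * (1 - xn));
  try assumption; try lia.
- rewrite el, em, en, !pow_add; ring.
- change (/ INR g ^ l) with xl; unfold Rdiv; change (/ INR g ^ l) with xl.
  assert (0 <= (1 - xl) * (1 - xm) <= 1) by nra.
  assert (1 - xl - xm <= (1 - xl) * (1 - xm)) by nra. nra.
Qed.

Lemma m_bound : INR m * lam <= bd (INR l).
Proof.
destruct repdigit_coeffs as [D0 [q0 [Dg qg]]].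
destruct (one_sub_inv_pow g m hg) as [em bm]; destruct (one_sub_inv_pow g n hg) as [en bn].
assert (nm := inv_pow_anti g m n hg hmn).
assert (l0 : (g ^ 1 <= g ^ l)%nat) by (apply Nat.pow_le_mono_r; lia).
set (xm := / INR g ^ m) in *; set (xn := / INR g ^ n) in *.
apply index_step with (p := (D * (g ^ l - 1))%nat) (N := (m + n)%nat) (Pr := (1 - xm) * (1 - xn));
  try assumption.
- simpl in l0; nia.
- rewrite Nat.pow_add_r; apply Nat.mul_le_mono; lia.
- rewrite em, en, mult_INR, !pow_add; ring.
- unfold Rdiv; change (/ INR g ^ m) with xm; nra.
Qed.

Lemma n_bound : INR n * lam <= bd (INR l + INR m).
Proof.
destruct repdigit_coeffs as [D0 [q0 [Dg qg]]].
destruct (one_sub_inv_pow g n hg) as [en bn].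
assert (l0 : (g ^ 1 <= g ^ l)%nat) by (apply Nat.pow_le_mono_r; lia).
assert (m0 : (g ^ 1 <= g ^ m)%nat) by (apply Nat.pow_le_mono_r; lia).
set (xn := / INR g ^ n) in *; rewrite <- plus_INR.
apply index_step with (p := (D * ((g ^ l - 1) * (g ^ m - 1)))%nat) (N := n) (Pr := 1 - xn); try lia.
- simpl in l0, m0; apply Nat.mul_pos_pos; [assumption | apply Nat.mul_pos_pos; lia].
- rewrite !Nat.pow_add_r; apply Nat.mul_le_mono; [lia | apply Nat.mul_le_mono; lia].
- rewrite en, !mult_INR; ring.
- unfold Rdiv; change (/ INR g ^ n) with xn; lra.
Qed.

(** With [Q] of order [lam L^3], the three bounds chain to [l] of order [Q L], [m] of order [Q^2 L]
    and [n] of order [Q^3 L]; the constant is [6.05 * 190000^3], rounded up. *)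
Lemma n_le_power : INR n <= 42 * 10 ^ 15 * lam ^ 3 * L ^ 10.
Proof.
assert (l1 := l_bound); assert (m1 := m_bound); assert (n1 := n_bound); unfold bd in *.
pose proof (lambda_ge g hg) as lg; fold lam in lg.
assert (L1 : 600 <= L) by (unfold L; lra).
set (Q := 190000 * (L * L * L) * lam).
assert (LL : 360000 <= L * L) by nra.
assert (LLL : 216000000 <= L * L * L) by nra.
assert (Q1 : 10 ^ 13 <= Q).
{ unfold Q; apply Rle_trans with (190000 * 216000000 * (69 / 100)); [lra |].
  apply Rmult_le_compat; lra. }
(* The 6 is an upper bound for [(3 + lam) / lam], as [lam >= 0.69]. *)
assert (red : forall x s, INR x * lam <= 190000 * (lam * ((s + 6 * L) * lam) * (L * L) * L) + 3 + lam ->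
   INR x <= Q * (s + 6 * L) + 6).
{ intros x s h; apply Rmult_le_reg_r with lam; [lra |].
  replace ((Q * (s + 6 * L) + 6) * lam) with (190000 * (lam * ((s + 6 * L) * lam) * (L * L) * L) + 6 * lam)
    by (unfold Q; ring). lra. }
apply red in l1, m1, n1.
assert (QL : 600 * Q <= Q * L) by (rewrite (Rmult_comm 600); apply Rmult_le_compat_l; lra).
assert (QQ : 10 ^ 13 * Q <= Q * Q) by (apply Rmult_le_compat_r; lra).
assert (QQL : 10 ^ 13 * (Q * L) <= Q * Q * L).
{ rewrite <- Rmult_assoc; apply Rmult_le_compat_r; lra. }
assert (QQQL : 10 ^ 13 * (Q * Q * L) <= Q * Q * Q * L).
{ rewrite <- Rmult_assoc; apply Rmult_le_compat_r; [lra |].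
  rewrite <- Rmult_assoc; apply Rmult_le_compat_r; lra. }
assert (m2 : INR m <= 601 / 100 * (Q * Q * L)).
{ assert (Q * (INR l + 6 * L) <= Q * (Q * (0 + 6 * L) + 6 + 6 * L)) by (apply Rmult_le_compat_l; lra). lra. }
assert (n2' : INR n <= 605 / 100 * (Q * Q * Q * L)).
{ assert (Q * (INR l + INR m + 6 * L) <= Q * (602 / 100 * (Q * Q * L) + 6 * L)) by (apply Rmult_le_compat_l; lra).
  lra. }
eapply Rle_trans; [exact n2' |].
replace (605 / 100 * (Q * Q * Q * L)) with (605 / 100 * 190000 ^ 3 * (lam ^ 3 * L ^ 10)) by (unfold Q; ring).
rewrite (Rmult_assoc (42 * 10 ^ 15)).
apply Rmult_le_compat_r; [apply Rmult_le_pos; apply pow_le; lra | lra].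
Qed.

End Equation.

(** * Comparison of powers with logarithms *)

Lemma ln10_le : ln 10 <= 695 / 300.
Proof.
pose proof ln2_le as l2.
assert (h : ln (10 ^ 3) <= ln (2 ^ 10)) by (apply ln_mono; lra).
rewrite !ln_pow in h by lra; simpl in h; lra.
Qed.

(* [1300 lambda^(3/5) (n / N)^(1/10)], with [N = 1.08 10^48 lambda^9], dominates
   [8 log k + 22] because [exp z >= 1 + z]. *)
Lemma log_dominated (k n : nat) (lam : R) : let N := 108 / 100 * 10 ^ 48 * lam ^ 9 in
  69 / 100 <= lam -> N <= INR n -> (1 <= k)%nat -> INR k <= 625 / 100 * (INR n * lam) + 2 ->
  exists r, 0 < r /\ r ^ 10 * N = lam ^ 6 * INR n /\ Rmax 600 (8 * ln (INR k) + 22) <= 1300 * r.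
Proof.
intros N lg nN k1 kn.
set (v := ln lam); set (w := ln (INR n) - ln N).
assert (l9 : (69 / 100) ^ 9 <= lam ^ 9) by (apply pow_incr; lra).
assert (l90 : 0 < lam ^ 9) by (apply pow_lt; lra).
assert (N1 : 10 ^ 46 <= N) by (unfold N; lra).
assert (n0 : 0 < INR n) by lra.
assert (nl : 10 <= INR n * lam).
{ apply Rle_trans with (INR n * (69 / 100)); [lra | apply Rmult_le_compat_l; lra]. }
assert (v0 : - (45 / 100) <= v).
{ rewrite <- (ln_exp (- (45 / 100))); apply ln_mono; [apply exp_pos |].
  apply Rle_trans with (69 / 100); [| exact lg].
  rewrite exp_Ropp, <- (Rinv_inv (69 / 100)); apply Rinv_le_contravar; [lra |].
  apply Rle_trans with (1 + 45 / 100); [lra | apply exp_ineq1_le]. }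
assert (w0 : 0 <= w) by (unfold w; assert (ln N <= ln (INR n)) by (apply ln_mono; lra); lra).
assert (lN : ln N <= 11128 / 100 + 9 * v).
{ unfold N; rewrite !ln_mult, !ln_pow by (try apply pow_lt; lra).
  assert (ln (108 / 100) <= 8 / 100).
  { rewrite <- (ln_exp (8 / 100)); apply ln_mono; [lra |]; pose proof (exp_ineq1_le (8 / 100)); lra. }
  replace (INR 48) with 48 by (simpl; ring); replace (INR 9) with 9 by (simpl; ring).
  pose proof ln10_le; fold v; lra. }
assert (lk : ln (INR k) <= 2085 / 1000 + (ln (INR n) + v)).
{ apply Rle_trans with (ln (2 ^ 3 * (INR n * lam))).
  - apply ln_mono; [apply (lt_INR 0); lia | lra].
  - rewrite !ln_mult, ln_pow by (try apply pow_lt; try apply Rmult_lt_0_compat; lra).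
    pose proof ln2_le; simpl (INR 3); fold v; lra. }
exists (exp ((6 * v + w) / 10)); split; [apply exp_pos |]; split.
- rewrite <- (exp_ln (exp ((6 * v + w) / 10) ^ 10)) by apply pow_lt, exp_pos.
  rewrite ln_pow, ln_exp by apply exp_pos.
  rewrite <- (exp_ln N), <- (exp_ln (lam ^ 6)), <- (exp_ln (INR n)) by (try apply pow_lt; lra).
  rewrite <- !exp_plus; f_equal; rewrite ln_pow by lra.
  unfold w; fold v; simpl; field.
(* The comparison is between [1300 + 780 v + 130 w] and about [929 + 80 v + 8 w]; the worst case
   [v = - 0.45], [w = 0] leaves 949 against 893. *)
- pose proof (exp_ineq1_le ((6 * v + w) / 10)); unfold w in *; apply Rmax_lub; lra.
Qed.

(** [t] exceeds [4 / 3 * (ln k + 2)] by at most 1 unless the floor 100 takes over, so [6 t] is at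
    most [8 (ln k + 2) + 6] or 600. *)
Lemma parameter_exists (k : nat) : (1 <= k)%nat -> exists t, 100 <= INR t /\
  4 * (ln (INR k) + 2) <= 3 * INR t /\ 6 * INR t <= Rmax 600 (8 * ln (INR k) + 22).
Proof.
intros k1; assert (l0 : 0 <= ln (INR k)) by (apply ln_nonneg, (le_INR 1); exact k1).
destruct (nat_floor (4 / 3 * (ln (INR k) + 2))) as [s sB]; [lra |].
assert (hundred : INR 100 = 100) by (simpl; ring); pose proof (S_INR s) as sS.
destruct (Nat.le_ge_cases (S s) 100) as [h | h]; [exists 100%nat | exists (S s)];
  apply le_INR in h; rewrite hundred in *.
- split; [lra | split; [lra |]]. apply Rle_trans with 600; [lra | apply Rmax_l].
- split; [lra | split; [lra |]].
  apply Rle_trans with (8 * ln (INR k) + 22); [lra | apply Rmax_r].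
Qed.

End Estimates.

Import Estimates.

Theorem theorem1p1 (g : nat) (hg : 2 <= g)
  (k d1 d2 d3 l m n : nat)
  (hk : 1 <= k) (hl : 1 <= l) (hm : 1 <= m) (hn : 1 <= n)
  (hd1 : 1 <= d1 <= g - 1) (hd2 : 1 <= d2 <= g - 1) (hd3 : 1 <= d3 <= g - 1)
  (hlm : l <= m) (hmn : m <= n)
  (heq : fib k = repdigit g d1 l * repdigit g d2 m * repdigit g d3 n) :
  (INR n < (108 / 100) * 10 ^ 48 * (ln (INR g)) ^ 9)%R /\
  (INR k < (108 / 100) * 10 ^ 49 * (ln (INR g)) ^ 10)%R.
Proof.
Local Open Scope R_scope.
set (lam := ln (INR g)).
assert (lg : 69 / 100 <= lam) by now apply lambda_ge.
assert (kn := k_le_n g k d1 d2 d3 l m n hg hk hl hlm hmn hd1 hd2 hd3 heq); fold lam in kn.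
assert (l9 : (69 / 100) ^ 9 <= lam ^ 9) by (apply pow_incr; lra).
assert (nlt : INR n < 108 / 100 * 10 ^ 48 * lam ^ 9).
(* If [n >= N], the bound of [n] by [L^10], with [L <= 1300 r] and [r^10 N = lam^6 n], becomes
   linear in [n], so [n] cancels. *)
{ apply Rnot_le_lt; intros nN.
  assert (n2 : (2 <= n)%nat) by (apply INR_le; simpl; lra).
  destruct (log_dominated k n lam lg nN hk kn) as [r [r0 [rE rL]]].
  destruct (parameter_exists k hk) as [t [t100 [tk tL]]].
  assert (npow := n_le_power g k d1 d2 d3 l m n t hg hk hl hlm hmn hd1 hd2 hd3 heq n2 t100 tk).
  fold lam in npow.
  assert (Lr : (6 * INR t) ^ 10 <= (1300 * r) ^ 10) by (apply pow_incr; lra).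
  assert (l3 : 0 < lam ^ 3) by (apply pow_lt; lra).
  set (N := 108 / 100 * 10 ^ 48 * lam ^ 9) in *.
  assert (N0 : 0 < N) by (unfold N; lra).
  assert (n0 : 0 < INR n) by lra.
  assert (npow2 : INR n <= 42 * 10 ^ 15 * lam ^ 3 * (1300 * r) ^ 10).
  { eapply Rle_trans; [exact npow |]. apply Rmult_le_compat_l; lra. }
  assert (npow3 : INR n * N <= 42 * 10 ^ 15 * lam ^ 3 * (1300 * r) ^ 10 * N).
  { apply Rmult_le_compat_r; [unfold N; lra | exact npow2]. }
  replace (42 * 10 ^ 15 * lam ^ 3 * (1300 * r) ^ 10 * N)
    with (42 * 10 ^ 15 * 1300 ^ 10 * lam ^ 3 * (r ^ 10 * N)) in npow3 by ring.
  rewrite rE in npow3.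
  replace (42 * 10 ^ 15 * 1300 ^ 10 * lam ^ 3 * (lam ^ 6 * INR n))
    with (INR n * (42 * 10 ^ 15 * 1300 ^ 10 * lam ^ 9)) in npow3 by ring.
  (* Numerically [42 * 10^15 * 1300^10 < 5.8 * 10^47], which is below [1.08 * 10^48]. *)
  apply Rmult_le_reg_l in npow3; [| exact n0]. unfold N in npow3; lra. }
split; [exact nlt |].
(* The bound for [k] follows from [k <= 6.25 n lam + 2], with 6.25 well below 10. *)
assert (INR n * lam < 108 / 100 * 10 ^ 48 * lam ^ 9 * lam) by (apply Rmult_lt_compat_r; lra).
assert (l10 : (69 / 100) ^ 10 <= lam ^ 10) by (apply pow_incr; lra).
replace (108 / 100 * 10 ^ 48 * lam ^ 9 * lam) with (108 / 100 * 10 ^ 48 * lam ^ 10) in H by ring.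
lra.
Qed.
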